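(* Fix $N>0$ and let $T$ be a Fibonacci set of rank $N$. Let $S_1\prec S_2\prec\dots\prec S_k$ be the list of predecessors of $T$ in $\mathbb{YFS}_{N-1}$ (those $S\in\mathbb{YFS}_{N-1}$ with $S\lessdot T$), sorted by dominance order. For $i=1,\dots,k$ let $V^T_{\le i}\subseteq V^T$ be the span of the rank $N$ Okada half arc-diagrams $H$ (with $\mathrm{PropLab}(H)=T$) such that $\mathrm{PropLab}(H/[N-1])\preceq S_i$, and let $V^T_{\le 0}$ be the zero vector space. Then the $V^T_{\le i}$ form an increasing sequence of $\mathbf{O}_{N-1}(X,Y)$-submodules $$0=V^T_{\le0}\subset V^T_{\le1}\subset\dots\subset V^T_{\le k}=V^T$$ such that $V^T_{\le i}/V^T_{\le i-1}\cong V^{S_i}$ for every $i=1,\dots,k$. In particular, if these modules $V^{S_i}$ are simple given the choice of parameters $X,Y$ defining $\mathbf{O}_{N-1}(X,Y)$, the following isomorphism holds: $$\mathrm{Res}^{\mathbf{O}_N(X,Y)}_{\mathbf{O}_{N-1}(X,Y)}(V^T)\cong\bigoplus_{i=1}^kV^{S_i}\cong\bigoplus_{S\lessdot T}V^S .$$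
   Context: Let $\mathbb{K}$ be a field and let $X=(x_1,x_2,\dots)$, $Y=(y_1,y_2,\dots)$ be two fixed infinite sequences of generic scalars in $\mathbb{K}$. The Okada algebra $\mathbf{O}_N(X,Y)$ is the unital associative algebra generated by $E_1,\dots,E_{N-1}$ with relations $E_i^2=x_iE_i$, $E_iE_j=E_jE_i$ ($|i-j|\ge2$), $E_{i+1}E_iE_{i+1}=y_iE_{i+1}$ ($1\le i\le N-2$); $\mathbf{O}_{N-1}(X,Y)$ is the subalgebra generated by $E_1,\dots,E_{N-2}$. Okada arc-diagrams. Let $[N]=\{1,\dots,N\}$, $\overline{[N]}=\{\bar1,\dots,\bar N\}$, $|i|=|\bar i|=i$, ordered by $1<\dots<N<\bar N<\dots<\bar1$. A non-crossing arc-diagram of rank $N$ is a perfect matching of $[N]\cup\overline{[N]}$ (pairs are arcs) with no arcs $\{a,b\},\{c,d\}$ with $a<c<b<d$. Arc $\{a<b\}$ is nested in $\{c<d\}$ if $c<a<b<d$. An Okada arc-diagram is a non-crossing arc-diagram with integer labels on arcs such that the label of $\{a,b\}$ is at least $1$, at most $\min(|a|,|b|)$ and of the same parity as $\min(|a|,|b|)$, and an arc nested in another has a strictly larger label. Product $C\cdot D$: identify each node $\bar i$ of $C$ with node $i$ of $D$, concatenate arcs, discard closed loops, label each resulting arc by the minimum of the labels of the arcs composing it. $A_i$ has arcs $\{a,\bar a\}$ labelled $a$ for $a\ne i,i+1$ and arcs $\{i,i+1\}$, $\{\bar i,\overline{i+1}\}$ labelled $i$. For $\sigma\in\mathfrak{S}_N$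 let $c_i=\#\{k<i:\sigma^{-1}(k)>\sigma^{-1}(i)\}$; for $g_i=A_i$ or $E_i$ set $g_\sigma=\prod_{i=1}^N(g_{i-1}g_{i-2}\cdots g_{i-c_i})$, factors ordered with $i$ increasing. Then $\sigma\mapsto A_\sigma$ is a bijection onto rank $N$ Okada arc-diagrams; put $E_D:=E_\sigma$ for $D=A_\sigma$. The $E_D$ form a basis of $\mathbf{O}_N(X,Y)$ and $E_CE_D=\lambda(C,D)E_{C\cdot D}$ with scalars $\lambda(C,D)$. Half diagrams: the left half $|D\rangle$ of $D$ keeps the labelled arcs joining two nodes of $[N]$ and replaces each arc joining $i\in[N]$ to $\overline{[N]}$ by a propagating half arc at $i$ with the same label. Okada half arc-diagrams of rank $N$ are the left halves of rank $N$ Okada arc-diagrams. $\mathrm{PropLab}(H)$ (resp. $\mathrm{PropLab}(D)$) is the set of labels of propagating half arcs of $H$ (resp. of arcs of $D$ joining $[N]$ to $\overline{[N]}$). For $r\le N$, $H/[r]$ is the rank $r$ half diagram having a full arc $\{i,j\}$ labelled $\ell$ for each full arc of $H$ with $i,j\le r$ labelled $\ell$, and a propagating half arc at $i\le r$ labelled $\ell$ whenever $H$ has a full arc $\{i,j\}$ labelled $\ell$ with $i\le r<j$ or a propagating half arc at $i$ labelled $\ell$. Fibonacci sets: $\mathbb{YFS}_N$ is the set of subsets $S=\{s_1<\dots<s_k\}$ of $[N]$ with $k\equiv N\pmod2$ and $s_i\equiv i\pmod 2$ (with rank $N$ as part of the data). For $S\in\mathbb{YFS}_{N-1}$, $T\in\mathbb{YFS}_N$,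 $S\lessdot T$ ($S$ is covered by $T$, $S$ is a predecessor of $T$) means $T=S\setminus\{\max S\}$ or $S=T\setminus\{\max T\}$. Dominance order on Fibonacci sets of the same rank: $\{s_1<\dots<s_k\}\preceq\{t_1<\dots<t_l\}$ if $k\le l$ and $s_{k-i}\le t_{l-i}$ for $0\le i<k$. The predecessors of a Fibonacci set are totally ordered by it. Cell module: for $S\in\mathbb{YFS}_N$, $V^S$ is the left $\mathbf{O}_N(X,Y)$-module with basis the rank $N$ Okada half arc-diagrams with propagating label set $S$, and action $E_C\bullet|D\rangle=\lambda(C,D)|C\cdot D\rangle$ if $\mathrm{PropLab}(C\cdot D)=S$, and $0$ otherwise, where $D$ is any Okada arc-diagram with the given left half (the result does not depend on the choice). *)

(* Defs.v *)
From HB Require Import structures.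
From mathcomp Require Import all_boot all_order all_algebra all_fingroup finmap.
From mathcomp Require Import generic_quotient ring_quotient.
From mathcomp Require Import boolp classical_sets cardinality.

Set Implicit Arguments.
Unset Strict Implicit.
Unset Printing Implicit Defensive.

Import GRing.Theory.
Local Open Scope ring_scope.
Local Open Scope quotient_scope.

Section Modules.
Variables (R : nzRingType) (M : lmodType R).

Definition submod (U : submodClosed M) := {v : M | v \in U}.
HB.instance Definition _ U := SubChoice.on (submod U).
HB.instance Definition _ (U : submodClosed M) :=
  [SubChoice_isSubLmodule of submod U by <:].

Lemma submod_zmod_closed (U : submodClosed M) : zmod_closed U.
Proof.
split=> [|v w Uv Uw]; first exact: rpred0.
by rewrite -scaleN1r rpredD ?rpredZ.
Qed.

Definition submod_zmod (U : submodClosed M) : zmodClosed M :=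
  HB.pack (GRing.SubmodClosed.sort U)
    (GRing.isZmodClosed.Build M (GRing.SubmodClosed.sort U)
      (@submod_zmod_closed U)).

Definition quotmod (U : submodClosed M) : Type := Quotient.quot (submod_zmod U).
HB.instance Definition _ U := GRing.Zmodule.on (quotmod U).
HB.instance Definition _ U := EqQuotient.on (quotmod U).

Section Quotient.
Variable U : submodClosed M.
Local Notation Q := (quotmod U).

Definition quot_scale (a : R) (q : Q) : Q := \pi_Q (a *: repr q).

Lemma quot_scale_pi a (v : M) : quot_scale a (\pi_Q v) = \pi_Q (a *: v).
Proof.
apply/eqP; rewrite /quot_scale -Quotient.idealrBE -scalerBr.
have Uvw : repr (\pi_Q v) - v \in submod_zmod U.
  by rewrite Quotient.idealrBE reprK.
exact: (@rpredZ _ _ U).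
Qed.

Lemma pi_quotD (v w : M) : \pi_Q (v + w) = \pi_Q v + \pi_Q w.
Proof. by rewrite (Quotient.pi_add (submod_zmod U)). Qed.

Lemma quot_scaleA a b q : quot_scale a (quot_scale b q) = quot_scale (a * b) q.
Proof. by rewrite -[q]reprK (quot_scale_pi b) !quot_scale_pi scalerA. Qed.

Lemma quot_scale1 : left_id 1 quot_scale.
Proof. by move=> q; rewrite -[q]reprK quot_scale_pi scale1r. Qed.

Lemma quot_scaleDr : right_distributive quot_scale +%R.
Proof.
move=> a q r; rewrite -[q]reprK -[r]reprK; move: (repr q) (repr r) => v w.
by rewrite -pi_quotD !quot_scale_pi scalerDr pi_quotD.
Qed.

Lemma quot_scaleDl q : {morph quot_scale^~ q : a b / a + b}.
Proof.
move=> a b; rewrite -[q]reprK; move: (repr q) => v.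
by rewrite !quot_scale_pi scalerDl pi_quotD.
Qed.

HB.instance Definition _ := GRing.Zmodule_isLmodule.Build R Q
  quot_scaleA quot_scale1 quot_scaleDr quot_scaleDl.
End Quotient.

End Modules.

Definition resmod (R R' : nzRingType) (f : {rmorphism R -> R'})
  (M : lmodType R') : Type := M.

Section Restriction.
Variables (R R' : nzRingType) (f : {rmorphism R -> R'}) (M : lmodType R').
Local Notation resmod := (resmod f M).

HB.instance Definition _ := GRing.Zmodule.on resmod.

Definition res_scale (a : R) (v : resmod) : resmod := f a *: (v : M).

Lemma res_scaleA a b v : res_scale a (res_scale b v) = res_scale (a * b) v.
Proof. by rewrite /res_scale scalerA rmorphM. Qed.

Lemma res_scale1 : left_id 1 res_scale.
Proof. by move=> v; rewrite /res_scale rmorph1 scale1r. Qed.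

Lemma res_scaleDr : right_distributive res_scale +%R.
Proof. by move=> a v w; rewrite /res_scale scalerDr. Qed.

Lemma res_scaleDl v : {morph res_scale^~ v : a b / a + b}.
Proof. by move=> a b; rewrite /res_scale rmorphD scalerDl. Qed.

HB.instance Definition _ := GRing.Zmodule_isLmodule.Build R resmod
  res_scaleA res_scale1 res_scaleDr res_scaleDl.
End Restriction.

Section DirectSum.
Variables (R : nzRingType) (I : Type) (M : I -> lmodType R).

Definition dprod : Type := forall i, M i.
HB.instance Definition _ := Choice.on dprod.

Let dprod0 : dprod := fun=> 0.
Let dprodN (u : dprod) : dprod := fun i => - u i.
Let dprodD (u v : dprod) : dprod := fun i => u i + v i.
Let dprodZ (a : R) (u : dprod) : dprod := fun i => a *: u i.

Let dprodDA : associative dprodD.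
Proof. by move=> u v w; apply: functional_extensionality_dep => i; exact: addrA. Qed.
Let dprodDC : commutative dprodD.
Proof. by move=> u v; apply: functional_extensionality_dep => i; exact: addrC. Qed.
Let dprod0D : left_id dprod0 dprodD.
Proof. by move=> u; apply: functional_extensionality_dep => i; exact: add0r. Qed.
Let dprodND : left_inverse dprod0 dprodN dprodD.
Proof. by move=> u; apply: functional_extensionality_dep => i; exact: addNr. Qed.
HB.instance Definition _ :=
  GRing.isZmodule.Build dprod dprodDA dprodDC dprod0D dprodND.

Let dprodZA a b u : dprodZ a (dprodZ b u) = dprodZ (a * b) u.
Proof. by apply: functional_extensionality_dep => i; exact: scalerA. Qed.
Let dprodZ1 : left_id 1 dprodZ.
Proof. by move=> u; apply: functional_extensionality_dep => i; exact: scale1r. Qed.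
Let dprodZDr : right_distributive dprodZ +%R.
Proof.
by move=> a u v; apply: functional_extensionality_dep => i; exact: scalerDr.
Qed.
Let dprodZDl u : {morph dprodZ^~ u : a b / a + b}.
Proof.
by move=> a b; apply: functional_extensionality_dep => i; exact: scalerDl.
Qed.
HB.instance Definition _ := GRing.Zmodule_isLmodule.Build R dprod
  dprodZA dprodZ1 dprodZDr dprodZDl.

Definition finite_supp : {pred dprod} :=
  fun u => `[< finite_set [set i | u i <> 0] >].

Lemma finite_supp_submod : subsemimod_closed finite_supp.
Proof.
split; first split.
- apply/asboolP/(sub_finite_set _ (finite_set0 I)) => i /=; exact.
- move=> u v /asboolP fu /asboolP fv; apply/asboolP.
  apply: (@sub_finite_set _ _ ([set i | u i <> 0] `|` [set i | v i <> 0])%classic);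
    last by rewrite finite_setU.
  move=> i /= uv_neq0; have [u0|u_neq0] := pselect (u i = 0); last by left.
  by right=> v0; apply: uv_neq0; rewrite /GRing.add /= /dprodD u0 v0 addr0.
- move=> a u /asboolP fu; apply/asboolP; apply: sub_finite_set fu => i /= + u0.
  by apply; rewrite /GRing.scale /= /dprodZ u0 scaler0.
Qed.

HB.instance Definition _ :=
  GRing.isSubSemiModClosed.Build R dprod finite_supp finite_supp_submod.

(* Finitely supported families *)
Definition dsum : Type := submod (finite_supp : submodClosed dprod).
HB.instance Definition _ := GRing.Lmodule.on dsum.
End DirectSum.

(* [subquot U W] is U / (U `&` W); it is only used when W is contained in U. *)
Section Subquotient.
Variables (R : nzRingType) (M : lmodType R) (U W : submodClosed M).

Definition in_sub : {pred submod U} := fun v => val v \in W.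

Lemma in_sub_submod : subsemimod_closed in_sub.
Proof.
split; first split.
- exact: rpred0.
- by move=> v w; exact: (@rpredD _ W (val v) (val w)).
- by move=> a v; exact: (@rpredZ _ _ W a (val v)).
Qed.

HB.instance Definition _ :=
  GRing.isSubSemiModClosed.Build R (submod U) in_sub in_sub_submod.

Definition subquot : Type := quotmod (in_sub : submodClosed (submod U)).
HB.instance Definition _ := GRing.Lmodule.on subquot.
End Subquotient.

Definition mod_iso (R : nzRingType) (M N : lmodType R) : Prop :=
  exists f : {linear M -> N}, bijective f.

Definition simple_mod (R : nzRingType) (M : lmodType R) : Prop :=
  (exists v : M, v != 0) /\
  forall U : submodClosed M,
    (forall v, v \in U -> v = 0) \/ (forall v, v \in U).

Definition okada_index (N : nat) := {i : nat | (0 < i < N)%N}.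

(* Noncommutative polynomial expressions in the generators over K *)
Inductive okada_expr (K : Type) (N : nat) :=
| ECst of K
| EGen of okada_index N
| EAdd of okada_expr K N & okada_expr K N
| EMul of okada_expr K N & okada_expr K N.
Arguments ECst {K N}.
Arguments EGen {K N}.

HB.instance Definition _ K N := gen_eqMixin (okada_expr K N).
HB.instance Definition _ K N := gen_choiceMixin (okada_expr K N).

Section OkadaAlgebra.
Variables (K : fieldType) (X Y : nat -> K) (N : nat).
Local Notation expr := (okada_expr K N).

(* The least congruence containing the axioms of unital associative K-algebras
   and the defining relations; the quotient is the algebra presented by these
   generators and relations. *)
Inductive okada_rel : expr -> expr -> Prop :=
| ORefl a : okada_rel a a
| OSym a b : okada_rel a b -> okada_rel b a
| OTrans a b c : okada_rel a b -> okada_rel b c -> okada_rel a c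
| OAddCong a a' b b' : okada_rel a a' -> okada_rel b b' ->
    okada_rel (EAdd a b) (EAdd a' b')
| OMulCong a a' b b' : okada_rel a a' -> okada_rel b b' ->
    okada_rel (EMul a b) (EMul a' b')
| OAddA a b c : okada_rel (EAdd a (EAdd b c)) (EAdd (EAdd a b) c)
| OAddC a b : okada_rel (EAdd a b) (EAdd b a)
| OAdd0 a : okada_rel (EAdd (ECst 0) a) a
| OAddN a : okada_rel (EAdd (EMul (ECst (-1)) a) a) (ECst 0)
| OMulA a b c : okada_rel (EMul a (EMul b c)) (EMul (EMul a b) c)
| OMul1 a : okada_rel (EMul (ECst 1) a) a
| OMulDl a b c : okada_rel (EMul (EAdd a b) c) (EAdd (EMul a c) (EMul b c))
| OMulDr a b c : okada_rel (EMul a (EAdd b c)) (EAdd (EMul a b) (EMul a c))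
| OCstD k l : okada_rel (ECst (k + l)) (EAdd (ECst k) (ECst l))
| OCstM k l : okada_rel (ECst (k * l)) (EMul (ECst k) (ECst l))
| OCstC k a : okada_rel (EMul (ECst k) a) (EMul a (ECst k))
| OGenSq (i : okada_index N) :
    okada_rel (EMul (EGen i) (EGen i)) (EMul (ECst (X (val i))) (EGen i))
| OGenComm (i j : okada_index N) : ((val i).+2 <= val j)%N ->
    okada_rel (EMul (EGen i) (EGen j)) (EMul (EGen j) (EGen i))
| OGenBraid (i j : okada_index N) : val j = (val i).+1 ->
    okada_rel (EMul (EMul (EGen j) (EGen i)) (EGen j))
              (EMul (ECst (Y (val i))) (EGen j)).

Definition okada_relb : rel expr := fun a b => `[< okada_rel a b >].

Lemma okada_relb_equiv : equiv_class_of okada_relb.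
Proof.
split=> [a|a b|b a c].
- by apply/asboolP; exact: ORefl.
- by apply/asboolP/asboolP; exact: OSym.
- by move=> /asboolP ab /asboolP bc; apply/asboolP; exact: OTrans ab bc.
Qed.

Canonical okada_equiv := EquivRelPack okada_relb_equiv.

Definition okada : Type := {eq_quot okada_equiv}.
HB.instance Definition _ := Choice.on okada.
HB.instance Definition _ := EqQuotient.on okada.

Local Notation cl := (\pi_okada).

Lemma okada_clP a b : cl a = cl b <-> okada_rel a b.
Proof.
by split=> [/eqP|ab]; [rewrite eqmodE => /asboolP | apply/eqP; rewrite eqmodE; apply/asboolP].
Qed.

Definition okada_cst k : okada := cl (ECst k).
Definition okada_add (p q : okada) : okada := cl (EAdd (repr p) (repr q)).
Definition okada_mul (p q : okada) : okada := cl (EMul (repr p) (repr q)).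

Lemma okada_repr a : okada_rel (repr (cl a)) a.
Proof. by apply/okada_clP; rewrite reprK. Qed.

Lemma okada_addE a b : okada_add (cl a) (cl b) = cl (EAdd a b).
Proof. by apply/okada_clP/OAddCong; exact: okada_repr. Qed.

Lemma okada_mulE a b : okada_mul (cl a) (cl b) = cl (EMul a b).
Proof. by apply/okada_clP/OMulCong; exact: okada_repr. Qed.

Lemma okada_ind (P : okada -> Prop) : (forall a, P (cl a)) -> forall p, P p.
Proof. by move=> Pcl p; rewrite -[p]reprK. Qed.

Let addA : associative okada_add.
Proof.
elim/okada_ind=> a; elim/okada_ind=> b; elim/okada_ind=> c.
by rewrite !okada_addE; apply/okada_clP/OAddA.
Qed.
Let addC : commutative okada_add.
Proof.
elim/okada_ind=> a; elim/okada_ind=> b.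
by rewrite !okada_addE; apply/okada_clP/OAddC.
Qed.
Let add0 : left_id (okada_cst 0) okada_add.
Proof. by elim/okada_ind=> a; rewrite okada_addE; apply/okada_clP/OAdd0. Qed.
Let addN : left_inverse (okada_cst 0) (okada_mul (okada_cst (-1))) okada_add.
Proof.
by elim/okada_ind=> a; rewrite okada_mulE okada_addE; apply/okada_clP/OAddN.
Qed.
Let mulA : associative okada_mul.
Proof.
elim/okada_ind=> a; elim/okada_ind=> b; elim/okada_ind=> c.
by rewrite !okada_mulE; apply/okada_clP/OMulA.
Qed.
Let cstC k p : okada_mul (okada_cst k) p = okada_mul p (okada_cst k).
Proof. by elim/okada_ind: p => a; rewrite !okada_mulE; apply/okada_clP/OCstC. Qed.
Let mul1 : left_id (okada_cst 1) okada_mul.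
Proof. by elim/okada_ind=> a; rewrite okada_mulE; apply/okada_clP/OMul1. Qed.
Let mulr1 : right_id (okada_cst 1) okada_mul.
Proof. by move=> p; rewrite -cstC mul1. Qed.
Let mulDl : left_distributive okada_mul okada_add.
Proof.
elim/okada_ind=> a; elim/okada_ind=> b; elim/okada_ind=> c.
by rewrite !(okada_addE, okada_mulE); apply/okada_clP/OMulDl.
Qed.
Let mulDr : right_distributive okada_mul okada_add.
Proof.
elim/okada_ind=> a; elim/okada_ind=> b; elim/okada_ind=> c.
by rewrite !(okada_addE, okada_mulE); apply/okada_clP/OMulDr.
Qed.

(* The algebra is nonzero: all the generators may be sent to 0. *)
Fixpoint okada_aug (a : expr) : K :=
  match a with
  | ECst k => k
  | EGen _ => 0
  | EAdd a b => okada_aug a + okada_aug b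
  | EMul a b => okada_aug a * okada_aug b
  end.

Lemma okada_aug_rel a b : okada_rel a b -> okada_aug a = okada_aug b.
Proof.
elim=> /= *; first [by [] | congruence | by rewrite addrA | exact: addrC
  | by rewrite add0r | by rewrite mulN1r addNr | by rewrite mulrA
  | by rewrite mul1r | by rewrite mulrDl | by rewrite mulrDr | exact: mulrC
  | by rewrite !mulr0].
Qed.

Let one_neq0 : okada_cst 1 != okada_cst 0.
Proof. by apply/eqP => /okada_clP/okada_aug_rel/eqP; rewrite /= oner_eq0. Qed.

HB.instance Definition _ := GRing.isZmodule.Build okada addA addC add0 addN.
HB.instance Definition _ := GRing.Zmodule_isNzRing.Build okada
  mulA mul1 mulr1 mulDl mulDr one_neq0.

Definition okada_scale (k : K) (p : okada) : okada := okada_cst k * p.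

Let cstD : {morph okada_cst : k l / k + l}.
Proof. by move=> k l; rewrite [RHS]okada_addE; apply/okada_clP/OCstD. Qed.
Let cstM : {morph okada_cst : k l / k * l}.
Proof. by move=> k l; rewrite [RHS]okada_mulE; apply/okada_clP/OCstM. Qed.

Let scaleA k l p : okada_scale k (okada_scale l p) = okada_scale (k * l) p.
Proof. by rewrite /okada_scale mulrA cstM. Qed.
Let scale1 : left_id 1 okada_scale.
Proof. exact: mul1. Qed.
Let scaleDr : right_distributive okada_scale +%R.
Proof. by move=> k p q; rewrite /okada_scale mulrDr. Qed.
Let scaleDl p : {morph okada_scale^~ p : k l / k + l}.
Proof. by move=> k l; rewrite /okada_scale cstD mulrDl. Qed.
HB.instance Definition _ := GRing.Zmodule_isLmodule.Build K okada
  scaleA scale1 scaleDr scaleDl.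

Let scaleAl (k : K) (p q : okada) : k *: (p * q) = k *: p * q.
Proof. exact: mulrA. Qed.
HB.instance Definition _ := GRing.Lmodule_isLalgebra.Build K okada scaleAl.

Let scaleAr (k : K) (p q : okada) : k *: (p * q) = p * (k *: q).
Proof.
rewrite /GRing.scale /= /okada_scale mulrA.
by rewrite (cstC k p : okada_cst k * p = p * okada_cst k) mulrA.
Qed.
HB.instance Definition _ := GRing.Lalgebra_isAlgebra.Build K okada scaleAr.

(* The generator E_i, for 1 <= i < N; the default value 0 is never used. *)
Definition okada_gen (i : nat) : okada :=
  if insub i is Some j then cl (EGen j) else 0.

End OkadaAlgebra.

Section OkadaInclusion.
Variables (K : fieldType) (X Y : nat -> K) (N : nat).

Lemma okada_index_widen (i : okada_index N) : (0 < val i < N.+1)%N.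
Proof. by have /andP[-> /ltnW] := valP i. Qed.

Fixpoint okada_widen_expr (a : okada_expr K N) : okada_expr K N.+1 :=
  match a with
  | ECst k => ECst k
  | EGen i => EGen (Sub (val i) (okada_index_widen i))
  | EAdd a b => EAdd (okada_widen_expr a) (okada_widen_expr b)
  | EMul a b => EMul (okada_widen_expr a) (okada_widen_expr b)
  end.

Lemma okada_widen_rel a b : okada_rel X Y a b ->
  okada_rel X Y (okada_widen_expr a) (okada_widen_expr b).
Proof.
by elim=> *; solve [econstructor; by [] | eapply OTrans; eassumption].
Qed.

(* O_N(X,Y) is identified with the subalgebra of O_{N+1}(X,Y) generated by
   E_1, ..., E_{N-1} through this map, which sends E_i to E_i. *)
Definition okada_incl (p : okada X Y N) : okada X Y N.+1 :=
  \pi_(okada X Y N.+1) (okada_widen_expr (repr p)).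

Lemma okada_inclE a :
  okada_incl (\pi_(okada X Y N) a) = \pi_(okada X Y N.+1) (okada_widen_expr a).
Proof. by apply/okada_clP/okada_widen_rel/okada_repr. Qed.

Lemma okada_inclD : {morph okada_incl : p q / p + q}.
Proof.
elim/okada_ind=> a; elim/okada_ind=> b.
by rewrite [X in okada_incl X]okada_addE !okada_inclE [RHS]okada_addE.
Qed.

Lemma okada_incl_monoid_morphism : monoid_morphism okada_incl.
Proof.
split; first exact: okada_inclE.
elim/okada_ind=> a; elim/okada_ind=> b.
by rewrite [X in okada_incl X]okada_mulE !okada_inclE [RHS]okada_mulE.
Qed.

Lemma okada_incl_zmod_morphism : zmod_morphism okada_incl.
Proof.
move=> p q; apply/eqP; rewrite eq_sym subr_eq -okada_inclD.
by rewrite subrK.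
Qed.

HB.instance Definition _ := GRing.isZmodMorphism.Build _ _ okada_incl
  okada_incl_zmod_morphism.
HB.instance Definition _ := GRing.isMonoidMorphism.Build _ _ okada_incl
  okada_incl_monoid_morphism.

End OkadaInclusion.

Arguments okada_incl {K} X Y N p.

(* The node i of [N] is [inl i], its barred copy is [inr i]; the ordinal
   i : 'I_N stands for the integer i.+1. *)
Definition node (N : nat) : Type := ('I_N + 'I_N)%type.
HB.instance Definition _ N := Finite.on (node N).

Section Diagrams.
Variable N : nat.
Implicit Types (a c : node N).

Definition node_abs a : nat := match a with inl i => i.+1 | inr i => i.+1 end.

(* Rank in the order 1 < ... < N < \bar N < ... < \bar 1 *)
Definition node_pos a : nat :=
  match a with inl i => i | inr i => N + (N - i.+1) end.

(* A labelled arc-diagram is encoded by the map sending each node to the other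
   end of its arc and the label of that arc.  Labels are at most N. *)
Definition prediagram : Type := {ffun node N -> node N * 'I_N.+1}.
HB.instance Definition _ := Finite.on prediagram.
Implicit Types C D : prediagram.

Definition mate D a : node N := (D a).1.
Definition label D a : nat := (D a).2.

Definition is_matching D : bool :=
  [forall a, (mate D a != a) && (D (mate D a) == (a, (D a).2))].

Definition non_crossing D : bool :=
  [forall a, forall c,
    ~~ [&& node_pos a < node_pos c, node_pos c < node_pos (mate D a)
         & node_pos (mate D a) < node_pos (mate D c)]%N].

Definition label_bounds D : bool :=
  [forall a, let m := minn (node_abs a) (node_abs (mate D a)) in
    (0 < label D a <= m)%N && (odd (label D a) == odd m)].

Definition nesting_increasing D : bool :=
  [forall a, forall c,
    [&& node_pos c < node_pos a, node_pos a < node_pos (mate D a)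
      & node_pos (mate D a) < node_pos (mate D c)]%N
    ==> (label D c < label D a)%N].

Definition is_okada D : bool :=
  [&& is_matching D, non_crossing D, label_bounds D & nesting_increasing D].

Definition diagram := {D : prediagram | is_okada D}.

(* In the concatenation of C and D, start at the node x, of C if inC and of D
   otherwise, and follow the arcs until an outer node is reached; l accumulates
   the minimum of the labels.  Starting from an outer node, at most N arcs are
   followed after the first one, as each of the N glued nodes is visited at most
   once, so fuel N suffices. *)
Fixpoint walk (fuel : nat) C D (inC : bool) (x : node N) (l : 'I_N.+1)
    : node N * 'I_N.+1 :=
  let: (y, m) := (if inC then C else D) x in
  let l' := if (m < l)%N then m else l in
  match fuel, inC, y with
  | f.+1, true, inr j => walk f C D false (inl j) l'
  | f.+1, false, inl j => walk f C D true (inr j) l'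
  | _, _, _ => (y, l')
  end.

Definition diagram_mul C D : prediagram :=
  [ffun a => walk N C D (if a is inl _ then true else false) a ord_max].

Definition node_bar a : node N :=
  match a with inl i => inr i | inr i => inl i end.

(* The node on the same side as a with absolute value m, for 1 <= m <= N *)
Definition node_move (m : nat) a : node N :=
  match a with
  | inl i => inl (insubd i m.-1)
  | inr i => inr (insubd i m.-1)
  end.

Definition diagram_id : prediagram :=
  [ffun a => (node_bar a, inord (node_abs a))].

(* The diagram A_i, for 1 <= i < N *)
Definition diagram_gen (i : nat) : prediagram :=
  [ffun a => if node_abs a == i then (node_move i.+1 a, inord i)
             else if node_abs a == i.+1 then (node_move i a, inord i)
             else diagram_id a].

(* The word i-1, i-2, ..., i-c_i, concatenated over i = 1, ..., N.  For the
   ordinal i, which stands for i.+1, this is i, i-1, ..., i-c+1. *)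
Definition perm_code (s : 'S_N) (i : 'I_N) : nat :=
  #|[set k : 'I_N | (k < i)%N && ((s^-1)%g i < (s^-1)%g k)%N]|.

Definition perm_word (s : 'S_N) : seq nat :=
  flatten [seq [seq (i - j)%N | j <- iota 0 (perm_code s i)] | i : 'I_N <- enum 'I_N].

Definition diagram_perm (s : 'S_N) : prediagram :=
  \big[diagram_mul/diagram_id]_(i <- perm_word s) diagram_gen i.

(* A half arc-diagram sends i to its label and to [Some j] if i and j are joined
   by a full arc, to [None] if there is a propagating half arc at i. *)
Definition prehalf : Type := {ffun 'I_N -> option 'I_N * 'I_N.+1}.
HB.instance Definition _ := Finite.on prehalf.
Implicit Type H : prehalf.

Definition left_half D : prehalf :=
  [ffun i => (if mate D (inl i) is inl j then Some j else None, (D (inl i)).2)].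

Definition is_half H : bool := [exists D : diagram, left_half (val D) == H].

Definition prop_labels H : {fset nat} :=
  [fset nat_of_ord (H i).2 | i in 'I_N & ~~ isSome (H i).1]%fset.

End Diagrams.

(* H/[r] *)
Definition half_restr (r N : nat) (le_rN : (r <= N)%N) (H : prehalf N)
    : prehalf r :=
  [ffun i => let: (p, l) := H (widen_ord le_rN i) in
             (obind (fun j : 'I_N => insub (val j)) p, inord l)].

Definition fset_seq (S : {fset nat}) : seq nat := sort leq (enum_fset S).
Definition fset_max (S : {fset nat}) : nat := \max_(s <- enum_fset S) s.

Definition is_fibonacci (N : nat) (S : {fset nat}) : bool :=
  [&& all (fun s => 0 < s <= N)%N (enum_fset S),
      odd #|` S| == odd N
    & all (fun i => odd (nth 0%N (fset_seq S) i) == odd i.+1) (iota 0 #|` S|)].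

Definition fibset (N : nat) := {S : {fset nat} | is_fibonacci N S}.

(* T covers S *)
Definition fib_covers (S T : {fset nat}) : bool :=
  (S != fset0) && (T == S `\ fset_max S)%fset ||
  (T != fset0) && (S == T `\ fset_max T)%fset.

(* s_{k-i} is the term of index k - i - 1 of the increasing enumeration. *)
Definition dominance (S T : {fset nat}) : bool :=
  (#|` S| <= #|` T|)%N &&
  all (fun i => nth 0%N (fset_seq S) (#|` S| - i.+1)
                <= nth 0%N (fset_seq T) (#|` T| - i.+1))%N
      (iota 0 #|` S|).

Section Cells.
Variables (K : fieldType) (X Y : nat -> K) (N : nat).

Definition okada_perm (s : 'S_N) : okada X Y N :=
  \prod_(i <- perm_word s) okada_gen X Y N i.

(* E_D = E_s for the permutation s such that D = A_s *)
Definition okada_diag (D : prediagram N) : okada X Y N :=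
  if [pick s | diagram_perm s == D] is Some s then okada_perm s else 0.

(* The scalar lambda(C, D) such that E_C E_D = lambda(C, D) E_{C.D} *)
Definition okada_lambda (C D : prediagram N) : K :=
  xget 0 [set l | okada_diag C * okada_diag D =
                  l *: okada_diag (diagram_mul C D)]%classic.

Definition half_diagram (S : fibset N) :=
  {H : prehalf N | is_half H && (prop_labels H == val S)}.

(* [cell_vec H] is the basis vector |H>; only its values at the Okada half
   arc-diagrams H with propagating labels S are meaningful.  Left O_N(X,Y)-modules
   are K-vector spaces through k |-> k%:A. *)
Record cell_module (S : fibset N) := CellModule {
  cell_sort :> lmodType (okada X Y N);
  cell_vec : prehalf N -> cell_sort;
  cell_basis : forall v : cell_sort, exists! c : {ffun half_diagram S -> K},
    v = \sum_H (c H)%:A *: cell_vec (val H);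
  cell_act : forall C D : diagram N, prop_labels (left_half (val D)) = val S ->
    okada_diag (val C) *: cell_vec (left_half (val D)) =
      let CD := diagram_mul (val C) (val D) in
      if prop_labels (left_half CD) == val S
      then (okada_lambda (val C) (val D))%:A *: cell_vec (left_half CD) else 0
}.

End Cells.

(* The span V^T_{<= S} of the H with PropLab(H/[n]) dominated by S *)
Definition cell_filtration (K : fieldType) (X Y : nat -> K) (n : nat)
    (T : fibset n.+1) (VT : cell_module X Y T) (S : fibset n) (v : VT) : Prop :=
  exists2 c : {ffun half_diagram T -> K},
    forall H, c H != 0 ->
      dominance (prop_labels (half_restr (leqnSn n) (val H))) (val S)
    & v = \sum_H (c H)%:A *: cell_vec VT (val H).
Arguments cell_filtration {K X Y n T} VT S v.

(* Main.v *)
Require Import Defs.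
From HB Require Import structures.
From mathcomp Require Import all_boot all_order all_algebra all_fingroup finmap.
From mathcomp Require Import boolp classical_sets cardinality.
From mathcomp Require Import zify.

Set Implicit Arguments.
Unset Strict Implicit.
Unset Printing Implicit Defensive.

Import GRing.Theory.

(**
Positions and insertions. Read the nodes along 1 < ... < N < \bar N < ... < \bar 1: a diagram
becomes a function sending a position to its partner and its label. Every diagram of rank
n + 1 is obtained in a unique way from one of rank n by inserting a short arc between two
neighbouring positions ([ins], [wf_top], [ins_inj]). The generators E_a with a < n commute with
insertion, both on diagrams ([lact_ins]) and on the scalars lambda ([lambda_ins]). The second
point rests on the fact that right multiplication by a block E_n E_{n-1} ... E_{n-c+1} is injective
on the algebra of rank n, which is proved by representing the algebra of rank n + 1 by
matrices over the algebra of rank n ([incl_desc_inj]).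

The filtration. On half diagrams, forgetting the last node is a bijection from the half
diagrams with label set T onto the half diagrams of rank n whose label set is a predecessor of
T ([restr_inj], [restr_covers], [covers_ext]). So V^T has the dimension of the sum of the
V^{S_i}, and E_a acts on |H> as it acts on |H/[n]> as long as the label set of H/[n] does not
change. A generator never increases the sum of the propagating labels, and if that sum is kept
then the new left half depends on the old left half only ([lact_half]). Since this sum is
strictly monotone for dominance ([dominance_weight]), the action of the smaller algebra is
triangular with diagonal blocks V^{S_i} ([okada_layer], [layer_iso]).

The splitting. When the parameters are nonzero and the V^{S_i} are simple, one wants module
maps from the restriction of V^T onto V^{S_i} that extend the projection pr_i of the i-th step of the
filtration. Let e be the word in the generators whose letters are the short arcs of the
half diagram with labels S_i that has only short full arcs. Up to a scalar e is an
idempotent; it kills the cell modules of larger weight, acts on V^{S_i} with rank one, and maps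
V^T into the i-th step of the filtration ([Ecan_sq], [Ecan_kill], [Ecan_line], [Ecan_filt]). For v in
V^T, look for x in V^{S_i} with e a x = pr_i (e a v) for all a in the algebra. By simplicity there
is at most one such x ([simple_zero]). Modulo lighter canonical words, the elements e a are spanned by
as many elements as V^{S_i} has dimensions ([Ecan_word]), and each of them gives one scalar
equation; an injective square system is solvable, so x exists ([ext_ex]). The map v |-> x is a
module map by uniqueness, and the family of these maps is triangular for the filtration, hence
bijective ([ext_zero], [ext_onto]).
*)

(** * Diagrams as functions on positions *)

Section Arcs.
Local Open Scope nat_scope.
Implicit Types (f g : nat -> nat * nat).

(** The absolute value of the node at position [p], when the positions 0, ..., 2N - 1 list
    the nodes in the order 1 < ... < N < \bar N < ... < \bar 1. *)
Definition ab N p := if p < N then p.+1 else N + N - p.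

(** An Okada arc-diagram read along the positions: [f p] holds the position and the label of
    the other end of the arc at [p]. With plain functions on [nat] the combinatorics becomes
    linear arithmetic; [is_okadaP] is the translation. *)
Record wf N f : Prop := Wf {
  wf_lt : forall p, p < N + N -> (f p).1 < N + N;
  wf_neq : forall p, p < N + N -> (f p).1 <> p;
  wf_inv : forall p, p < N + N -> f (f p).1 = (p, (f p).2);
  wf_nc : forall p q, q < N + N -> p < q -> q < (f p).1 -> (f p).1 < (f q).1 -> False;
  wf_pos : forall p, p < N + N -> 0 < (f p).2;
  wf_le : forall p, p < N + N -> (f p).2 <= ab N p;
  wf_odd : forall p, p < N + N ->
    odd (f p).2 = odd (minn (ab N p) (ab N (f p).1));
  wf_nest : forall p q, p < N + N -> q < p -> p < (f p).1 -> (f p).1 < (f q).1 ->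
    (f q).2 < (f p).2 }.

Definition eqa N f g := forall p, p < N + N -> f p = g p.

Lemma wf_m N f p : wf N f -> p < N + N -> (f (f p).1).1 = p.
Proof. by move=> w pN; rewrite (wf_inv w). Qed.
Lemma wf_l N f p : wf N f -> p < N + N -> (f (f p).1).2 = (f p).2.
Proof. by move=> w pN; rewrite (wf_inv w). Qed.

(** An interval of positions that is stable under the matching has even length: cut it at
    the partner of its first position, and use that arcs do not cross. *)
Lemma wf_closed N f : wf N f -> forall k s t, t - s <= k -> s <= t -> t <= N + N ->
  (forall x, s <= x -> x < t -> s <= (f x).1 /\ (f x).1 < t) -> odd s = odd t.
Proof.
move=> w; elim=> [|k IH] s t ks st tN cl.
  by have -> : s = t by lia.
have [/eqP->//|/eqP nst] := boolP (s == t).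
have sN : s < N + N by lia.
have [sm mt] := cl s (leqnn _) ltac:(lia).
have nsm := wf_neq w sN.
have ms := wf_m w sN.
set m := (f s).1 in sm mt nsm ms *.
have mN : m < N + N by lia.
have e1 : odd s.+1 = odd m.
  apply: IH; try lia.
  move=> x sx xm; have [a b] := cl x ltac:(lia) ltac:(lia).
  have xN : x < N + N by lia.
  have mx := wf_m w xN.
  have nc := @wf_nc _ _ w s x xN ltac:(lia) xm.
  split.
    have : (f x).1 <> s by move=> e; move: xm; rewrite /m -e mx; lia.
    lia.
  have : (f x).1 <> m by move=> e; move: mx; rewrite e ms; lia.
  rewrite -/m in nc; lia.
have e2 : odd m.+1 = odd t.
  apply: IH; try lia.
  move=> x sx xm; have [a b] := cl x ltac:(lia) ltac:(lia).
  have xN : x < N + N by lia.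
  have mx := wf_m w xN.
  split=> //.
  have h1 : (f x).1 <> s by move=> e; move: sx; rewrite /m -e mx; lia.
  have h2 : (f x).1 <> m by move=> e; move: mx; rewrite e ms; lia.
  have h3 : m < (f x).1 \/ ((f x).1 < m) by lia.
  case: h3 => // h3.
  have := @wf_nc _ _ w s (f x).1 ltac:(lia) ltac:(lia) ltac:(rewrite -/m; lia).
  rewrite -/m mx; lia.
lia.
Qed.

(** The positions strictly between the two ends of an arc form a stable interval. *)
Lemma wf_parity N f p : wf N f -> p < N + N -> odd (f p).1 = ~~ odd p.
Proof.
move=> w.
suff H q : q < N + N -> q < (f q).1 -> odd (f q).1 = ~~ odd q.
  move=> pN; have nsm := wf_neq w pN.
  have mN := wf_lt w pN.
  have [?|?] : p < (f p).1 \/ (f p).1 < p by lia.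
    exact: H.
  by have := H _ mN; rewrite (wf_m w pN); lia.
move=> sN sm; have mN := wf_lt w sN.
have ms := wf_m w sN.
symmetry; rewrite -[~~ odd q]/(odd q.+1).
apply: (wf_closed w (leqnn _)); try lia.
move=> x sx xm; have xN : x < N + N by lia.
have mx := wf_m w xN.
have nc := @wf_nc _ _ w q x xN ltac:(lia) xm.
have h1 : (f x).1 <> q by move=> e; move: xm; rewrite -e mx; lia.
have h2 : (f x).1 <> (f q).1 by move=> e; move: mx; rewrite e ms; lia.
have h3 : q < (f x).1 \/ (f x).1 < q by lia.
case: h3 => h3; first lia.
have := @wf_nc _ _ w (f x).1 q ltac:(lia) ltac:(lia).
rewrite mx; lia.
Qed.

(** Renumbering of the positions that makes room for two new ones at [k] and [k.+1]. *)
Definition sh k p := if p < k then p else p.+2.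
Definition un k p := if p < k then p else p - 2.

Lemma sh_spec k p : (p < k /\ sh k p = p) \/ (k <= p /\ sh k p = p.+2).
Proof. by rewrite /sh; case: ltnP; [left|right]. Qed.
Lemma un_spec k p : (p < k /\ un k p = p) \/ (k <= p /\ un k p = p - 2).
Proof. by rewrite /un; case: ltnP; [left|right]. Qed.
Lemma ab_spec N p : (p < N /\ ab N p = p.+1) \/ (N <= p /\ ab N p = N + N - p).
Proof. by rewrite /ab; case: ltnP; [left|right]. Qed.
Lemma shK k p : un k (sh k p) = p.
Proof. have := un_spec k (sh k p); have := sh_spec k p; lia. Qed.
Lemma unK k p : p != k -> p != k.+1 -> sh k (un k p) = p.
Proof. have := un_spec k p; have := sh_spec k (un k p); lia. Qed.

(** Raising the rank by one: a short arc is inserted at the positions [n + c] and [n + c + 1].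
    Its right end has absolute value n + 1 - c, which is the largest label it may carry. On
    elements E_D this is right multiplication by E_n E_{n-1} ... E_{n-c+1} ([Ed_ins]). *)
Definition ins (n c : nat) f (x : nat) : nat * nat :=
  if x == n + c then ((n + c).+1, n.+1 - c)
  else if x == (n + c).+1 then (n + c, n.+1 - c)
  else (sh (n + c) (f (un (n + c) x)).1, (f (un (n + c) x)).2).

Definition del (n c : nat) g (x : nat) : nat * nat :=
  (un (n + c) (g (sh (n + c) x)).1, (g (sh (n + c) x)).2).

Lemma ins_sh n c f x : ins n c f (sh (n + c) x) = (sh (n + c) (f x).1, (f x).2).
Proof.
have := sh_spec (n + c) x => h.
by rewrite /ins !ifF ?shK //; apply/eqP; lia.
Qed.
Lemma ins_k n c f : ins n c f (n + c) = ((n + c).+1, n.+1 - c).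
Proof. by rewrite /ins eqxx. Qed.
Lemma ins_k1 n c f : ins n c f (n + c).+1 = (n + c, n.+1 - c).
Proof. by rewrite /ins eqxx ifF //; apply/eqP; lia. Qed.

Lemma posP k x : [\/ x = k, x = k.+1 | exists y, x = sh k y].
Proof.
have [/eqP->|h] := boolP (x == k); first by constructor 1.
have [/eqP->|h'] := boolP (x == k.+1); first by constructor 2.
by constructor 3; exists (un k x); rewrite unK.
Qed.

Lemma odd_absh n c p z : c <= n -> p < n + n -> z < n + n -> odd z = ~~ odd p ->
  odd (minn (ab n.+1 (sh (n + c) p)) (ab n.+1 (sh (n + c) z))) = odd (minn (ab n p) (ab n z)).
Proof.
move=> cn pN zN oz.
have [k hk] : exists k, z = p.+1 + k + k \/ p = z.+1 + k + k.
  have [h|h] := ltnP p z.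
    exists ((z - p.+1)./2); left; lia.
  exists ((p - z.+1)./2); right; lia.
clear oz.
case: (sh_spec (n + c) p) => -[h1 ->]; case: (sh_spec (n + c) z) => -[h2 ->];
case: (ab_spec n p) => -[h3 ->]; case: (ab_spec n z) => -[h4 ->]; try (exfalso; lia);
match goal with |- context [ab n.+1 ?u] => case: (ab_spec n.+1 u) => -[h5 ->] end; try (exfalso; lia);
match goal with |- context [ab n.+1 ?u] => case: (ab_spec n.+1 u) => -[h6 ->] end; try (exfalso; lia);
rewrite /minn; do ?[case: ifP => ?]; try (exfalso; lia); case: hk => hk; first [exfalso; lia | lia].
Qed.

(** An arc around the new one ends further to the right, at a node of absolute value at most
    n - c, which bounds its label; and nothing is nested in a short arc. *)
Lemma ins_wf n c f : c <= n -> wf n f -> wf n.+1 (ins n c f).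
Proof.
move=> cn w.
have N1 : n.+1 + n.+1 = (n + n).+2 by lia.
split; rewrite ?N1.
- move=> p; case: (posP (n + c) p) => [->|->|[y ->]]; rewrite ?ins_k ?ins_k1 ?ins_sh /=; try lia.
  have := sh_spec (n + c) y; have := sh_spec (n + c) (f y).1; have := @wf_lt _ _ w y; lia.
- move=> p; case: (posP (n + c) p) => [->|->|[y ->]]; rewrite ?ins_k ?ins_k1 ?ins_sh /=; try lia.
  have := sh_spec (n + c) y; have := sh_spec (n + c) (f y).1; have := @wf_neq _ _ w y; lia.
- move=> p; case: (posP (n + c) p) => [->|->|[y ->]]; rewrite ?ins_k ?ins_k1 ?ins_sh ?ins_k ?ins_k1 //=.
  move=> yN; have y2 : y < n + n by have := sh_spec (n + c) y; lia.
  by rewrite (wf_inv w).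
- move=> p q; case: (posP (n + c) p) => [->|->|[y ->]]; case: (posP (n + c) q) => [->|->|[z ->]];
   rewrite ?ins_k ?ins_k1 ?ins_sh /=; try lia.
  have := @wf_nc _ _ w y z.
  have := sh_spec (n + c) y; have := sh_spec (n + c) (f y).1;
  have := sh_spec (n + c) z; have := sh_spec (n + c) (f z).1; lia.
- move=> p; case: (posP (n + c) p) => [->|->|[y ->]]; rewrite ?ins_k ?ins_k1 ?ins_sh /=; try lia.
  have := sh_spec (n + c) y; have := @wf_pos _ _ w y; lia.
- move=> p; case: (posP (n + c) p) => [->|->|[y ->]]; rewrite ?ins_k ?ins_k1 ?ins_sh /=.
  + have := ab_spec n.+1 (n + c); lia.
  + have := ab_spec n.+1 (n + c).+1; lia.
  + have := sh_spec (n + c) y; have := @wf_le _ _ w y;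
    have := ab_spec n.+1 (sh (n + c) y); have := ab_spec n y; lia.
- move=> p; case: (posP (n + c) p) => [->|->|[y ->]]; rewrite ?ins_k ?ins_k1 ?ins_sh /=.
  + have := ab_spec n.+1 (n + c).+1; have := ab_spec n.+1 (n + c); lia.
  + have := ab_spec n.+1 (n + c).+1; have := ab_spec n.+1 (n + c); lia.
  + move=> yN; have y2 : y < n + n by have := sh_spec (n + c) y; lia.
    rewrite (wf_odd w) //.
    by rewrite (odd_absh cn y2 (wf_lt w y2) (wf_parity w y2)).
- move=> p q; case: (posP (n + c) p) => [->|->|[y ->]]; case: (posP (n + c) q) => [->|->|[z ->]];
   rewrite ?ins_k ?ins_k1 ?ins_sh /=; try lia.
  + move=> _; have := sh_spec (n + c) z; have := sh_spec (n + c) (f z).1 => h1 h2 h3 h4 h5.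
    have zN : z < n + n by lia.
    have := @wf_le _ _ w _ (wf_lt w zN); rewrite (wf_l w) //.
    have := ab_spec n (f z).1; lia.
  have := @wf_nest _ _ w y z.
  have := sh_spec (n + c) y; have := sh_spec (n + c) (f y).1;
  have := sh_spec (n + c) z; have := sh_spec (n + c) (f z).1; lia.
Qed.

(** Every diagram of positive rank arises by insertion. Among the barred nodes \bar j whose
    arc is labelled j, such as \bar 1, take the one with the largest j. If it were not tied to
    its left neighbour, the arc of that neighbour, whose label is at most j,
    would cross the arc of \bar j or be nested in it.
    The maximality clause is what makes the removal of this arc legal and unique. *)
Lemma wf_top n g : wf n.+1 g ->
  exists c, [/\ c <= n, g (n + c) = ((n + c).+1, n.+1 - c),
    g (n + c).+1 = (n + c, n.+1 - c) &
    forall j, n.+1 - c < j -> j <= n.+1 -> (g (n.+1 + n.+1 - j)).2 < j].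
Proof.
move=> w.
pose P j := (0 < j <= n.+1) && ((g (n.+1 + n.+1 - j)).2 == j).
have exP : exists j, P j.
  exists 1; rewrite /P /=.
  have h : n.+1 + n.+1 - 1 < n.+1 + n.+1 by lia.
  have := wf_pos w h; have := wf_le w h; have := ab_spec n.+1 (n.+1 + n.+1 - 1); lia.
have ubP j : P j -> j <= n.+1 by rewrite /P; lia.
case: (ex_maxnP exP ubP) => m /andP[m0 /eqP lm] mx.
have mxl j : m < j -> j <= n.+1 -> (g (n.+1 + n.+1 - j)).2 < j.
  move=> mj jn; have h : n.+1 + n.+1 - j < n.+1 + n.+1 by lia.
  have := wf_le w h; have := ab_spec n.+1 (n.+1 + n.+1 - j).
  have := mx j; rewrite /P; lia.
set x := n.+1 + n.+1 - m in lm.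
have xN : x < n.+1 + n.+1 by lia.
have lx := wf_le w (wf_lt w xN); rewrite (wf_l w) // lm in lx.
have nx := wf_neq w xN.
have ax := ab_spec n.+1 (g x).1.
have mN := wf_lt w xN.
have mmx := wf_m w xN.
(* the largest j found above is m, and x is the position of \bar m *)
suff gx : (g x).1 = x.-1.
  exists (n.+1 - m).
  have e1 : (n + (n.+1 - m)).+1 = x by lia.
  have e2 : n + (n.+1 - m) = x.-1 by lia.
  split; first lia.
  - rewrite e1 e2 -gx (wf_inv w) // lm; congr (_, _); lia.
  - rewrite e1 e2 [g x]surjective_pairing gx lm; congr (_, _); lia.
  - move=> j h; apply: mxl; lia.
have [/eqP//|/eqP ngx] := boolP ((g x).1 == x.-1).
have px : (g x).1 < x.-1 by lia.
have x1N : x.-1 < n.+1 + n.+1 by lia.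
have mb := wf_lt w x1N.
have mmb := wf_m w x1N.
have nb := wf_neq w x1N.
have lb := wf_le w x1N.
have ab1 := ab_spec n.+1 x.-1.
have lb' : (g x.-1).2 <= m.
  have [e|e] : x.-1 = n \/ n < x.-1 by lia.
    have le2 := wf_le w mb; rewrite (wf_l w) // in le2.
    have := ab_spec n.+1 (g x.-1).1; lia.
  have := mxl m.+1 ltac:(lia) ltac:(lia).
  by have -> : n.+1 + n.+1 - m.+1 = x.-1 by lia.
have d1 : (g x.-1).1 <> x by move=> e; rewrite e in mmb; lia.
have d2 : (g x.-1).1 <> (g x).1 by move=> e; rewrite e mmx in mmb; lia.
have [h|h] : (g x.-1).1 < (g x).1 \/ (g x).1 < (g x.-1).1 by lia.
  have := @wf_nc _ _ w (g x.-1).1 (g x).1 mN h; rewrite mmb mmx; lia.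
have [h'|h'] : (g x.-1).1 < x.-1 \/ x.-1 < (g x.-1).1 by lia.
  have := @wf_nest _ _ w (g x.-1).1 (g x).1 mb h; rewrite mmb mmx !(wf_l w) //; lia.
have [h2|h2] : (g x.-1).1 < x \/ x < (g x.-1).1 by lia.
  lia.
have := @wf_nc _ _ w (g x).1 x.-1 x1N px; rewrite mmx; lia.
Qed.

Lemma ins_del n c g : c <= n -> g (n + c) = ((n + c).+1, n.+1 - c) ->
  g (n + c).+1 = (n + c, n.+1 - c) ->
  wf n.+1 g -> eqa n.+1 g (ins n c (del n c g)).
Proof.
move=> cn g0 g1 w x.
case: (posP (n + c) x) => [->|->|[y ->]]; rewrite ?ins_k ?ins_k1 ?ins_sh //= => yN.
have s1 := sh_spec (n + c) y.
rewrite /del unK /=; first by rewrite -surjective_pairing.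
  apply/eqP => e; have := wf_m w yN; rewrite e g0 /=; lia.
apply/eqP => e; have := wf_m w yN; rewrite e g1 /=; lia.
Qed.

(** A barred node to the left of the removed arc has its absolute value lowered by one; the
    maximality hypothesis says exactly that its label still fits. *)
Lemma del_wf n c g : c <= n -> g (n + c) = ((n + c).+1, n.+1 - c) ->
  g (n + c).+1 = (n + c, n.+1 - c) ->
  (forall j, n.+1 - c < j -> j <= n.+1 -> (g (n.+1 + n.+1 - j)).2 < j) ->
  wf n.+1 g -> wf n (del n c g).
Proof.
move=> cn g0 g1 top w.
have shN y : y < n + n -> sh (n + c) y < n.+1 + n.+1 by have := sh_spec (n + c) y; lia.
have mg y : y < n + n -> sh (n + c) (un (n + c) (g (sh (n + c) y)).1) = (g (sh (n + c) y)).1.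
  move=> yN; have s1 := sh_spec (n + c) y; apply: unK; apply/eqP => e;
  have := wf_m w (shN _ yN); rewrite e ?g0 ?g1 /=; lia.
have inc a b : (sh (n + c) a < sh (n + c) b) = (a < b).
  have := sh_spec (n + c) a; have := sh_spec (n + c) b; lia.
have sN y : sh (n + c) y < n.+1 + n.+1 -> y < n + n.
  have := sh_spec (n + c) y; lia.
have lbl y : y < n + n -> (g (sh (n + c) y)).2 <= ab n y.
  move=> yN; have := wf_le w (shN _ yN).
  have := ab_spec n y; have := ab_spec n.+1 (sh (n + c) y); have := sh_spec (n + c) y.
  move=> h1 h2 h3 h4.
  have [?|?] : y < n \/ n <= y by lia.
    lia.
  have [h|h] : y < n + c \/ n + c <= y by lia.
  2: lia.
  have [?|?] : (y = n) \/ n < y by lia.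
    subst y.
    have := wf_odd w (shN _ yN); have := wf_parity w (shN _ yN); have := wf_lt w (shN _ yN).
    have := ab_spec n.+1 (g (sh (n + c) n)).1.
    have := wf_le w (wf_lt w (shN _ yN)); rewrite (wf_l w (shN _ yN)).
    have := top n.+1 ltac:(lia) ltac:(lia); rewrite addKn.
    have : (g (sh (n + c) n)).1 = n.+1 -> (g n.+1).2 = (g (sh (n + c) n)).2.
      by move=> <-; rewrite (wf_l w (shN _ yN)).
    lia.
  have : (g (sh (n + c) y)).2 < n.+1 + n.+1 - y.
    rewrite (_ : sh (n + c) y = n.+1 + n.+1 - (n.+1 + n.+1 - y)); last lia.
    apply: top; lia.
  have := wf_odd w (shN _ yN); have := wf_parity w (shN _ yN); have := wf_lt w (shN _ yN).
  have := ab_spec n.+1 (g (sh (n + c) y)).1.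
  have := wf_le w (wf_lt w (shN _ yN)); rewrite (wf_l w (shN _ yN)).
  have : (g (sh (n + c) y)).1 = y.+1 -> (g (sh (n + c) y)).2 < n.+1 + n.+1 - y.+1.
    move=> e; have h5 : y.+1 < n + c.
      have := wf_m w (shN _ yN); rewrite e => h6.
      have [e2|?] : y.+1 = n + c \/ y.+1 < n + c by lia.
        by rewrite e2 g0 /= in h6; lia.
      by [].
    have := top (n.+1 + n.+1 - y.+1) ltac:(lia) ltac:(lia).
    rewrite (_ : n.+1 + n.+1 - (n.+1 + n.+1 - y.+1) = y.+1); last lia.
    by rewrite -(wf_l w (shN _ yN)) e.
  lia.
split; rewrite /del /=.
- by move=> p pN; apply: sN; rewrite mg //; apply: wf_lt => //; exact: shN.
- by move=> p pN e; apply: (wf_neq w (shN _ pN)); rewrite -mg // e.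
- by move=> p pN; rewrite mg // (wf_inv w) ?shK //; exact: shN.
- move=> p q qN pq.
  have pN : p < n + n by lia.
  rewrite -(inc q) -(inc (un _ _)) !mg //.
  by apply: (wf_nc w (shN _ qN)); rewrite inc.
- move=> p pN; exact: (wf_pos w (shN _ pN)).
- by move=> p pN; exact: lbl.
- move=> p pN; rewrite (wf_odd w (shN _ pN)).
  set z := un _ _.
  have zN : z < n + n by apply: sN; rewrite mg //; apply: wf_lt => //; exact: shN.
  rewrite -mg // -/z odd_absh //.
  have := wf_parity w (shN _ pN); rewrite -mg // -/z.
  have := sh_spec (n + c) z; have := sh_spec (n + c) p; lia.
- move=> p q pN qp.
  have qN : q < n + n by lia.
  rewrite -(inc p) -(inc (un _ _)) !mg //.
  by apply: (wf_nest w (shN _ pN)); rewrite inc.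
Qed.

Lemma ins_top n c f : wf n f -> c <= n ->
  (forall j, n.+1 - c < j -> j <= n.+1 -> (ins n c f (n.+1 + n.+1 - j)).2 < j).
Proof.
move=> w cn j h1 h2; set x := _ - j.
case: (posP (n + c) x) => [e|e|[y e]].
- by rewrite e ins_k /=.
- by rewrite e ins_k1 /=.
rewrite e ins_sh /=; have s1 := sh_spec (n + c) y.
have yN : y < n + n by lia.
have := wf_le w yN; have := ab_spec n y; lia.
Qed.

(** By [ins_top] the position of the inserted arc is recovered from the largest j such that
    the arc of \bar j is labelled j. *)
Lemma ins_inj n c c' f f' : wf n f -> wf n f' -> c <= n -> c' <= n ->
  eqa n.+1 (ins n c f) (ins n c' f') -> c = c' /\ eqa n f f'.
Proof.
move=> w w' cn cn' e.
have [h|h] : c = c' \/ c <> c' by lia.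
  split=> // x xN; subst c'.
  have sN : sh (n + c) x < n.+1 + n.+1 by have := sh_spec (n + c) x; lia.
  have := e _ sN; rewrite !ins_sh.
  have := sh_spec (n + c) (f x).1; have := sh_spec (n + c) (f' x).1.
  case: (f x) (f' x) => [a b] [a' b'] /= h1 h2 [h3 ->]; congr (_, _); lia.
have [h'|h'] : c < c' \/ c' < c by lia.
- have := ins_top w' cn' (j := n.+1 - c) ltac:(lia) ltac:(lia).
  rewrite -e; last lia.
  have -> : n.+1 + n.+1 - (n.+1 - c) = (n + c).+1 by lia.
  rewrite ins_k1 /=; lia.
- have := ins_top w cn (j := n.+1 - c') ltac:(lia) ltac:(lia).
  rewrite e; last lia.
  have -> : n.+1 + n.+1 - (n.+1 - c') = (n + c').+1 by lia.
  rewrite ins_k1 /=; lia.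
Qed.

End Arcs.

(** * Surgery on matchings *)

Section Surgery.
Local Open Scope nat_scope.
Implicit Types (f g : nat -> nat * nat).

(** Composition with a pair of arcs: the partners of [p] and [q] get joined, with the minimum
    of the two labels, and [p] and [q] are tied together with label [k]. *)
Definition surg (p q k : nat) f (x : nat) : nat * nat :=
  if x == p then (q, k)
  else if x == q then (p, k)
  else if (f x).1 == p then ((f q).1, minn (f p).2 (f q).2)
  else if (f x).1 == q then ((f p).1, minn (f p).2 (f q).2)
  else f x.

(** Planarity and label conditions do not enter the relations between surgeries. *)
Record mt M f : Prop := Mt {
  mt_lt : forall p, p < M -> (f p).1 < M;
  mt_neq : forall p, p < M -> (f p).1 != p;
  mt_inv : forall p, p < M -> f (f p).1 = (p, (f p).2) }.

Lemma surg_p p q k f : surg p q k f p = (q, k).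
Proof. by rewrite /surg eqxx. Qed.
Lemma surg_q p q k f : p != q -> surg p q k f q = (p, k).
Proof. by rewrite /surg eqxx eq_sym => /negPf->. Qed.
Lemma surg_mp p q k f x : x != p -> x != q -> (f x).1 = p ->
  surg p q k f x = ((f q).1, minn (f p).2 (f q).2).
Proof. by rewrite /surg => /negPf-> /negPf-> ->; rewrite eqxx. Qed.
Lemma surg_mq p q k f x : p != q -> x != p -> x != q -> (f x).1 = q ->
  surg p q k f x = ((f p).1, minn (f p).2 (f q).2).
Proof. by rewrite /surg => pq /negPf-> /negPf-> ->; rewrite eqxx eq_sym (negPf pq). Qed.
Lemma surg_o p q k f x : x != p -> x != q -> (f x).1 != p -> (f x).1 != q ->
  surg p q k f x = f x.
Proof. by rewrite /surg => /negPf-> /negPf-> /negPf-> /negPf->. Qed.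

Lemma surg_sym p q k f x : p != q -> surg p q k f x = surg q p k f x.
Proof.
move=> pq; have qp : q != p by rewrite eq_sym.
have [->|xp] := eqVneq x p; first by rewrite surg_p surg_q.
have [->|xq] := eqVneq x q; first by rewrite surg_p surg_q.
have [fp|fp] := eqVneq (f x).1 p; first by rewrite surg_mp // surg_mq // minnC.
have [fq|fq] := eqVneq (f x).1 q; first by rewrite surg_mq // surg_mp // minnC.
by rewrite !surg_o.
Qed.

Lemma surg_eq M p q k f g : p < M -> q < M -> (forall x, x < M -> f x = g x) ->
  forall x, x < M -> surg p q k f x = surg p q k g x.
Proof. by move=> pM qM e x xM; rewrite /surg !e. Qed.

Lemma surg_mt M p q k f : p < M -> q < M -> p != q -> mt M f -> mt M (surg p q k f).
Proof.
move=> pM qM pq w; have qp : q != p by rewrite eq_sym.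
have iv x y : x < M -> (f x).1 = y -> f y = (x, (f x).2) by move=> xM <-; exact: (mt_inv w xM).
split=> x xM.
- have [->|xp] := eqVneq x p; first by rewrite surg_p.
  have [->|xq] := eqVneq x q; first by rewrite surg_q.
  have [fp|fp] := eqVneq (f x).1 p; first by rewrite surg_mp //=; exact: (mt_lt w).
  have [fq|fq] := eqVneq (f x).1 q; first by rewrite surg_mq //=; exact: (mt_lt w).
  by rewrite !surg_o //; exact: (mt_lt w).
- have [->|xp] := eqVneq x p; first by rewrite surg_p.
  have [->|xq] := eqVneq x q; first by rewrite surg_q.
  have [fp|fp] := eqVneq (f x).1 p.
    rewrite surg_mp //=; apply/eqP => e.
    by rewrite (iv _ _ qM e) /= in fp; rewrite fp eqxx in pq.
  have [fq|fq] := eqVneq (f x).1 q.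
    rewrite surg_mq //=; apply/eqP => e.
    by rewrite (iv _ _ pM e) /= in fq; rewrite fq eqxx in pq.
  by rewrite !surg_o //; exact: (mt_neq w).
- have [->|xp] := eqVneq x p; first by rewrite surg_p surg_q.
  have [->|xq] := eqVneq x q; first by rewrite surg_q //= surg_p.
  have [fp|fp] := eqVneq (f x).1 p.
    have ep := iv _ _ xM fp.
    have e1 : (f (f q).1).1 = q by rewrite (mt_inv w qM).
    have n1 : (f q).1 != p by apply/eqP => e; rewrite e ep /= in e1; rewrite e1 eqxx in xq.
    by rewrite (surg_mp k xp xq fp) /= (surg_mq k pq n1 (mt_neq w qM) e1) ep.
  have [fq|fq] := eqVneq (f x).1 q.
    have eq := iv _ _ xM fq.
    have e1 : (f (f p).1).1 = p by rewrite (mt_inv w pM).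
    have n1 : (f p).1 != q by apply/eqP => e; rewrite e eq /= in e1; rewrite e1 eqxx in xp.
    by rewrite (surg_mq k pq xp xq fq) /= (surg_mp k (mt_neq w pM) n1 e1) eq.
  have ex : (f (f x).1).1 = x by rewrite (mt_inv w xM).
  rewrite [surg p q k f x]surg_o //.
  by rewrite surg_o ?ex //; exact: (mt_inv w).
Qed.

(** By symmetry, commutation has to be examined only at the positions tied to [p]. *)
Lemma surgC_core M p q r s k k' f x : mt M f -> x < M -> p < M -> q < M -> r < M -> s < M ->
  uniq [:: p; q; r; s] -> x \notin [:: p; q; r; s] -> (f x).1 = p ->
  surg p q k (surg r s k' f) x = surg r s k' (surg p q k f) x.
Proof.
move=> w xM pM qM rM sM; rewrite /= !inE !negb_or !andbT.
case/and3P=> /and3P[pq pr ps] /andP[qr qs] rs /and4P[xp xq xr xs] fx.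
have iv x0 y : x0 < M -> (f x0).1 = y -> f y = (x0, (f x0).2) by move=> xM' <-; exact: (mt_inv w xM').
have ep := iv _ _ xM fx.
have e1 : surg r s k' f x = f x by rewrite surg_o ?fx.
have e2 : surg r s k' f p = f p by rewrite surg_o ?ep.
rewrite surg_mp ?e1 // e2.
have e3 : surg p q k f x = ((f q).1, minn (f p).2 (f q).2) by rewrite surg_mp.
have aux r' s' k2 : r' < M -> s' < M -> r' != s' -> p != r' -> p != s' -> q != r' -> q != s' -> x != r' -> x != s' ->
  (f q).1 = r' -> ((surg r' s' k2 f q).1, minn (f p).2 (surg r' s' k2 f q).2) =
  surg r' s' k2 (surg p q k f) x.
  move=> rM' sM' rs' pr' ps' qr' qs' xr' xs' fq.
  have er := iv _ _ qM fq.
  rewrite surg_mp //= [RHS]surg_mp ?e3 //.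
  have fsp : (f s').1 != p by apply/eqP => e; have := iv _ _ sM' e; rewrite ep => -[e']; rewrite e' eqxx in xs'.
  have fsq : (f s').1 != q by apply/eqP => e; have := iv _ _ sM' e; rewrite (surjective_pairing (f q)) fq => -[e']; rewrite e' eqxx in rs'.
  have [rp sp rq sq] : [/\ r' != p, s' != p, r' != q & s' != q].
    by rewrite !(eq_sym _ p) !(eq_sym _ q).
  rewrite (surg_o k sp sq fsp fsq).
  rewrite (surg_mq k pq rp rq) ?er //=.
  by rewrite minnA.
have [fr|fr] := eqVneq (f q).1 r; first exact: aux.
have [fs|fs] := eqVneq (f q).1 s.
  rewrite surg_sym // [RHS]surg_sym //.
  by apply: aux => //; rewrite eq_sym.
by rewrite [surg r s k' f q]surg_o // surg_o ?e3.
Qed.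

Lemma surgC M p q r s k k' f x : mt M f -> x < M -> p < M -> q < M -> r < M -> s < M ->
  uniq [:: p; q; r; s] ->
  surg p q k (surg r s k' f) x = surg r s k' (surg p q k f) x.
Proof.
move=> w xM pM qM rM sM u.
have := u; rewrite /= !inE !negb_or !andbT.
case/and3P=> /and3P[pq pr ps] /andP[qr qs] rs.
have [xi|xi] := boolP (x \in [:: p; q; r; s]).
  have n1 := (eq_sym p, eq_sym q, eq_sym r).
  have [qp rp sp] : [/\ q != p, r != p & s != p] by rewrite !(eq_sym _ p).
  have [rq sq sr] : [/\ r != q, s != q & s != r] by rewrite !(eq_sym _ q) (eq_sym s).
  move: xi; rewrite !inE => /or4P[] /eqP->; rewrite ?surg_p ?surg_q //;
    by rewrite surg_o ?surg_p ?surg_q.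
have eqs a b c g h : a != b -> (forall y, y < M -> g y = h y) -> a < M -> b < M -> surg a b c g x = surg b a c h x.
  by move=> ab e aM bM; rewrite surg_sym //; exact: (@surg_eq M).
have [fp|fp] := eqVneq (f x).1 p; first exact: (@surgC_core M).
have [fq|fq] := eqVneq (f x).1 q.
  rewrite surg_sym // (@surgC_core M) //.
    by apply: (@surg_eq M) => // y _; symmetry; exact: surg_sym.
    by move: u; rewrite /= !inE; lia.
  by move: xi; rewrite !inE !negb_or => /and4P[-> -> -> ->].
have [fr|fr] := eqVneq (f x).1 r.
  rewrite [RHS](@surgC_core M) //.
    by move: u; rewrite /= !inE; lia.
  by move: xi; rewrite !inE !negb_or => /and4P[-> -> -> ->].
have [fs|fs] := eqVneq (f x).1 s.
  rewrite [RHS]surg_sym // [RHS](@surgC_core M) //.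
  - by apply: (@surg_eq M) => // y _; exact: surg_sym.
  - by move: u; rewrite /= !inE; lia.
  by move: xi; rewrite !inE !negb_or => /and4P[-> -> -> ->].
move: xi; rewrite !inE !negb_or => /and4P[xp xq xr xs].
have e1 : surg r s k' f x = f x by rewrite surg_o.
have e2 : surg p q k f x = f x by rewrite surg_o.
by rewrite surg_o ?e1 // surg_o ?e2.
Qed.

Lemma surg_arc M p q k f x : mt M f -> x < M -> p < M -> q < M -> p != q -> f p = (q, k) -> surg p q k f x = f x.
Proof.
move=> w xM pM qM pq fp.
have iv x0 y : x0 < M -> (f x0).1 = y -> f y = (x0, (f x0).2) by move=> xM' <-; exact: (mt_inv w xM').
have fq : f q = (p, k) by have := iv p q pM; rewrite fp; apply.
have [->|xp] := eqVneq x p; first by rewrite surg_p.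
have [->|xq] := eqVneq x q; first by rewrite surg_q.
apply: surg_o => //; apply/eqP => e; have := iv _ _ xM e.
  by rewrite fp => -[e']; rewrite e' eqxx in xq.
by rewrite fq => -[e']; rewrite e' eqxx in xp.
Qed.

Lemma surg_idem M p q k f x : mt M f -> x < M -> p < M -> q < M -> p != q ->
  surg p q k (surg p q k f) x = surg p q k f x.
Proof.
by move=> w xM pM qM pq; apply: (@surg_arc M) => //; [exact: surg_mt|rewrite surg_p].
Qed.

(** The strand that ends at [p] is led through two intermediate arcs, labelled k + 1 and k;
    its own label survives in the minimum because it is at most k. *)
Lemma surg_braid M p q r k f x : mt M f -> x < M -> p < M -> q < M -> r < M ->
  uniq [:: p; q; r] -> (f p).2 <= k ->
  surg q r k.+1 (surg p q k (surg q r k.+1 f)) x = surg q r k.+1 f x.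
Proof.
move=> w0 xM pM qM rM; rewrite /= !inE !negb_or !andbT => /andP[/andP[pq pr] qr] lp0.
have [qp rp rq] : [/\ q != p, r != p & r != q] by rewrite !(eq_sym _ p) (eq_sym r).
have w := surg_mt k.+1 qM rM qr w0.
have lp : (surg q r k.+1 f p).2 <= k.
  have iv := mt_inv w0 pM.
  rewrite /surg (negPf pq) (negPf pr); case: eqP => [e|_] /=.
    by rewrite geq_min -e iv /= lp0.
  by case: eqP => [e|_] //=; rewrite geq_min -e iv /= lp0 orbT.
have gq : surg q r k.+1 f q = (r, k.+1) by rewrite surg_p.
have gr : surg q r k.+1 f r = (q, k.+1) by rewrite surg_q.
move: (surg q r k.+1 f) w lp gq gr => g w lp gq gr.
have iv x0 y : x0 < M -> (g x0).1 = y -> g y = (x0, (g x0).2) by move=> xM' <-; exact: (mt_inv w xM').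
have gpq : (g p).1 != q by apply/eqP => e; have := iv _ _ pM e; rewrite gq => -[e']; rewrite e' eqxx in pr.
have gpr : (g p).1 != r by apply/eqP => e; have := iv _ _ pM e; rewrite gr => -[e']; rewrite e' eqxx in pq.
have hr : surg p q k g r = ((g p).1, (g p).2).
  by rewrite surg_mq ?gr // gq /=; congr (_, _); lia.
have [->|xq] := eqVneq x q; first by rewrite surg_p gq.
have [->|xr] := eqVneq x r; first by rewrite surg_q ?gr.
have [->|xp] := eqVneq x p.
  rewrite surg_mp ?surg_p // hr surg_q //= [RHS]surjective_pairing; congr (_, _); lia.
have gxq : (g x).1 != q by apply/eqP => e; have := iv _ _ xM e; rewrite gq => -[e']; rewrite e' eqxx in xr.
have gxr : (g x).1 != r by apply/eqP => e; have := iv _ _ xM e; rewrite gr => -[e']; rewrite e' eqxx in xq.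
have [gx|gx] := eqVneq (g x).1 p.
  have gp := iv _ _ xM gx.
  have hx : surg p q k g x = (r, (g p).2).
    by rewrite surg_mp // gq /=; congr (_, _); lia.
  rewrite surg_mq ?hx // surg_q ?hr //= gp /= [RHS]surjective_pairing gx; congr (_, _).
  rewrite gp /= in lp; lia.
have hx : surg p q k g x = g x by rewrite surg_o.
by rewrite surg_o ?hx.
Qed.

End Surgery.

(** * The action of the generators on diagrams *)

Section Words.
Local Open Scope nat_scope.
Implicit Types (f g : nat -> nat * nat) (w : seq nat).

Lemma eqa_sym N f g : eqa N f g -> eqa N g f.
Proof. by move=> e x xN; rewrite e. Qed.
Lemma eqa_trans N f g h : eqa N f g -> eqa N g h -> eqa N f h.
Proof. by move=> e e' x xN; rewrite e // e'. Qed.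

Lemma wf_eqa N f g : eqa N f g -> wf N f -> wf N g.
Proof.
move=> e w; have lt := wf_lt w.
split.
- by move=> p pN; rewrite -e //; exact: lt.
- by move=> p pN; rewrite -e //; exact: (wf_neq w).
- by move=> p pN; rewrite -!e //; [exact: (wf_inv w)|exact: lt].
- move=> p q qN pq; have pN : p < N + N by exact: ltn_trans qN.
  by rewrite -!e //; exact: (wf_nc w).
- by move=> p pN; rewrite -e //; exact: (wf_pos w).
- by move=> p pN; rewrite -e //; exact: (wf_le w).
- by move=> p pN; rewrite -e //; exact: (wf_odd w).
- move=> p q pN qp; have qN : q < N + N by exact: ltn_trans pN.
  by rewrite -!e //; exact: (wf_nest w).
Qed.

(** The part of [wf] on which the relations between generators depend. It is visibly stable
    under surgery, whereas the stability of [wf] comes out of the normal form of words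
    ([La_wf]). *)
Definition good N f := mt (N + N) f /\ forall p, p < N + N -> (f p).2 <= ab N p.

Lemma wf_good N f : wf N f -> good N f.
Proof.
move=> w; split; last exact: (wf_le w).
by split; [exact: (wf_lt w)|move=> p pN; apply/eqP; exact: (wf_neq w)|exact: (wf_inv w)].
Qed.

(** [lact i f] is A_i f and [bact N i f] is f A_i: surgery at the nodes i, i + 1, respectively
    at their barred copies. *)
Definition lact (i : nat) f := surg i.-1 i i f.
Definition bact (N i : nat) f := surg (N + N - i.+1) (N + N - i) i f.

Lemma lact_eqa N i f g : 0 < i < N -> eqa N f g -> eqa N (lact i f) (lact i g).
Proof. by move=> iN e; apply: surg_eq => //; lia. Qed.

Lemma bact_eqa N i f g : 0 < i < N -> eqa N f g -> eqa N (bact N i f) (bact N i g).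
Proof. by move=> iN e; apply: surg_eq => //; lia. Qed.

Lemma surg_good N p q k f : p < N + N -> q < N + N -> p != q -> k <= ab N p -> k <= ab N q ->
  good N f -> good N (surg p q k f).
Proof.
move=> pN qN pq kp kq [w le]; split; first exact: surg_mt.
move=> x xN; rewrite /surg; case: eqP => [->//|_]; case: eqP => [->//|_].
have iv := mt_inv w xN; have := le _ xN => lx.
case: eqP => [e|_] /=; first by rewrite geq_min -e iv /= lx.
case: eqP => [e|_] //=; by rewrite geq_min -e iv /= lx orbT.
Qed.

Lemma lact_good N i f : 0 < i < N -> good N f -> good N (lact i f).
Proof.
move=> iN; apply: surg_good; try lia.
  have := ab_spec N i.-1; lia.
have := ab_spec N i; lia.
Qed.

Lemma bact_good N i f : 0 < i < N -> good N f -> good N (bact N i f).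
Proof.
move=> iN; apply: surg_good; try lia.
  have := ab_spec N (N + N - i.+1); lia.
have := ab_spec N (N + N - i); lia.
Qed.

Definition letters N w := all (fun i => 0 < i < N) w.

Definition La w f := foldr lact f w.

Lemma La_cat u v f : La (u ++ v) f = La u (La v f).
Proof. exact: foldr_cat. Qed.

Lemma La_eqa N w f g : letters N w -> eqa N f g -> eqa N (La w f) (La w g).
Proof. by elim: w => //= i w IH /andP[iN wN] e; apply: lact_eqa => //; exact: IH. Qed.

Lemma La_good N w f : letters N w -> good N f -> good N (La w f).
Proof. by elim: w => //= i w IH /andP[iN wN] e; apply: lact_good => //; exact: IH. Qed.

Lemma lact_bact N i j f : 0 < i < N -> 0 < j < N -> good N f ->
  eqa N (lact i (bact N j f)) (bact N j (lact i f)).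
Proof.
move=> iN jN [w _] x xN; apply: (surgC (M := N + N)) => //; try lia.
by rewrite /= !inE; lia.
Qed.

Lemma lactC N i j f : 0 < i -> i.+1 < j -> j < N -> good N f ->
  eqa N (lact i (lact j f)) (lact j (lact i f)).
Proof.
move=> i0 ij jN [w _] x xN; apply: (surgC (M := N + N)) => //; try lia.
by rewrite /= !inE; lia.
Qed.

Lemma lact_idem N i f : 0 < i < N -> good N f -> eqa N (lact i (lact i f)) (lact i f).
Proof. by move=> iN [w _] x xN; apply: (surg_idem (M := N + N)) => //; lia. Qed.

Lemma lact_braid N i f : 0 < i -> i.+1 < N -> good N f ->
  eqa N (lact i.+1 (lact i (lact i.+1 f))) (lact i.+1 f).
Proof.
move=> i0 iN [w le] x xN; apply: (surg_braid (M := N + N)) => //; try lia.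
- by rewrite /= !inE; lia.
have := le i.-1; have := ab_spec N i.-1; lia.
Qed.

Lemma surg_ins n c p q k f : p < n + c -> q < n + c ->
  surg p q k (ins n c f) =1 ins n c (surg p q k f).
Proof.
move=> pK qK x.
have sp y : (sh (n + c) y == p) = (y == p).
  by apply/eqP/eqP; have := sh_spec (n + c) y; lia.
have sq y : (sh (n + c) y == q) = (y == q).
  by apply/eqP/eqP; have := sh_spec (n + c) y; lia.
have ip : ins n c f p = (sh (n + c) (f p).1, (f p).2).
  by rewrite -ins_sh /sh pK.
have iq : ins n c f q = (sh (n + c) (f q).1, (f q).2).
  by rewrite -ins_sh /sh qK.
case: (posP (n + c) x) => [->|->|[y ->]]; rewrite ?ins_k ?ins_k1 ?ins_sh.
- by rewrite surg_o ?ins_k //=; apply/eqP; lia.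
- by rewrite surg_o ?ins_k1 //=; apply/eqP; lia.
rewrite /surg sp sq ins_sh ip iq /= sp sq.
case: ifP => _ /=; first by rewrite /sh qK.
case: ifP => _ /=; first by rewrite /sh pK.
by case: ifP => _ //=; case: ifP => _ //=.
Qed.

Lemma lact_ins n c i f : 0 < i < n -> lact i (ins n c f) =1 ins n c (lact i f).
Proof. by move=> h; apply: surg_ins; lia. Qed.

Lemma ins_eqa n c f g : c <= n -> eqa n f g -> eqa n.+1 (ins n c f) (ins n c g).
Proof.
move=> cn e x xN; case: (posP (n + c) x) xN => [->|->|[y ->]] xN; rewrite ?ins_k ?ins_k1 ?ins_sh //.
by rewrite e //; have := sh_spec (n + c) y; lia.
Qed.

Lemma La_ins n c w f : c <= n -> letters n w -> eqa n.+1 (La w (ins n c f)) (ins n c (La w f)).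
Proof.
move=> cn; elim: w => //= i w IH /andP[iN wN] x xN.
rewrite (@lact_eqa n.+1 i _ (ins n c (La w f))) //; last first.
  exact: IH.
  by lia.
exact: lact_ins.
Qed.

(** The only relation between insertions and generators that leaves the smaller algebra. It
    is what turns the words of permutations into chains of insertions ([La_desc]). *)
Lemma lact_top m c f : c <= m -> good m f ->
  eqa m.+2 (lact m.+1 (ins m.+1 0 (ins m c f))) (ins m.+1 c.+1 (ins m 0 f)).
Proof.
move=> cm [w le] x xN; rewrite /lact /=.
set g := ins m c f; set h := ins m 0 f.
have g0 : ins m.+1 0 g m.+1 = (m.+2, m.+2).
  by rewrite -[in X in ins _ _ _ X](addn0 m.+1) ins_k addn0 subn0.
have g1 : ins m.+1 0 g m.+2 = (m.+1, m.+2).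
  by have := ins_k1 m.+1 0 g; rewrite addn0 subn0.
have gs y : ins m.+1 0 g (sh m.+1 y) = (sh m.+1 (g y).1, (g y).2).
  by have := ins_sh m.+1 0 g y; rewrite addn0.
have hs y : h (sh m y) = (sh m (f y).1, (f y).2).
  by have := ins_sh m 0 f y; rewrite addn0.
have h0 : h m = (m.+1, m.+1) by have := ins_k m 0 f; rewrite addn0 subn0.
have h1 : h m.+1 = (m, m.+1) by have := ins_k1 m 0 f; rewrite addn0 subn0.
have gm : ins m.+1 0 g m = (sh m.+1 (g m).1, (g m).2).
  by rewrite -gs /sh ltnSn.
have gk : g (m + c) = ((m + c).+1, m.+1 - c) by exact: ins_k.
have gk1 : g (m + c).+1 = (m + c, m.+1 - c) by exact: ins_k1.
have K : m.+1 + c.+1 = (m + c).+2 by lia.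
case: (posP (m.+1 + c.+1) x) xN => [->|->|[y ->]] xN; rewrite ?ins_k ?ins_k1 ?ins_sh.
-
  have [/eqP c0|c0] := boolP (c == 0).
    subst c; rewrite addn1 surg_mq ?g1 ?g0 //=; try (by apply/eqP; lia).
    rewrite gm; rewrite addn0 subn0 in gk; rewrite gk /=.
    by rewrite /sh ltnn; congr (_, _); lia.
  have e : m.+1 + c.+1 = sh m.+1 (m + c) by have := sh_spec m.+1 (m + c); lia.
  have s1 := sh_spec m.+1 (m + c); have s2 := sh_spec m.+1 (m + c).+1.
  rewrite {1}e surg_o ?gs ?gk //=; try lia.
  by congr (_, _); lia.
- have e : (m.+1 + c.+1).+1 = sh m.+1 (m + c).+1 by have := sh_spec m.+1 (m + c).+1; lia.
  have [/eqP c0|c0] := boolP (c == 0).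
    subst c; have s1 := sh_spec m.+1 (m + 0); have s2 := sh_spec m.+1 (m + 0).+1.
    rewrite {1}e surg_mp ?gs ?gk1 ?g0 //=; try lia.
    rewrite gm; rewrite addn0 subn0 in gk; rewrite gk /=.
    by congr (_, _); lia.
  have s1 := sh_spec m.+1 (m + c); have s2 := sh_spec m.+1 (m + c).+1.
  rewrite {1}e surg_o ?gs ?gk1 //=; try lia.
  by congr (_, _); lia.
- have yN : y < m.+1 + m.+1 by have := sh_spec (m.+1 + c.+1) y; lia.
  case: (posP m y) yN => [->|->|[z ->]] yN.
  + rewrite h0 /= (_ : sh (m.+1 + c.+1) m = m) ?surg_p; last by have := sh_spec (m.+1 + c.+1) m; lia.
    by congr (_, _); have := sh_spec (m.+1 + c.+1) m.+1; lia.
  + rewrite h1 /= (_ : sh (m.+1 + c.+1) m.+1 = m.+1); last by have := sh_spec (m.+1 + c.+1) m.+1; lia.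
    rewrite surg_q; last by apply/eqP; lia.
    by congr (_, _); have := sh_spec (m.+1 + c.+1) m; lia.
  rewrite hs /=.
  have zN : z < m + m by have := sh_spec m z; lia.
  have ltz := mt_lt w zN; have nz := mt_neq w zN; have iz := mt_inv w zN.
  have [/eqP zm|zm] := boolP ((z == m) && (0 < c)).
    have [ez c0] : z = m /\ 0 < c by lia.
    subst z; rewrite (_ : sh (m.+1 + c.+1) _ = m.+2); last first.
      have := sh_spec m m; have := sh_spec (m.+1 + c.+1) (sh m m); lia.
    rewrite surg_mq ?g1 ?g0 //=; try (by apply/eqP; lia).
    rewrite gm (_ : g m = (sh (m + c) (f m).1, (f m).2)) /=; last first.
      by rewrite -ins_sh /sh ifT //; lia.
    have := le m zN; have := ab_spec m m.
    have := sh_spec m.+1 (sh (m + c) (f m).1); have := sh_spec (m + c) (f m).1.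
    have := sh_spec (m.+1 + c.+1) (sh m (f m).1); have := sh_spec m (f m).1.
    move/eqP: nz => nz *; congr (_, _); lia.
  have e2 : sh (m.+1 + c.+1) (sh m z) = sh m.+1 (sh (m + c) z).
    have := sh_spec m.+1 (sh (m + c) z); have := sh_spec (m + c) z.
    have := sh_spec (m.+1 + c.+1) (sh m z); have := sh_spec m z.
    lia.
  have e3 : ins m.+1 0 g (sh m.+1 (sh (m + c) z)) = (sh m.+1 (sh (m + c) (f z).1), (f z).2).
    by rewrite gs {1 2}/g ins_sh.
  rewrite e2.
  have nm : sh m.+1 (sh (m + c) z) != m.
    apply/eqP; have := sh_spec m.+1 (sh (m + c) z); have := sh_spec (m + c) z; lia.
  have nm1 : sh m.+1 (sh (m + c) z) != m.+1.
    apply/eqP; have := sh_spec m.+1 (sh (m + c) z); have := sh_spec (m + c) z; lia.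
  have nq : sh m.+1 (sh (m + c) (f z).1) != m.+1.
    apply/eqP; have := sh_spec m.+1 (sh (m + c) (f z).1); have := sh_spec (m + c) (f z).1; lia.
  have [/andP[/eqP fm c0]|fm] := boolP (((f z).1 == m) && (0 < c)).
    rewrite surg_mp ?e3 ?g0 //=; last first.
      have := sh_spec m.+1 (sh (m + c) (f z).1); have := sh_spec (m + c) (f z).1; lia.
    rewrite gm (_ : g m = (sh (m + c) (f m).1, (f m).2)) /=; last first.
      by rewrite -ins_sh /sh ifT //; lia.
    rewrite fm in iz ltz *; rewrite iz /=.
    have := le m ltz; have := ab_spec m m; rewrite iz /=.
    have := sh_spec m m; have := sh_spec (m.+1 + c.+1) (sh m m).
    move=> *; congr (_, _); lia.
  rewrite surg_o ?e3 //=; last first.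
    apply/eqP; have := sh_spec m.+1 (sh (m + c) (f z).1); have := sh_spec (m + c) (f z).1; lia.
  congr (_, _).
  have := sh_spec m.+1 (sh (m + c) (f z).1); have := sh_spec (m + c) (f z).1.
  have := sh_spec (m.+1 + c.+1) (sh m (f z).1); have := sh_spec m (f z).1.
  lia.
Qed.

End Words.

(** * Normal forms of words *)

Section Codes.
Local Open Scope nat_scope.
Implicit Types (f g c : nat -> nat) (w : seq nat).

Definition idf (N x : nat) : nat * nat := (N + N - x.+1, ab N x).

Lemma idf_ins n : eqa n.+1 (idf n.+1) (ins n 0 (idf n)).
Proof.
move=> x xN; case: (posP (n + 0) x) xN => [->|->|[y ->]] xN; rewrite ?ins_k ?ins_k1 ?ins_sh /idf /=.
- by rewrite /ab; congr (_, _); [lia|rewrite addn0 ltnSn subn0].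
- by rewrite /ab; congr (_, _); [lia|rewrite addn0 ltnn; lia].
have := sh_spec (n + 0) y; have := sh_spec (n + 0) (n + n - y.+1).
have := ab_spec n.+1 (sh (n + 0) y); have := ab_spec n y.
move=> *; congr (_, _); lia.
Qed.

Lemma idf_wf N : wf N (idf N).
Proof.
elim: N => [|n IH]; first by split.
by apply: wf_eqa (eqa_sym (@idf_ins n)) _; apply: ins_wf.
Qed.

Definition desc i k := [seq i - j | j <- iota 0 k].

Lemma descS i k : desc i.+1 k.+1 = i.+1 :: desc i k.
Proof.
rewrite /desc /= subn0; congr (_ :: _).
by rewrite (iotaDl 1 0) -map_comp; apply: eq_map => j /=; rewrite add1n subSS.
Qed.

Lemma desc_rcons i k : desc i k.+1 = rcons (desc i k) (i - k).
Proof. by rewrite /desc -addn1 iotaD map_cat cats1. Qed.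

Lemma desc_cat i a b : desc i (a + b) = desc i a ++ desc (i - a) b.
Proof.
rewrite /desc iotaD map_cat; congr (_ ++ _).
by rewrite add0n -[in LHS](addn0 a) iotaDl -map_comp; apply: eq_map => j /=; lia.
Qed.

Lemma mem_desc i k x : x \in desc i k -> k <= i -> i - k < x <= i.
Proof. by case/mapP => j; rewrite mem_iota => jk -> ki; lia. Qed.

Lemma letters_desc i k N : i < N -> k <= i -> letters N (desc i k).
Proof. by move=> iN ki; apply/allP => x /mem_desc /(_ ki); lia. Qed.

Lemma letters_cat N u v : letters N (u ++ v) = letters N u && letters N v.
Proof. exact: all_cat. Qed.

Lemma letters_le N M w : N <= M -> letters N w -> letters M w.
Proof. by move=> NM; apply: sub_all => x; lia. Qed.

Lemma La_desc N k : k <= N -> eqa N.+1 (La (desc N k) (idf N.+1)) (ins N k (idf N)).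
Proof.
elim: N k => [|m IH] [|k] // kN; try exact: idf_ins.
rewrite descS /=.
apply: eqa_trans (lact_eqa (g := ins m.+1 0 (ins m k (idf m))) _ _) _.
- lia.
- apply: eqa_trans (La_eqa _ (@idf_ins _)) _; first by apply: letters_desc; lia.
  apply: eqa_trans (La_ins _ _ _) _ => //; first by apply: letters_desc; lia.
  by apply: ins_eqa => //; apply: IH; lia.
apply: eqa_trans (lact_top _ _) _ => //; first exact: wf_good (idf_wf m).
by apply: ins_eqa => //; apply: eqa_sym; exact: idf_ins.
Qed.

(** The word of the permutation whose code is [c], see [perm_wordE]. *)
Definition cword N c := flatten [seq desc i (c i) | i <- iota 0 N].

Lemma cwordS N c : cword N.+1 c = cword N c ++ desc N (c N).
Proof. by rewrite /cword -addn1 iotaD map_cat flatten_cat /= cats0. Qed.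

Lemma eq_cword N c c' : (forall i, i < N -> c i = c' i) -> cword N c = cword N c'.
Proof.
elim: N => // n IH h; rewrite !cwordS (h n) // IH // => i iN; apply: h; exact: ltnW.
Qed.

Lemma letters_cword N c : (forall i, c i <= i) -> letters N (cword N c).
Proof.
move=> h; elim: N => // n IH; rewrite cwordS letters_cat letters_desc // andbT.
exact: letters_le IH.
Qed.

(** The diagram of the permutation whose code is [c], see [diagram_permE]. *)
Fixpoint chain N c := if N is n.+1 then ins n (c n) (chain n c) else idf 0.

Lemma La_cword N c : (forall i, c i <= i) -> eqa N (La (cword N c) (idf N)) (chain N c).
Proof.
move=> h; elim: N => [|n IH]; first by [].
rewrite cwordS La_cat /=.
have ln := letters_cword n h.
apply: eqa_trans (La_eqa (letters_le (leqnSn n) ln) (La_desc (h n))) _.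
by apply: eqa_trans (La_ins _ _ ln) (ins_eqa _ IH).
Qed.

Lemma chain_wf N c : (forall i, c i <= i) -> wf N (chain N c).
Proof.
move=> h; elim: N => [|n IH]; first by apply: idf_wf.
by apply: ins_wf.
Qed.

Lemma eq_chain N c c' : (forall i, i < N -> c i = c' i) -> chain N c = chain N c'.
Proof.
by elim: N => //= n IH h; rewrite (h n) // IH // => i iN; apply: h; exact: ltnW.
Qed.

Lemma chain_onto N (f : nat -> nat * nat) : wf N f ->
  exists c, (forall i, c i <= i) /\ eqa N f (chain N c).
Proof.
elim: N f => [|n IH] f w; first by exists (fun=> 0).
have [k [kn f0 f1 top]] := wf_top w.
have [c [cle e]] := IH _ (del_wf kn f0 f1 top w).
exists (fun i => if i == n then k else c i); split.
  by move=> i; case: eqP => [->|].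
apply: eqa_trans (ins_del kn f0 f1 w) _.
rewrite /= eqxx; apply: ins_eqa => //.
rewrite (_ : chain n _ = chain n c) //.
by apply: eq_chain => i iN; case: eqP => // iN'; lia.
Qed.

Lemma chain_inj N c c' : (forall i, c i <= i) -> (forall i, c' i <= i) ->
  eqa N (chain N c) (chain N c') -> forall i, i < N -> c i = c' i.
Proof.
move=> h h'; elim: N => // n IH e i.
have [e1 e2] := ins_inj (chain_wf n h) (chain_wf n h') (h n) (h' n) e.
rewrite ltnS leq_eqVlt => /orP[/eqP->//|]; exact: IH.
Qed.

End Codes.

Section Rewriting.
Variables (K : fieldType) (X Y : nat -> K).
Implicit Types (f g : nat -> nat * nat) (w : seq nat) (l : K).

(** A formal derivation of E_a = l E_b from the relations of the algebra. The same derivation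
    is read in the algebra ([weq_Ew]) and on diagrams, where the scalar is forgotten
    ([weq_La]). *)
Inductive weq : K -> seq nat -> seq nat -> Prop :=
| Wrefl w : weq 1%R w w
| Wtrans l l' a b c : weq l a b -> weq l' b c -> weq (l * l')%R a c
| Wcat l l' a a' b b' : weq l a a' -> weq l' b b' -> weq (l * l')%R (a ++ b) (a' ++ b')
| Wsq i : weq (X i) [:: i; i] [:: i]
| Wcomm i j : (i.+2 <= j)%N -> weq 1%R [:: i; j] [:: j; i]
| Wcomm' i j : (i.+2 <= j)%N -> weq 1%R [:: j; i] [:: i; j]
| Wbraid i : (0 < i)%N -> weq (Y i) [:: i.+1; i; i.+1] [:: i.+1].

Local Open Scope nat_scope.

Lemma weq_letters N l a b : weq l a b -> letters N a -> letters N b.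
Proof.
elim=> //=.
- by move=> l1 l2 u v z _ IH1 _ IH2 /IH1/IH2.
- by move=> l1 l2 u u' v v' _ IH1 _ IH2; rewrite !letters_cat => /andP[/IH1-> /IH2->].
- by move=> i /andP[].
- by move=> i j _; rewrite !andbT andbC.
- by move=> i j _; rewrite !andbT andbC.
- by move=> i _ /andP[->].
Qed.

Lemma weq_La N l a b f : weq l a b -> letters N a -> good N f -> eqa N (La a f) (La b f).
Proof.
move=> h; elim: h f => {l a b} //=.
- move=> l l' a b c e1 IH1 _ IH2 f la gf.
  by apply: eqa_trans (IH1 _ la gf) (IH2 _ (weq_letters e1 la) gf).
- move=> l l' a a' b b' e1 IH1 e2 IH2 f; rewrite letters_cat => /andP[la lb] gf.
  rewrite !La_cat; apply: eqa_trans (IH1 _ la _) _; first exact: La_good.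
  exact: La_eqa (weq_letters e1 la) (IH2 _ lb gf).
- by move=> i f /andP[iN _]; exact: lact_idem.
- move=> i j ij f; rewrite andbT => /andP[iN jN]; apply: lactC; lia.
- move=> i j ij f; rewrite andbT => /andP[iN jN] gf; apply: eqa_sym; apply: lactC => //; lia.
- move=> i i0 f /andP[iN _]; apply: lact_braid; lia.
Qed.

Definition nz := forall i, (0 < i) -> (X i != 0)%R /\ (Y i != 0)%R.

Lemma weq_nz N l a b : nz -> weq l a b -> letters N a -> (l != 0)%R.
Proof.
move=> h; elim=> {l a b} //=.
- by move=> w _; exact: oner_neq0.
- move=> l l' a b c e1 IH1 _ IH2 la; rewrite mulf_neq0 ?IH1 ?IH2 //.
  exact: weq_letters e1 la.
- by move=> l l' a a' b b' _ IH1 _ IH2; rewrite letters_cat => /andP[la lb]; rewrite mulf_neq0 ?IH1 ?IH2.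
- by move=> i /andP[/andP[i0 _] _]; case: (h i i0).
- by move=> *; exact: oner_neq0.
- by move=> *; exact: oner_neq0.
- by move=> i i0 _; case: (h i i0).
Qed.

Lemma weq_catl u l a b : weq l a b -> weq l (u ++ a) (u ++ b).
Proof. by move=> e; rewrite -[l]mul1r; apply: Wcat e; exact: Wrefl. Qed.
Lemma weq_catr u l a b : weq l a b -> weq l (a ++ u) (b ++ u).
Proof. by move=> e; rewrite -[l]mulr1; apply: Wcat e _; exact: Wrefl. Qed.
Lemma weq_tr1 l a b c : weq 1%R a b -> weq l b c -> weq l a c.
Proof. by move=> e; rewrite -{2}[l]mul1r; exact: Wtrans. Qed.
Lemma weq_tr2 l a b c : weq l a b -> weq 1%R b c -> weq l a c.
Proof. by move=> e e'; rewrite -[l]mulr1; exact: Wtrans e e'. Qed.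

Definition far (a b : seq nat) := forall x y, x \in a -> y \in b -> x.+2 <= y \/ y.+2 <= x.

Lemma weq_far a b : far a b -> weq 1%R (a ++ b) (b ++ a).
Proof.
elim: a => [|x a IH] h; first by rewrite cats0; exact: Wrefl.
have {}IH : weq 1%R (a ++ b) (b ++ a) by apply: IH => u v ua; apply: h; rewrite inE ua orbT.
apply: weq_tr1 (weq_catl [:: x] IH) _.
rewrite catA -[x :: a]cat1s [b ++ _]catA; apply: weq_catr.
have {}h y : y \in b -> x.+2 <= y \/ y.+2 <= x by apply: h; rewrite inE eqxx.
elim: b h {IH} => [|y b IH] h; first exact: Wrefl.
have e : weq 1%R [:: x; y] [:: y; x].
  by have [xy|yx] := h y ltac:(by rewrite inE eqxx); [exact: Wcomm|exact: Wcomm'].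
apply: weq_tr1 (weq_catr b e) _.
by apply: (weq_catl [:: y]); apply: IH => z zb; apply: h; rewrite inE zb orbT.
Qed.

(** What happens to a block E_N ... E_{N-c+1} multiplied on the right by E_i, in this lemma and
    the next three: a small i commutes with the block, i = N - c lengthens it, i = N - c + 1 is absorbed
    with the factor x_i, and a larger i is removed by a braid relation, which leaves a shorter
    block behind letters smaller than N. *)
Lemma desc_mul_lt N c i : i + c < N -> weq 1%R (desc N c ++ [:: i]) (i :: desc N c).
Proof.
move=> h; apply: weq_far => x y /mem_desc xd; rewrite inE => /eqP->.
have := xd ltac:(lia); lia.
Qed.

Lemma desc_mul_eq N c : desc N c ++ [:: N - c] = desc N c.+1.
Proof. by rewrite cats1 -desc_rcons. Qed.

Lemma desc_mul_sq N c : weq (X (N - c)) (desc N c.+1 ++ [:: N - c]) (desc N c.+1).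
Proof. by rewrite -desc_mul_eq -catA; apply: weq_catl; exact: Wsq. Qed.

Lemma desc_mul_gt N c i : i <= N -> N.+1 < i + c -> c <= N ->
  weq (Y i.-1) (desc N c ++ [:: i]) (desc (i - 2) (c - (N - i) - 2) ++ desc N (N - i).+1).
Proof.
move=> iN h cN.
set d := c - (N - i) - 2; set w := desc (i - 2) d.
have i2 : 1 < i by lia.
have e1 : desc N c = desc N (N - i) ++ ([:: i; i.-1] ++ w).
  rewrite (_ : c = (N - i) + (2 + d)); last by rewrite /d; lia.
  rewrite desc_cat; congr (_ ++ _).
  rewrite (_ : N - (N - i) = i) ?desc_cat; last lia.
  by rewrite /desc /= subn0 subn1.
have wl x : x \in w -> 0 < x /\ x <= i - 2.
  move=> /mem_desc xd; have := xd ltac:(rewrite /d; lia); lia.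
rewrite e1 -!catA.
have f1 : weq 1%R (w ++ [:: i]) ([:: i] ++ w).
  by apply: weq_far => x y /wl ?; rewrite inE => /eqP->; lia.
have s1 : weq (Y i.-1) ([:: i; i.-1] ++ w ++ [:: i]) ([:: i] ++ w).
  apply: weq_tr1 (weq_catl _ f1) _; rewrite catA; apply: weq_catr.
  have -> : i = i.-1.+1 by lia.
  by apply: Wbraid; lia.
apply: weq_tr2 (weq_catl _ s1) _.
rewrite catA (_ : desc N (N - i) ++ [:: i] = desc N (N - i).+1); last first.
  by rewrite -desc_mul_eq; congr (_ ++ [:: _]); lia.
apply: weq_far => x y /mem_desc xd /wl [y1 y2]; have := xd ltac:(lia); lia.
Qed.

Lemma step_nf N w : letters N.+1 w -> exists l w' c,
  [/\ c <= N, letters N w' & weq l w (w' ++ desc N c)].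
Proof.
elim/last_ind: w => [|w i IH] lw.
  by exists 1%R, [::], 0; split=> //; exact: Wrefl.
move: lw; rewrite -cats1 letters_cat /= andbT => /andP[lw iN].
have [l [w' [c [cN lw' e]]]] := IH lw.
have {}e := weq_catr [:: i] e.
rewrite -catA in e.
have [h|h] := ltnP (i + c) N.
  exists (l * 1)%R, (w' ++ [:: i]), c; split=> //.
    by rewrite letters_cat lw' /= andbT; lia.
  apply: Wtrans e _; rewrite -catA; apply: weq_catl; exact: desc_mul_lt.
have [h1|h1] : i + c = N \/ N < i + c by lia.
  exists l, w', c.+1; split=> //; first lia.
  by rewrite -desc_mul_eq (_ : N - c = i) //; lia.
have [h2|h2] : i + c = N.+1 \/ N.+1 < i + c by lia.
  have [d ed] : exists d, c = d.+1 by exists c.-1; lia.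
  exists (l * X i)%R, w', c; split=> //.
  apply: Wtrans e _; apply: weq_catl; subst c.
  have -> : i = N - d by lia.
  exact: desc_mul_sq.
exists (l * Y i.-1)%R, (w' ++ desc (i - 2) (c - (N - i) - 2)), (N - i).+1; split.
- lia.
- rewrite letters_cat lw' letters_desc //; lia.
- apply: Wtrans e _; rewrite -catA; apply: weq_catl; apply: desc_mul_gt; lia.
Qed.

(** Consequently two words with the same diagram are proportional in the algebra: by
    [chain_inj] they have the same normal form. *)
Lemma word_nf N w : letters N w -> exists l c, (forall i, c i <= i) /\ weq l w (cword N c).
Proof.
elim: N w => [|n IH] w lw.
  exists 1%R, (fun=> 0); split=> //; case: w lw => [|i w] /=; first by move=> _; exact: Wrefl.
  by case/andP; lia.
have [l [w' [k [kn lw' e]]]] := step_nf lw.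
have [l' [c [cle e']]] := IH _ lw'.
exists (l * l')%R, (fun i => if i == n then k else c i); split.
  by move=> i; case: eqP => [->|].
apply: Wtrans e _.
rewrite cwordS eqxx (_ : cword n _ = cword n c); last first.
  by apply: eq_cword => i iN; case: eqP => // iN'; lia.
exact: weq_catr.
Qed.

End Rewriting.

Section WordDiagrams.
Local Open Scope nat_scope.
Implicit Types (f g : nat -> nat * nat) (w : seq nat).

(** Planarity of A_w is inherited from the chain of insertions given by the normal form. *)
Lemma La_wf N w : letters N w -> wf N (La w (idf N)).
Proof.
move=> lw; have [c [cle ee]] : exists c, (forall i, c i <= i) /\ eqa N (La w (idf N)) (chain N c).
  have [l [c [cle e]]] := word_nf (fun=> 1%R : rat) (fun=> 1%R) lw; exists c; split=> //.
  apply: eqa_trans (weq_La e lw (wf_good (idf_wf N))) _; exact: La_cword.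
apply: wf_eqa (eqa_sym ee) _; exact: chain_wf.
Qed.

Lemma lact_wf N i f : 0 < i < N -> wf N f -> wf N (lact i f).
Proof.
move=> iN w; have [c [cle e]] := chain_onto w.
have {}e := eqa_trans e (eqa_sym (La_cword cle)).
apply: wf_eqa (eqa_sym (lact_eqa iN e)) _.
by apply: (La_wf (w := i :: cword N c)); rewrite /= iN letters_cword.
Qed.

Lemma wf_word n f : wf n f -> exists w, letters n w /\ eqa n (La w (idf n)) f.
Proof.
move=> wfn; have [c [h e]] := chain_onto wfn; exists (cword n c); split.
  exact: letters_cword.
exact: eqa_trans (La_cword h) (eqa_sym e).
Qed.

End WordDiagrams.

(** * Words in the Okada algebra *)

Section OkadaWords.
Local Open Scope ring_scope.
Variables (K : fieldType) (X Y : nat -> K).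

Local Notation cl N := (\pi_(okada X Y N))%qT.
Local Notation gen N := (okada_gen X Y N).

Lemma cl_mul N a b : cl N (EMul a b) = cl N a * cl N b.
Proof. by rewrite [RHS]okada_mulE. Qed.
Lemma cl_add N a b : cl N (EAdd a b) = cl N a + cl N b.
Proof. by rewrite [RHS]okada_addE. Qed.
Lemma cl_cst N k : cl N (ECst k) = k%:A.
Proof. by rewrite -[RHS]/(_ * _) mulr1. Qed.
Lemma scale_cl N k (p : okada X Y N) : k *: p = cl N (ECst k) * p.
Proof. by []. Qed.

Lemma gen_in N (i : okada_index N) : gen N (val i) = cl N (EGen i).
Proof. by rewrite /okada_gen valK. Qed.

Lemma gen_out N i : ~~ (0 < i < N)%N -> gen N i = 0.
Proof. by move=> h; rewrite /okada_gen insubN. Qed.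

Lemma genP N i : (0 < i < N)%N -> exists j : okada_index N, val j = i.
Proof. by move=> h; exists (Sub i h). Qed.

Lemma gen_sq N i : gen N i * gen N i = X i *: gen N i.
Proof.
have [/genP[j <-]|h] := boolP (0 < i < N)%N; last by rewrite !gen_out // mulr0 scaler0.
by rewrite !gen_in scale_cl -!cl_mul; apply/okada_clP/OGenSq.
Qed.

Lemma gen_comm N i j : (i.+2 <= j)%N -> gen N i * gen N j = gen N j * gen N i.
Proof.
have [/genP[i' <-]|h] := boolP (0 < i < N)%N; last by rewrite (gen_out h) mulr0 mul0r.
have [/genP[j' <-]|h] := boolP (0 < j < N)%N; last by rewrite (gen_out h) mulr0 mul0r.
by move=> ij; rewrite !gen_in -!cl_mul; apply/okada_clP/OGenComm.
Qed.

Lemma gen_braid N i : (0 < i)%N -> gen N i.+1 * gen N i * gen N i.+1 = Y i *: gen N i.+1.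
Proof.
move=> i0.
have [h|h] := boolP (0 < i.+1 < N)%N; last by rewrite (gen_out h) mulr0 scaler0.
have [i' ei] : exists j : okada_index N, val j = i by apply: genP; lia.
have [j ej] := genP h; rewrite -ej -ei !gen_in scale_cl -!cl_mul.
by apply/okada_clP; apply: OGenBraid; rewrite ei.
Qed.

Definition Ew N (w : seq nat) : okada X Y N := \prod_(i <- w) gen N i.

Lemma Ew_cat N u v : Ew N (u ++ v) = Ew N u * Ew N v.
Proof. exact: big_cat. Qed.
Lemma Ew1 N i : Ew N [:: i] = gen N i.
Proof. exact: big_seq1. Qed.
Lemma Ew0 N : Ew N [::] = 1.
Proof. exact: big_nil. Qed.
Lemma Ew_cons N i w : Ew N (i :: w) = gen N i * Ew N w.
Proof. exact: big_cons. Qed.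

Lemma weq_Ew N l a b : weq X Y l a b -> Ew N a = l *: Ew N b.
Proof.
elim=> {l a b}.
- by move=> w; rewrite scale1r.
- by move=> l l' a b c _ -> _ ->; rewrite scalerA.
- by move=> l l' a a' b b' _ e1 _ e2; rewrite !Ew_cat e1 e2 -scalerAl -scalerAr scalerA.
- by move=> i; rewrite Ew_cons !Ew1 gen_sq.
- by move=> i j ij; rewrite !Ew_cons !Ew0 !mulr1 scale1r (gen_comm _ ij).
- by move=> i j ij; rewrite !Ew_cons !Ew0 !mulr1 scale1r (gen_comm _ ij).
- by move=> i i0; rewrite !Ew_cons !Ew0 !mulr1 mulrA gen_braid.
Qed.

Lemma incl_gen N i : (0 < i < N)%N -> okada_incl X Y N (gen N i) = gen N.+1 i.
Proof.
move=> /genP[j <-]; rewrite gen_in okada_inclE /=.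
rewrite -gen_in SubK; done.
Qed.

Lemma incl_Ew N w : letters N w -> okada_incl X Y N (Ew N w) = Ew N.+1 w.
Proof.
elim: w => [|i w IH] /=; first by rewrite !Ew0 rmorph1.
by case/andP=> iN lw; rewrite !Ew_cons rmorphM /= incl_gen // IH.
Qed.

Lemma incl_scale N k (p : okada X Y N) : okada_incl X Y N (k *: p) = k *: okada_incl X Y N p.
Proof. by rewrite !scale_cl rmorphM /= okada_inclE. Qed.

Lemma okada_gen_ind N (P : okada X Y N -> Prop) :
  (forall k, P k%:A) -> (forall i, (0 < i < N)%N -> P (gen N i)) ->
  (forall p q, P p -> P q -> P (p + q)) -> (forall p q, P p -> P q -> P (p * q)) ->
  forall p, P p.
Proof.
move=> Pk Pg PD PM; elim/okada_ind; elim=> [k|i|a Pa b Pb|a Pa b Pb].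
- by rewrite cl_cst.
- by rewrite -gen_in; exact: Pg (valP i).
- by rewrite cl_add; exact: PD.
- by rewrite cl_mul; exact: PM.
Qed.

Lemma okada_span N (p : okada X Y N) : exists s : seq (K * seq nat),
  all (fun x => letters N x.2) s /\ p = \sum_(x <- s) x.1 *: Ew N x.2.
Proof.
elim/okada_gen_ind: p => [k|i iN|p q [s [ls ->]] [t [lt ->]]|p q [s [ls ->]] [t [lt ->]]].
- by exists [:: (k, [::])]; split=> //; rewrite big_seq1 /= Ew0.
- by exists [:: (1, [:: i])]; split; [rewrite /= iN|rewrite big_seq1 /= Ew1 scale1r].
- by exists (s ++ t); rewrite all_cat ls lt big_cat.
exists [seq (x.1 * y.1, x.2 ++ y.2) | x <- s, y <- t]; split.
  apply/allP => z /allpairsP[[x y] /= [xs yt ->]] /=.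
  by rewrite letters_cat (allP ls _ xs) (allP lt _ yt).
rewrite big_allpairs_dep /= mulr_suml; apply: eq_bigr => x _.
rewrite mulr_sumr; apply: eq_bigr => y _.
by rewrite Ew_cat -scalerAl -scalerAr scalerA.
Qed.

Section Regular.
Variable n : nat.
Local Notation O := (okada X Y n).

(** Let B_c = E_n E_{n-1} ... E_{n-c+1} for 0 <= c <= n. The algebra of rank n + 1 is meant to be free
    over the algebra of rank n on the B_c, and [rmul i c = (u, d)] prescribes B_c E_i = u B_d; the
    four cases are those of [desc_mul_lt] and the lemmas after it. Compatibility of this rule with the defining
    relations gives the algebra of rank n + 1 a representation by matrices over the algebra
    of rank n, in which right multiplication by B_c is visibly injective on the smaller
    algebra ([incl_desc_inj]). *)
Definition rmul (i c : nat) : O * nat :=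
  if (i + c < n)%N then (gen n i, c)
  else if (i + c == n)%N then (1, c.+1)
  else if (i + c == n.+1)%N then ((X i)%:A, c)
  else ((Y i.-1) *: Ew n (desc (i - 2) (c - (n - i) - 2)), (n - i).+1).

Lemma rmul_le i c : (0 < i <= n)%N -> (c <= n)%N -> ((rmul i c).2 <= n)%N.
Proof. by rewrite /rmul => iN cN; case: ifP => // ?; case: eqP => /= ?; [lia|case: eqP => /= ?; lia]. Qed.

(** Each row has one nonzero entry at most, so that products are compositions ([smat_mul]). *)
Definition smat (F : nat -> O * nat) : 'M[O]_n.+1 :=
  \matrix_(c, d) if (d : nat) == (F c).2 then (F c).1 else 0.

Lemma smat_mul F G : (forall c, (c <= n)%N -> ((F c).2 <= n)%N) ->
  smat F * smat G = smat (fun c => ((F c).1 * (G (F c).2).1, (G (F c).2).2)).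
Proof.
move=> hF; apply/matrixP => c d; rewrite !mxE.
have cn : (c <= n)%N by rewrite -ltnS.
have lt : ((F c).2 < n.+1)%N by rewrite ltnS hF.
rewrite (bigD1 (Ordinal lt)) //= !mxE /= eqxx big1 ?addr0.
  by case: ifP => // _; rewrite mulr0.
move=> e /eqP ne; rewrite !mxE ifF ?mul0r //.
by apply/eqP => h; apply: ne; apply: val_inj.
Qed.

Lemma eq_smat F G : (forall c, (c <= n)%N -> F c = G c) -> smat F = smat G.
Proof. by move=> e; apply/matrixP => c d; rewrite !mxE e // -ltnS. Qed.

Lemma smat_scale (k : K) F : (k%:A)%:M * smat F = smat (fun c => (k *: (F c).1, (F c).2)).
Proof.
apply/matrixP => c d; rewrite [_ * _]mul_scalar_mx !mxE; case: ifP => _; last by rewrite mulr0.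
by rewrite -scalerAl mul1r.
Qed.

Lemma Ew_gen_far w i : (forall x, x \in w -> (x.+2 <= i)%N \/ (i.+2 <= x)%N) ->
  gen n i * Ew n w = Ew n w * gen n i.
Proof.
move=> h; rewrite -Ew1 -!Ew_cat (weq_Ew n (weq_far X Y (b := w) _)) ?scale1r //.
by move=> x y; rewrite inE => /eqP-> /h; lia.
Qed.

Lemma desc_gen_lt i c j : (j + c < i)%N -> gen n j * Ew n (desc i c) = Ew n (desc i c) * gen n j.
Proof. by move=> h; apply: Ew_gen_far => x /mem_desc xd; have := xd ltac:(lia); lia. Qed.

Lemma desc_gen_sq i c : Ew n (desc i c.+1) * gen n (i - c) = X (i - c) *: Ew n (desc i c.+1).
Proof. by rewrite -Ew1 -Ew_cat (weq_Ew n (desc_mul_sq X Y i c)). Qed.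

Lemma desc_gen_eq i c : Ew n (desc i c) * gen n (i - c) = Ew n (desc i c.+1).
Proof. by rewrite -Ew1 -Ew_cat desc_mul_eq. Qed.

Lemma desc_gen_gt N c i : (i <= N)%N -> (N.+1 < i + c)%N -> (c <= N)%N ->
  Ew n (desc N c) * gen n i = Y i.-1 *: (Ew n (desc (i - 2) (c - (N - i) - 2)) * Ew n (desc N (N - i).+1)).
Proof. by move=> *; rewrite -Ew1 -!Ew_cat (weq_Ew n (desc_mul_gt X Y _ _ _)). Qed.

Lemma rmul_far i c : (i + c < n)%N -> rmul i c = (gen n i, c).
Proof. by rewrite /rmul => ->. Qed.
Lemma rmul_next i c : (i + c)%N = n -> rmul i c = (1, c.+1).
Proof. by rewrite /rmul => ->; rewrite ltnn eqxx. Qed.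
Lemma rmul_square i c : (i + c)%N = n.+1 -> rmul i c = ((X i)%:A, c).
Proof. by rewrite /rmul => h; rewrite h eqxx !ifF //; [apply/eqP|]; lia. Qed.
Lemma rmul_inner i c : (n.+1 < i + c)%N ->
  rmul i c = ((Y i.-1) *: Ew n (desc (i - 2) (c - (n - i) - 2)), (n - i).+1).
Proof. by rewrite /rmul => h; rewrite !ifF //; try apply/eqP; lia. Qed.

Lemma rmulP i c : [\/ (i + c < n)%N, (i + c)%N = n, (i + c)%N = n.+1 | (n.+1 < i + c)%N].
Proof.
case: (ltnP (i + c) n) => h1; first by constructor 1.
have [h2|h2] := eqVneq (i + c)%N n; first by constructor 2.
have [h3|h3] := eqVneq (i + c)%N n.+1; first by constructor 3.
by constructor 4; lia.
Qed.

Lemma rmul_sq i c : (0 < i <= n)%N -> (c <= n)%N ->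
  ((rmul i c).1 * (rmul i (rmul i c).2).1, (rmul i (rmul i c).2).2) =
  (X i *: (rmul i c).1, (rmul i c).2).
Proof.
move=> iN cN; case: (rmulP i c) => h.
- by rewrite !rmul_far //= gen_sq.
- by rewrite (rmul_next h) /= rmul_square ?mul1r //; lia.
- by rewrite !(rmul_square h) /= mulr_algr.
by rewrite (rmul_inner h) /= rmul_square ?mulr_algr //; lia.
Qed.

Lemma rmul_comm i j c : (0 < i)%N -> (i.+2 <= j <= n)%N -> (c <= n)%N ->
  ((rmul i c).1 * (rmul j (rmul i c).2).1, (rmul j (rmul i c).2).2) =
  ((rmul j c).1 * (rmul i (rmul j c).2).1, (rmul i (rmul j c).2).2).
Proof.
move=> i0 ij cN; case: (rmulP i c) => hi.
- rewrite (rmul_far hi) /=; case: (rmulP j c) => hj.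
  + by rewrite (rmul_far hj) /= rmul_far //= gen_comm //; lia.
  + by rewrite (rmul_next hj) /= rmul_far ?mulr1 ?mul1r //; lia.
  + by rewrite (rmul_square hj) /= rmul_far //= mulr_algl mulr_algr.
  + rewrite (rmul_inner hj) /= rmul_far /=; last by lia.
    rewrite -scalerAl -scalerAr desc_gen_lt //; lia.
- rewrite (rmul_next hi) /= mul1r rmul_inner; last by lia.
  rewrite rmul_inner /=; last by lia.
  rewrite rmul_far /=; last by lia.
  rewrite -scalerAl (_ : i = (j - 2 - (c - (n - j) - 2))%N) ?desc_gen_eq; last by lia.
  by congr (_ *: Ew n (desc _ _), _); lia.
- rewrite (rmul_square hi) /= rmul_inner; last by lia.
  rewrite /= rmul_far /=; last by lia.
  rewrite mulr_algl -scalerAl.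
  have -> : (c - (n - j) - 2 = (c - (n - j) - 3).+1)%N by lia.
  have -> : gen n i = gen n (j - 2 - (c - (n - j) - 3)) by congr okada_gen; lia.
  rewrite desc_gen_sq !scalerA; congr (_ *: _, _).
  by rewrite mulrC; congr (_ * X _); lia.
rewrite (rmul_inner hi) /= rmul_inner /=; last by lia.
rewrite rmul_inner /=; last by lia.
rewrite rmul_far /=; last by lia.
rewrite -scalerAl -scalerAl -scalerAr desc_gen_gt; try lia.
rewrite !scalerA mulrC; congr (_ *: (Ew n (desc _ _) * Ew n (desc _ _)), _); lia.
Qed.

Lemma rmul_braid i c : (0 < i)%N -> (i.+1 <= n)%N -> (c <= n)%N ->
  let r1 := rmul i.+1 c in let r2 := rmul i r1.2 in let r3 := rmul i.+1 r2.2 in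
  ((r1.1 * r2.1) * r3.1, r3.2) = (Y i *: r1.1, r1.2).
Proof.
move=> i0 iN cN /=; case: (rmulP i.+1 c) => h.
- by rewrite (rmul_far h) /= (rmul_far (i := i)) /= ?(rmul_far h) /= ?gen_braid //; lia.
- rewrite (rmul_next h) /= (rmul_next (i := i)) /=; last by lia.
  rewrite rmul_inner /=; last by lia.
  rewrite !mul1r (_ : (_ - _ - 2 = 0)%N) ?Ew0; last by lia.
  by congr (_, _); lia.
- rewrite (rmul_square h) /= (rmul_next (i := i)) /=; last by lia.
  rewrite rmul_inner /=; last by lia.
  rewrite (_ : (_ - _ - 2 = 0)%N) ?Ew0; last by lia.
  rewrite mulr1 mulr_algl scalerA mulrC -scalerA; congr (_, _); lia.
rewrite (rmul_inner h) /= (rmul_next (i := i)) /=; last by lia.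
rewrite rmul_inner /=; last by lia.
rewrite (_ : (_.+2 - _ - 2 = 0)%N) ?Ew0; last by lia.
rewrite mulr1 mulr_algr; congr (_, _); lia.
Qed.

Fixpoint ev (e : okada_expr K n.+1) : 'M[O]_n.+1 :=
  match e with
  | ECst k => (k%:A)%:M
  | EGen i => smat (rmul (val i))
  | EAdd a b => ev a + ev b
  | EMul a b => ev a * ev b
  end.

Lemma scalC (k : K) (A : 'M[O]_n.+1) : (k%:A)%:M * A = A * (k%:A)%:M.
Proof.
rewrite [LHS]mul_scalar_mx; apply/matrixP => i j; rewrite !mxE (bigD1 j) //= !mxE eqxx mulr1n.
rewrite big1 ?addr0 ?mulr_algl ?mulr_algr // => l lj.
by rewrite mxE (negPf lj) mulr0n mulr0.
Qed.

Lemma ev_rel a b : okada_rel X Y a b -> ev a = ev b.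
Proof.
elim=> {a b} /=; try by [].
- by move=> a b c _ -> _ ->.
- by move=> a a' b b' _ -> _ ->.
- by move=> a a' b b' _ -> _ ->.
- by move=> a b c; rewrite addrA.
- by move=> a b; rewrite addrC.
- by move=> a; rewrite scale0r raddf0 add0r.
- by move=> a; rewrite scaleN1r raddfN /= mulN1r addNr scale0r raddf0.
- by move=> a b c; rewrite mulrA.
- by move=> a; rewrite scale1r mul1r.
- by move=> a b c; rewrite mulrDl.
- by move=> a b c; rewrite mulrDr.
- by move=> k l; rewrite scalerDl raddfD.
- by move=> k l; rewrite [RHS]mul_scalar_mx scale_scalar_mx mulr_algl scalerA.
- by move=> k a; exact: scalC.
- move=> [i iN] /=; rewrite smat_mul => [|c cn]; last by apply: rmul_le; lia.
  rewrite smat_scale; apply: eq_smat => c cn; apply: rmul_sq => //; lia.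
- move=> [i iN] [j jN] /= ij.
  rewrite !smat_mul => [|c cn|c cn]; try by apply: rmul_le; lia.
  by apply: eq_smat => c cn; apply: rmul_comm => //; lia.
move=> [i iN] [j jN] /= ij; subst j.
have le1 c : (c <= n)%N -> ((rmul i c).2 <= n)%N by move=> cn; apply: rmul_le; lia.
have le2 c : (c <= n)%N -> ((rmul i.+1 c).2 <= n)%N by move=> cn; apply: rmul_le; lia.
rewrite smat_mul // smat_mul /= => [|c cn]; last by apply: le1; exact: le2.
rewrite smat_scale; apply: eq_smat => c cn; apply: rmul_braid => //; lia.
Qed.

Definition evq (p : okada X Y n.+1) := ev (generic_quotient.repr p).

Lemma evq_cl a : evq (cl n.+1 a) = ev a.
Proof. by apply: ev_rel; exact: okada_repr. Qed.

Lemma evqM p q : evq (p * q) = evq p * evq q.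
Proof.
by elim/okada_ind: p => a; elim/okada_ind: q => b; rewrite -cl_mul !evq_cl.
Qed.

Lemma evq1 : evq 1 = 1.
Proof. by rewrite [LHS]evq_cl /= scale1r. Qed.

Lemma evq_gen i : (0 < i <= n)%N -> evq (gen n.+1 i) = smat (rmul i).
Proof. by move=> h; have [j <-] : exists j : okada_index n.+1, val j = i; [exact: genP|rewrite gen_in evq_cl]. Qed.

Lemma ev_incl p d : evq (okada_incl X Y n p) 0 d = if d == 0 then p else 0.
Proof.
elim/okada_ind: p d => a d; rewrite okada_inclE evq_cl.
elim: a d => [k|i|a IHa b IHb|a IHa b IHb] d /=.
- by rewrite mxE cl_cst eq_sym; case: eqP; rewrite ?mulr1n ?mulr0n.
- have iN : (0 < val i < n)%N := valP i; rewrite mxE rmul_far /=; last by rewrite addn0; case/andP: iN.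
  by rewrite -(inj_eq val_inj) /= gen_in.
- by rewrite mxE IHa IHb cl_add; case: eqP => // _; rewrite addr0.
rewrite mxE (bigD1 ord0) //= IHa eqxx IHb big1 ?addr0; first by case: eqP => // _; rewrite ?cl_mul ?mulr0.
by move=> j j0; rewrite IHa (negPf j0) mul0r.
Qed.

Lemma ev_desc k d : (k <= n)%N -> evq (Ew n.+1 (desc n k)) 0 d = (d == k :> nat)%:R.
Proof.
elim: k d => [|k IH] d kn; first by rewrite Ew0 evq1 mxE eq_sym -(inj_eq val_inj).
rewrite desc_rcons -cats1 Ew_cat Ew1 evqM evq_gen; last by lia.
have kN : (k < n.+1)%N by lia.
rewrite mxE (bigD1 (Ordinal kN)) //= IH ?eqxx ?mul1r; last by lia.
rewrite mxE rmul_next /=; last by lia.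
rewrite big1 ?addr0; first by case: eqP.
move=> j; rewrite -(inj_eq val_inj) /= => jk; rewrite IH ?(negPf jk) ?mul0r //; lia.
Qed.

(** The first row of the matrix of p B_k has p as its only nonzero entry, in column k. *)
Lemma incl_desc_inj k p q : (k <= n)%N ->
  okada_incl X Y n p * Ew n.+1 (desc n k) = okada_incl X Y n q * Ew n.+1 (desc n k) -> p = q.
Proof.
move=> kn /(congr1 (fun r => evq r 0 (inord k))); rewrite !evqM !mxE.
have H r : \sum_j evq (okada_incl X Y n r) 0 j * evq (Ew n.+1 (desc n k)) j (inord k) = r.
  rewrite (bigD1 ord0) //= ev_incl eqxx ev_desc // inordK ?ltnS // eqxx mulr1 big1 ?addr0 //.
  by move=> j j0; rewrite ev_incl (negPf j0) mul0r.
by rewrite !H.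
Qed.

End Regular.

Lemma Ew_cwordS n c : (forall i, c i <= i)%N ->
  Ew n.+1 (cword n.+1 c) = okada_incl X Y n (Ew n (cword n c)) * Ew n.+1 (desc n (c n)).
Proof. by move=> h; rewrite cwordS Ew_cat incl_Ew //; exact: letters_cword. Qed.

(** The scalars lambda are well determined because the elements E_D do not vanish. *)
Lemma Ew_cword_neq0 n c : (forall i, c i <= i)%N -> Ew n (cword n c) != 0.
Proof.
move=> h; elim: n => [|n IH]; first by rewrite Ew0 oner_neq0.
rewrite Ew_cwordS //; apply: contra_neq IH => e.
by apply: (incl_desc_inj (h n)); rewrite e rmorph0 mul0r.
Qed.

End OkadaWords.

(** * From diagrams to functions on positions *)

Section Bridge.
Local Open Scope nat_scope.
Variable N : nat.
Implicit Types (D : prediagram N) (a b : node N) (f g : nat -> nat * nat).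

Lemma node_pos_lt a : node_pos a < N + N.
Proof. by case: a => j /=; have := ltn_ord j; lia. Qed.

Lemma node_pos_inj : injective (@node_pos N).
Proof.
move=> [i|i] [j|j] /= e; have := ltn_ord i; have := ltn_ord j => hj hi; try (exfalso; lia);
  by congr (_ _); apply: val_inj => /=; lia.
Qed.

Lemma node_pos_onto p : p < N + N -> exists a, node_pos a = p.
Proof.
move=> pN; have [h|h] := ltnP p N; first by exists (inl (Ordinal h)).
have h' : N + N - p.+1 < N by lia.
by exists (inr (Ordinal h')) => /=; lia.
Qed.

Definition node_at p : option (node N) := [pick a | node_pos a == p].

Lemma node_atK a : node_at (node_pos a) = Some a.
Proof.
rewrite /node_at; case: pickP => [b /eqP/node_pos_inj->//|/(_ a)].
by rewrite eqxx.
Qed.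

(** [pf] and [mk] translate diagrams into functions on positions and back ([mk_pf], [pf_mk]). *)
Definition pf D p : nat * nat :=
  if node_at p is Some a then (node_pos (mate D a), label D a) else (0, 0).

Definition mk f : prediagram N :=
  [ffun a => (odflt a (node_at (f (node_pos a)).1), inord (f (node_pos a)).2)].

Lemma pfE D a : pf D (node_pos a) = (node_pos (mate D a), label D a).
Proof. by rewrite /pf node_atK. Qed.

Lemma abE a : ab N (node_pos a) = node_abs a.
Proof. by case: a => j; have := ltn_ord j; have := ab_spec N (node_pos (inl j)); have := ab_spec N (node_pos (inr j)) => /=; lia. Qed.

Lemma eqa_nodes f g : (forall a, f (node_pos a) = g (node_pos a)) -> eqa N f g.
Proof. by move=> e p /node_pos_onto[a <-]. Qed.

Lemma pf_mk f : good N f -> eqa N (pf (mk f)) f.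
Proof.
move=> [w le]; apply: eqa_nodes => a; rewrite pfE /mate /label !ffunE /=.
have aN := node_pos_lt a.
have [b eb] := node_pos_onto (mt_lt w aN).
rewrite -eb node_atK /= eb inordK -?surjective_pairing //.
have := le _ aN; have := ab_spec N (node_pos a); lia.
Qed.

Lemma eq_mk f g : eqa N f g -> mk f = mk g.
Proof. by move=> e; apply/ffunP => a; rewrite !ffunE e // node_pos_lt. Qed.

Lemma mk_pf D : mk (pf D) = D.
Proof.
apply/ffunP => a; rewrite !ffunE pfE /= node_atK /= /mate /label inord_val.
by rewrite -surjective_pairing.
Qed.

Lemma pf_inj D D' : eqa N (pf D) (pf D') -> D = D'.
Proof. by move=> e; rewrite -(mk_pf D) -(mk_pf D'); exact: eq_mk. Qed.

Lemma is_okadaP D : is_okada D <-> wf N (pf D).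
Proof.
split.
- case/and4P=> /forallP/= ma /forallP/= nc /forallP/= lb /forallP/= ne.
  split.
  + by move=> p /node_pos_onto[a <-]; rewrite pfE node_pos_lt.
  + move=> p /node_pos_onto[a <-]; rewrite pfE /= => /node_pos_inj e.
    by have /andP[] := ma a; rewrite e eqxx.
  + move=> p /node_pos_onto[a <-]; rewrite pfE /= pfE /mate /label.
    by have /andP[_ /eqP ->] := ma a.
  + move=> p q qN pq; have /node_pos_onto[a ea] : p < N + N by lia.
    have [b eb] := node_pos_onto qN; subst p q; rewrite !pfE /= => h1 h2.
    by have /forallP/(_ b)/negP := nc a; apply; apply/and3P.
  + by move=> p /node_pos_onto[a <-]; rewrite pfE /=; case/andP: (lb a) => /andP[].
  + move=> p /node_pos_onto[a <-]; rewrite pfE /= abE.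
    by case/andP: (lb a) => /andP[_ h] _; apply: leq_trans h _; exact: geq_minl.
  + by move=> p /node_pos_onto[a <-]; rewrite pfE /= !abE; case/andP: (lb a) => _ /eqP.
  + move=> p q pN qp; have /node_pos_onto[b eb] : q < N + N by lia.
    have [a ea] := node_pos_onto pN; subst p q; rewrite !pfE /= => h1 h2.
    by have /forallP/(_ b)/implyP := ne a; apply; apply/and3P.
move=> w; apply/and4P; split; apply/forallP => a /=.
- have aN := node_pos_lt a.
  have := wf_neq w aN; have := wf_inv w aN; rewrite pfE /= pfE => -[e1 e2] e3.
  apply/andP; split; first by apply/eqP => e; apply: e3; rewrite e.
  rewrite [D (mate D a)]surjective_pairing; apply/eqP; congr (_, _).
    exact: node_pos_inj.
  exact: val_inj.
- apply/forallP => b; apply/negP => /and3P[h1 h2 h3].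
  by apply: (wf_nc w (node_pos_lt b) h1); rewrite !pfE.
- have aN := node_pos_lt a.
  have := wf_pos w aN; have := wf_le w aN; have := wf_odd w aN; have := wf_le w (wf_lt w aN).
  rewrite (wf_l w aN) pfE /= !abE => h1 -> h2 ->; rewrite eqxx andbT /=.
  by rewrite leq_min h1 h2.
- apply/forallP => b; apply/implyP => /and3P[h1 h2 h3].
  have := @wf_nest _ _ w (node_pos a) (node_pos b) (node_pos_lt a) h1.
  by rewrite !pfE; apply.
Qed.

Lemma pf_diagram (D : diagram N) : wf N (pf (val D)).
Proof. by apply/is_okadaP; exact: valP. Qed.

Lemma mk_okada f : wf N f -> is_okada (mk f).
Proof. by move=> w; apply/is_okadaP; exact: wf_eqa (eqa_sym (pf_mk (wf_good w))) w. Qed.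

Definition omin (m l : 'I_N.+1) : 'I_N.+1 := if (m < l)%N then m else l.

Lemma val_omin m l : omin m l = minn m l :> nat.
Proof. by rewrite /omin /minn; case: ifP. Qed.

Section Walk.
Variables (C D : prediagram N).

Lemma walk_stopC (k : nat) (x : node N) (j : 'I_N) (m l : 'I_N.+1) : C x = (inl j, m) -> walk k C D true x l = (inl j, omin m l).
Proof. by case: k => [|k] /= ->. Qed.
Lemma walk_stopD (k : nat) (x : node N) (j : 'I_N) (m l : 'I_N.+1) : D x = (inr j, m) -> walk k C D false x l = (inr j, omin m l).
Proof. by case: k => [|k] /= ->. Qed.
Lemma walk_C (k : nat) (x : node N) (j : 'I_N) (m l : 'I_N.+1) : 0 < k -> C x = (inr j, m) -> walk k C D true x l = walk k.-1 C D false (inl j) (omin m l).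
Proof. by case: k => [|k] //= _ ->. Qed.
Lemma walk_D (k : nat) (x : node N) (j : 'I_N) (m l : 'I_N.+1) : 0 < k -> D x = (inl j, m) -> walk k C D false x l = walk k.-1 C D true (inr j) (omin m l).
Proof. by case: k => [|k] //= _ ->. Qed.
End Walk.

Section GenMul.
Variables (i : nat) (p q : 'I_N) (D : prediagram N).
Hypotheses (ip : p.+1 = i) (iq : q = i :> nat).
Hypothesis gD : good N (pf D).

Let G := diagram_gen N i.

Let G_side (s : 'I_N -> node N) : s = inl \/ s = inr -> 
  [/\ G (s p) = (s q, inord i), G (s q) = (s p, inord i) &
    forall j, j != p -> j != q -> G (s j) = (node_bar (s j), inord j.+1)].
Proof.
move=> hs; have iN : i < N by rewrite -iq.
have abs_s j : node_abs (s j) = j.+1 by case: hs => ->.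
have mv m j : m.-1 < N -> node_move m (s j) = s (insubd j m.-1) by case: hs => ->.
split.
- rewrite ffunE abs_s ip eqxx mv //=; congr (s _, _).
  by apply: val_inj; rewrite insubdK.
- rewrite ffunE abs_s iq ifF; last by apply/eqP; lia.
  rewrite eqxx mv; last by lia.
  congr (s _, _); apply: val_inj; rewrite /= insubdK; first by rewrite -ip.
  by rewrite -topredE /=; lia.
move=> j jp jq; rewrite ffunE abs_s !ifF ?ffunE ?abs_s //.
  by apply/eqP => e; case/eqP: jq; apply: val_inj => /=; lia.
by apply/eqP => e; case/eqP: jp; apply: val_inj => /=; lia.
Qed.

Let pq : p != q.
Proof. by apply/eqP => e; move: ip; rewrite e; lia. Qed.

Let Dm a : D (mate D a) = (a, (D a).2).
Proof.
have [w _] := gD; have := mt_inv w (node_pos_lt a); rewrite pfE /= pfE => -[e1 e2].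
rewrite [LHS]surjective_pairing; congr (_, _); first exact: node_pos_inj.
exact: val_inj.
Qed.

Let Dn a : mate D a != a.
Proof.
have [w _] := gD; have := mt_neq w (node_pos_lt a); rewrite pfE /=.
by apply: contra_neq => ->.
Qed.

Let Dl a : ((D a).2 : nat) <= node_abs a.
Proof. by have [_ le] := gD; have := le _ (node_pos_lt a); rewrite pfE abE. Qed.

Let Dsw a b m : D a = (b, m) -> D b = (a, m).
Proof. by move=> e; have := Dm a; rewrite /mate e. Qed.

Let lab (m m' : 'I_N.+1) : (m = m' :> nat) -> m = m'.
Proof. exact: val_inj. Qed.

(** The surgery [lact], on nodes instead of positions. *)
Definition capped a : node N * 'I_N.+1 :=
  if a == inl p then (inl q, inord i)
  else if a == inl q then (inl p, inord i)
  else if mate D a == inl p then (mate D (inl q), omin (D (inl p)).2 (D (inl q)).2)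
  else if mate D a == inl q then (mate D (inl p), omin (D (inl p)).2 (D (inl q)).2)
  else D a.

(** A path through the concatenation of A_i with D can traverse the arc of A_i between the
    barred copies of i and i + 1 at most once, in passing from D to D. Every other piece of A_i on the
    path is a straight arc, whose label a does not lower the minimum since the arc of D at the
    node a has a label at most a. *)
Lemma diagram_mul_capped a : diagram_mul G D a = capped a.
Proof.
have iN : i < N by rewrite -iq.
have [Gp Gq Go] := G_side (or_introl erefl).
have [Hp Hq Ho] := G_side (or_intror erefl).
have vi : (inord i : 'I_N.+1) = i :> nat by rewrite inordK //; lia.
have vj (j : 'I_N) : (inord j.+1 : 'I_N.+1) = j.+1 :> nat by rewrite inordK // ltnS.
have npq : p <> q :> nat by lia.
have nqp : (inl q == inl p :> node N) = false by apply/eqP => -[e]; have := pq; rewrite e eqxx.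
have lp := Dl (inl p); have lq := Dl (inl q); rewrite /= in lp lq.
(* the passage through the arc of A_i, entered from D at p' and left towards D at q' *)
have pass (p' q' : 'I_N) x (k : nat) (l : 'I_N.+1) : (p' = p /\ q' = q) \/ (p' = q /\ q' = p) ->
    D x = (inl p', (D x).2) -> x != inl q' -> (D x).2 = l -> 0 < k ->
    (forall z, mate D (inl q') = inl z -> 1 < k) ->
    walk k G D true (inr p') l = (mate D (inl q'), omin (D (inl p)).2 (D (inl q)).2).
  move=> hpq ex nx el f1 f2.
  have ep : D (inl p') = (x, l) by rewrite -el; exact: Dsw.
  have Gp' : G (inr p') = (inr q', inord i) by case: hpq => -[-> ->].
  rewrite (walk_C _ _ _ Gp'); last by lia.
  have lpe : (D (inl p')).2 = l by rewrite ep.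
  have om2 : minn (D (inl q')).2 (minn i l) = minn (D (inl p)).2 (D (inl q)).2.
    by move: lpe; case: hpq => -[-> ->] <-; lia.
  case eq: (D (inl q')) => [[z|z] m'].
  - have f3 : 1 < k by apply: (f2 z); rewrite /mate eq.
    rewrite (walk_D _ _ _ eq); last by lia.
    have ez := Dsw eq.
    have zp : z != p'.
      by apply/eqP => e; move: nx; rewrite e ep in ez; case: ez => ->; rewrite eqxx.
    have zq : z != q' by apply/eqP => e; have := Dn (inl q'); rewrite /mate eq e eqxx.
    rewrite (@walk_stopC G D _ _ z (inord z.+1)); last first.
      by rewrite Ho //; case: hpq zp zq => -[-> ->].
    congr (_, _); first by rewrite /mate eq.
    apply: lab; rewrite !val_omin vi vj -om2 eq /=.
    have := Dl (inl z); rewrite ez /=; lia.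
  rewrite (walk_stopD _ _ _ eq); congr (_, _); first by rewrite /mate eq.
  by apply: lab; rewrite !val_omin vi -om2 eq.
rewrite ffunE /capped.
case: a => x.
- have [->|xp] := eqVneq x p.
    rewrite eqxx (walk_stopC _ _ _ Gp); congr (_, _); apply: lab; rewrite val_omin vi /=; lia.
  have [->|xq] := eqVneq x q.
    rewrite nqp eqxx (walk_stopC _ _ _ Gq); congr (_, _); apply: lab; rewrite val_omin vi /=; lia.
  have nip : (inl x == inl p :> node N) = false by apply/eqP => -[e]; rewrite e eqxx in xp.
  have niq : (inl x == inl q :> node N) = false by apply/eqP => -[e]; rewrite e eqxx in xq.
  rewrite nip niq (walk_C _ _ _ (Go _ xp xq)) ; last by lia.
  have xN := ltn_ord x.
  have xp' : x <> p :> nat by move=> e; case/eqP: xp; exact: val_inj.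
  have xq' : x <> q :> nat by move=> e; case/eqP: xq; exact: val_inj.
  have lx := Dl (inl x); rewrite /= in lx.
  case ex: (D (inl x)) => [[z|z] m]; rewrite /mate ex /=; rewrite ex /= in lx.
  + rewrite (walk_D _ _ _ ex); last by lia.
    have em : omin m (omin (inord x.+1) ord_max) = m by apply: lab; rewrite !val_omin vj /=; have := ltn_ord m; lia.
    rewrite em.
    have aux (p' q' : 'I_N) : (p' = p /\ q' = q) \/ (p' = q /\ q' = p) -> z = p' ->
       walk N.-2 G D true (inr z) m = (mate D (inl q'), omin (D (inl p)).2 (D (inl q)).2).
      move=> hpq e; rewrite e; apply: (pass p' q' (inl x)) => //.
      - by rewrite ex e.
      - by case: hpq => -[_ ->]; rewrite ?nip ?niq.
      - by rewrite ex.
      - clear -iq ip iN xN xp' xq'; lia.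
      - move=> t et; have := Dn (inl q'); rewrite et => tq.
        have tp : t <> p' by move=> et'; have := Dm (inl q'); rewrite et et' -e (Dsw ex) => -[e'] _; case: hpq => -[_ eq']; rewrite e' eq' ?eqxx in xp xq.
        have tx : t <> x by move=> et'; have := Dm (inl q'); rewrite et et' ex e => -[e'] _; case: hpq => -[eq1 eq2]; have := pq; rewrite -eq2 -eq1 e' eqxx.
        have tN := ltn_ord t.
        have : t <> p' :> nat by move=> h; apply: tp; exact: val_inj.
        have : t <> x :> nat by move=> h; apply: tx; exact: val_inj.
        have : t <> q' :> nat by move=> h; move: tq; rewrite (val_inj h) eqxx.
        by case: hpq => -[-> ->]; lia.
    case: eqP => [[e]|zp]; first exact: aux (or_introl (conj erefl erefl)) e.
    case: eqP => [[e]|zq]; first exact: aux (or_intror (conj erefl erefl)) e.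
    rewrite (@walk_stopC G D _ _ z (inord z.+1)); last first.
      by rewrite Ho //; apply/eqP => e; [apply: zp|apply: zq]; rewrite e.
    congr (_, _); apply: lab; rewrite val_omin vj.
    by have := Dl (inl z); rewrite (Dsw ex) /=; lia.
  rewrite (walk_stopD _ _ _ ex) /=; congr (_, _); apply: lab; rewrite !val_omin vj /=; have := ltn_ord m; lia.
rewrite /=.
case ex: (D (inr x)) => [[z|z] m]; rewrite /mate ex /=.
- rewrite (walk_D _ _ _ ex); last by lia.
  have em : omin m ord_max = m by apply: lab; rewrite !val_omin /=; have := ltn_ord m; lia.
  rewrite em.
  have aux (p' q' : 'I_N) : (p' = p /\ q' = q) \/ (p' = q /\ q' = p) -> z = p' ->
     walk N.-1 G D true (inr z) m = (mate D (inl q'), omin (D (inl p)).2 (D (inl q)).2).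
    move=> hpq e; rewrite e; apply: (pass p' q' (inr x)) => //.
    - by rewrite ex e.
    - by rewrite ex.
    - clear -iq ip iN; lia.
    - move=> t et; have := Dn (inl q'); rewrite et => tq.
      have tp : t <> p' by move=> et'; have := Dm (inl q'); rewrite et et' -e (Dsw ex).
      have tN := ltn_ord t.
      have : t <> p' :> nat by move=> h; apply: tp; exact: val_inj.
      have : t <> q' :> nat by move=> h; move: tq; rewrite (val_inj h) eqxx.
      by case: hpq => -[-> ->]; lia.
  case: eqP => [[e]|zp]; first exact: aux (or_introl (conj erefl erefl)) e.
  case: eqP => [[e]|zq]; first exact: aux (or_intror (conj erefl erefl)) e.
  rewrite (@walk_stopC G D _ _ z (inord z.+1)); last first.
    by rewrite Ho //; apply/eqP => e; [apply: zp|apply: zq]; rewrite e.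
  congr (_, _); apply: lab; rewrite val_omin vj.
  by have := Dl (inl z); rewrite (Dsw ex) /=; lia.
rewrite (walk_stopD _ _ _ ex) /=; congr (_, _); apply: lab; rewrite !val_omin /=; have := ltn_ord m; lia.
Qed.

End GenMul.
End Bridge.

(** * Permutations, the elements E_D and the scalars lambda *)

Section Perms.
Local Open Scope nat_scope.

Lemma diagram_mul_gen N i (D : prediagram N) : 0 < i < N -> good N (pf D) ->
  diagram_mul (diagram_gen N i) D = mk N (lact i (pf D)).
Proof.
move=> /andP[i0 iN] gD.
have i1N : i.-1 < N by lia.
pose p := Ordinal i1N; pose q := Ordinal iN.
have ip : p.+1 = i by rewrite /= prednK.
apply: pf_inj; apply: eqa_trans (eqa_sym (pf_mk (lact_good _ gD))); last by rewrite i0.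
apply: eqa_nodes => a; rewrite pfE /mate /label (diagram_mul_capped ip (erefl _ : q = i :> nat) gD) /capped.
have ep : i.-1 = node_pos (inl p : node N) by [].
have eq : i = node_pos (inl q : node N) by [].
rewrite /lact /surg {1}ep {4}eq !(inj_eq (@node_pos_inj N)).
case: ifP => [_|np]; first by rewrite /= inordK //; lia.
have eqa' : (node_pos a == i) = (a == inl q) by rewrite {1}eq (inj_eq (@node_pos_inj N)).
rewrite eqa'; case: ifP => [_|nq]; first by rewrite /= inordK //; lia.
have h1 : ((pf D (node_pos a)).1 == i.-1) = (mate D a == inl p).
  by rewrite pfE /= ep (inj_eq (@node_pos_inj N)).
have h2 : ((pf D (node_pos a)).1 == i) = (mate D a == inl q).
  by rewrite pfE /= {1}eq (inj_eq (@node_pos_inj N)).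
have h3 : pf D i.-1 = (node_pos (mate D (inl p)), label D (inl p)) by rewrite -pfE.
have h4 : pf D i = (node_pos (mate D (inl q)), label D (inl q)) by rewrite -pfE.
rewrite h1 h2 h3 h4 pfE.
by case: ifP => _; [|case: ifP => _]; rewrite /= ?val_omin.
Qed.

Lemma diagram_idE N : diagram_id N = mk N (idf N).
Proof.
apply: pf_inj; apply: eqa_trans (eqa_sym (pf_mk (wf_good (idf_wf N)))).
apply: eqa_nodes => a; rewrite pfE /mate /label ffunE /= /idf abE inordK.
  by congr (_, _); case: a => j /=; have := ltn_ord j; lia.
by case: a => j /=; rewrite ltnS.
Qed.

Lemma word_diagram N w : letters N w ->
  \big[@diagram_mul N/diagram_id N]_(i <- w) diagram_gen N i = mk N (La w (idf N)).
Proof.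
elim: w => [|i w IH] /=; first by rewrite big_nil diagram_idE.
case/andP=> iN lw; rewrite big_cons IH //.
have g := La_good lw (wf_good (idf_wf N)).
have e := pf_mk g.
have gp : good N (pf (mk N (La w (idf N)))) by apply: wf_good; apply: wf_eqa (eqa_sym e) (La_wf lw).
by rewrite diagram_mul_gen //; apply: eq_mk; apply: lact_eqa.
Qed.

Lemma diagram_genE N i : 0 < i < N -> diagram_gen N i = mk N (lact i (idf N)).
Proof.
move=> /andP[i0 iN]; apply: pf_inj.
have gi : good N (lact i (idf N)) by apply: lact_good (wf_good (idf_wf N)); rewrite i0.
apply: eqa_trans (eqa_sym (pf_mk gi)).
have vi : (inord i : 'I_N.+1) = i :> nat by apply: inordK; lia.
apply: eqa_nodes => a; rewrite pfE /mate /label ffunE.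
have [e1|n1] := eqVneq (node_abs a) i.
  rewrite /= vi.
  case: a e1 => j /= e1; have jN := ltn_ord j.
    rewrite insubdK // /lact /surg ifT //; apply/eqP; lia.
  rewrite insubdK // /lact surg_mp /idf /=; try lia.
  by have := ab_spec N i.-1; have := ab_spec N i => *; congr (_, _); lia.
have [e1|n2] := eqVneq (node_abs a) i.+1.
  rewrite /= vi.
  case: a e1 n1 => j /= e1 n1; have jN := ltn_ord j.
    rewrite insubdK -?topredE /=; last by lia.
    have ej : (j : nat) = i by lia.
    by rewrite /lact ej surg_q //; lia.
  rewrite insubdK -?topredE /=; last by lia.
  rewrite /lact surg_mq /idf /=; try lia.
  by have := ab_spec N i.-1; have := ab_spec N i => *; congr (_, _); lia.
have e0 : diagram_id N a = (node_bar a, inord (node_abs a)) by rewrite ffunE.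
rewrite e0 /= /lact surg_o.
- rewrite /idf abE inordK; last by case: a {n1 n2 e0} => j /=; rewrite ltnS.
  by congr (_, _); case: a {n1 n2 e0} => j /=; have := ltn_ord j; lia.
all: by case: a n1 n2 {e0} => j /=; have := ltn_ord j; rewrite /idf /=; lia.
Qed.

Lemma card_ge n (j : nat) : #|[set x : 'I_n | j <= x]| = n - j.
Proof.
rewrite -sum1_card (eq_bigl (fun x : 'I_n => true && (j <= x))); last by move=> x; rewrite inE.
by rewrite -(big_geq_mkord _ _ (fun=> true) (fun=> 1)) sum_nat_const_nat muln1.
Qed.

Lemma lift_lt n (j : 'I_n.+1) (a b : 'I_n) : (lift j a < lift j b) = (a < b).
Proof. by rewrite /= /bump; case: leqP; case: leqP; lia. Qed.

(** The inverse permutation is extended by sending the new point to n - k, which k of the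
    earlier values then exceed. *)
Lemma code_step n (s : 'S_n) k : k <= n -> exists s' : 'S_n.+1,
  (forall i : 'I_n, perm_code s' (lift ord_max i) = perm_code s i) /\
  perm_code s' ord_max = k.
Proof.
move=> kn; have jn : n - k < n.+1 by lia.
pose j := Ordinal jn.
exists ((lift_perm ord_max j s^-1)^-1)%g; rewrite /perm_code invgK.
split=> [i|].
  rewrite -(card_imset _ (@lift_inj _ (@ord_max n))); congr #|pred_of_set _|.
  apply/setP => k'; apply/idP/imsetP => [|[k'' + ->]]; rewrite !inE.
    rewrite lift_max => /andP[ki h].
    have k'n : k' < n by apply: ltn_trans ki _.
    have ek : k' = lift ord_max (Ordinal k'n) by apply: ord_inj; rewrite lift_max.
    exists (Ordinal k'n) => //; rewrite inE /= ki /=.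
    by rewrite ek !lift_perm_lift lift_lt in h.
  by rewrite !lift_max !lift_perm_lift lift_lt.
rewrite -[RHS](subKn kn) -[n - k]/(val j) -card_ge.
have inj : injective (fun x : 'I_n => lift ord_max (s x)) by move=> x y /lift_inj/perm_inj.
rewrite -[RHS](card_imset _ inj); congr #|pred_of_set _|.
have lj (x : 'I_n) : (j < lift j x) = (j <= x).
  by rewrite -[nat_of_ord (lift j x)]/(bump j x) /bump; case: leqP => h; lia.
apply/setP => k'; apply/idP/imsetP => [|[k'' + ->]]; rewrite !inE lift_perm_id.
  move=> /andP[ki h].
  have ek : k' = lift ord_max (Ordinal ki) by apply: ord_inj; rewrite lift_max.
  exists (s^-1 (Ordinal ki))%g; last by rewrite permKV.
  by rewrite ek lift_perm_lift lj in h; rewrite inE.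
by rewrite lift_perm_lift permK lj lift_max => ->; rewrite ltn_ord.
Qed.

Lemma code_onto n (c : nat -> nat) : (forall i, c i <= i) ->
  exists s : 'S_n, forall i : 'I_n, perm_code s i = c i.
Proof.
move=> h; elim: n => [|n [s IH]]; first by exists 1%g; case.
have [s' [h1 h2]] := code_step s (h n).
exists s' => i; case: (unliftP ord_max i) => [i'|] ->.
  by rewrite h1 IH lift_max.
by rewrite h2.
Qed.

Definition code_of n (s : 'S_n) (i : nat) : nat :=
  if insub i is Some j then perm_code s j else 0.

Lemma code_of_le n (s : 'S_n) i : code_of s i <= i.
Proof.
rewrite /code_of; case: insubP => // j _ <-; rewrite /perm_code.
have e : val j = #|~: [set x : 'I_n | j <= x]|.
  by have := cardsC [set x : 'I_n | j <= x]; rewrite card_ge card_ord; have := ltn_ord j => /=; lia.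
rewrite [leqRHS]e; apply: subset_leq_card; apply/fintype.subsetP => k; rewrite !inE => /andP[kj _].
by rewrite -ltnNge.
Qed.

Lemma perm_wordE n (s : 'S_n) : perm_word s = cword n (code_of s).
Proof.
rewrite /perm_word /cword -val_enum_ord -map_comp; congr flatten.
by apply: eq_map => i /=; rewrite /code_of valK.
Qed.

Lemma diagram_permE n (s : 'S_n) : diagram_perm s = mk n (chain n (code_of s)).
Proof.
rewrite /diagram_perm perm_wordE word_diagram; last exact: letters_cword (code_of_le s).
apply: eq_mk; exact: La_cword (code_of_le s).
Qed.

End Perms.

Section Diag.
Local Open Scope ring_scope.
Variables (K : fieldType) (X Y : nat -> K).
Implicit Types (f g : nat -> nat * nat).

(** By [chain_inj] all permutations with the given diagram have the same code, so the one
    that is picked does not matter. *)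
Lemma okada_diag_chain n c : (forall i, c i <= i)%N ->
  okada_diag X Y (mk n (chain n c)) = Ew X Y n (cword n c).
Proof.
move=> h; rewrite /okada_diag; case: pickP => [s /eqP|none].
  rewrite diagram_permE => e; rewrite /okada_perm perm_wordE /Ew.
  have [w w'] := (chain_wf n (code_of_le s), chain_wf n h).
  have {}e : eqa n (chain n (code_of s)) (chain n c).
    apply: eqa_trans (eqa_sym (pf_mk (wf_good w))) _; rewrite e; exact: pf_mk (wf_good w').
  by rewrite (eq_cword (chain_inj (code_of_le s) h e)).
have [s hs] := code_onto n h; have := none s; rewrite diagram_permE.
rewrite (_ : chain n _ = chain n c) ?eqxx //.
by apply: eq_chain => i iN; rewrite /code_of insubT /= hs.
Qed.

Definition Ed n f : okada X Y n := okada_diag X Y (mk n f).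

Lemma Ed_eqa n f g : eqa n f g -> Ed n f = Ed n g.
Proof. by move=> e; rewrite /Ed (eq_mk e). Qed.

Lemma Ed_neq0 n f : wf n f -> Ed n f != 0.
Proof.
move=> w; have [c [h e]] := chain_onto w.
by rewrite (Ed_eqa e) /Ed okada_diag_chain // Ew_cword_neq0.
Qed.

Lemma Ed_ins n k f : wf n f -> (k <= n)%N ->
  Ed n.+1 (ins n k f) = okada_incl X Y n (Ed n f) * Ew X Y n.+1 (desc n k).
Proof.
move=> w kn; have [c [h e]] := chain_onto w.
rewrite (Ed_eqa e) (Ed_eqa (ins_eqa kn e)).
pose c' i := if i == n then k else c i.
have h' i : (c' i <= i)%N by rewrite /c'; case: eqP => [->|].
have cc : forall i, (i < n)%N -> c' i = c i by move=> i; rewrite /c'; case: eqP => // ->; rewrite ltnn.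
have e1 : ins n k (chain n c) = chain n.+1 c' by rewrite /= {1}/c' eqxx (eq_chain cc).
rewrite e1 /Ed !okada_diag_chain // Ew_cwordS // (eq_cword cc).
by rewrite /c' eqxx.
Qed.

(** Words and their diagrams have the same normal form. *)
Lemma Ew_Ed n w : letters n w -> exists l : K,
  (nz X Y -> l != 0) /\ Ew X Y n w = l *: Ed n (La w (idf n)).
Proof.
move=> lw; have [l [c [h e]]] := word_nf X Y lw; exists l; split.
  by move=> hn; exact: weq_nz e lw.
rewrite (weq_Ew n e) (@Ed_eqa _ _ (chain n c)) /Ed ?okada_diag_chain //.
apply: eqa_trans (weq_La e lw (wf_good (idf_wf n))) _; exact: La_cword.
Qed.

Lemma Ed_gen n i : (0 < i < n)%N -> okada_diag X Y (diagram_gen n i) = okada_gen X Y n i.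
Proof.
move=> iN; rewrite diagram_genE //.
pose c j := (j == i : nat).
have h j : (c j <= j)%N by rewrite /c; case: eqP => // ->; lia.
have e : cword n c = [:: i].
  have aux m : cword m c = if (i < m)%N then [:: i] else [::].
    elim: m => // m IH; rewrite cwordS IH /c /desc.
    have [->|mi] := eqVneq m i; first by rewrite ltnn ltnSn /= subn0.
    by rewrite cats0 (_ : (i < m.+1) = (i < m))%N //; lia.
  by rewrite aux ifT //; lia.
have := La_cword h (N := n); rewrite e /= => /eq_mk ->.
by rewrite okada_diag_chain // e Ew1.
Qed.

(** Insertion multiplies E_D on the right by a block ([Ed_ins]), and multiplication by a block
    is injective on the smaller algebra ([incl_desc_inj]). *)
Lemma lambda_ins n i k f : (0 < i < n)%N -> (k <= n)%N -> wf n f ->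
  okada_lambda X Y (diagram_gen n.+1 i) (mk n.+1 (ins n k f)) =
  okada_lambda X Y (diagram_gen n i) (mk n f).
Proof.
move=> iN kn w; have iN' : (0 < i < n.+1)%N by lia.
have gm m g : (0 < i < m)%N -> wf m g -> diagram_mul (diagram_gen m i) (mk m g) = mk m (lact i g).
  move=> im wg; have e := pf_mk (wf_good wg).
  rewrite diagram_mul_gen //; last exact: wf_good (wf_eqa (eqa_sym e) wg).
  by apply: eq_mk; apply: lact_eqa.
rewrite /okada_lambda !gm //; last exact: ins_wf.
rewrite !Ed_gen // -!/(Ed _ _) Ed_ins // -incl_gen // mulrA -rmorphM /=.
have e : eqa n.+1 (lact i (ins n k f)) (ins n k (lact i f)) by move=> x _; exact: lact_ins.
rewrite (Ed_eqa e) Ed_ins //; last exact: lact_wf.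
congr (xget 0 _); apply/seteqP; split=> l /=.
  rewrite scalerAl -incl_scale; exact: incl_desc_inj.
by move=> ->; rewrite incl_scale scalerAl.
Qed.

Lemma lambda_spec n i f : (0 < i < n)%N -> wf n f ->
  okada_gen X Y n i * Ed n f = okada_lambda X Y (diagram_gen n i) (mk n f) *: Ed n (lact i f)
  /\ (nz X Y -> okada_lambda X Y (diagram_gen n i) (mk n f) != 0).
Proof.
move=> iN w.
have gm : diagram_mul (diagram_gen n i) (mk n f) = mk n (lact i f).
  have e := pf_mk (wf_good w).
  rewrite diagram_mul_gen //; last exact: wf_good (wf_eqa (eqa_sym e) w).
  by apply: eq_mk; apply: lact_eqa.
have [u [lu eu]] := wf_word w.
have [l1 [n1 e1]] := Ew_Ed lu.
have [c [h ec]] := chain_onto w.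
have lc := letters_cword n h.
have [l2 [n2 e2]] := @Ew_Ed n (i :: cword n c) ltac:(by rewrite /= iN).
have ef : Ed n f = Ew X Y n (cword n c) by rewrite (Ed_eqa ec) /Ed okada_diag_chain.
have el : Ed n (La (i :: cword n c) (idf n)) = Ed n (lact i f).
  apply: Ed_eqa; apply: lact_eqa => //; exact: eqa_trans (La_cword h) (eqa_sym ec).
have eqn : okada_gen X Y n i * Ed n f = l2 *: Ed n (lact i f) by rewrite ef -Ew_cons e2 el.
rewrite /okada_lambda gm Ed_gen // -!/(Ed _ _) eqn.
case: xgetP => [l -> /= e|none]; last by case: (none l2).
split=> // /n2 nl2; apply: contra_neq nl2 => l0; move/eqP: e; rewrite l0 scale0r scaler_eq0.
by rewrite (negPf (Ed_neq0 (lact_wf iN w))) orbF => /eqP.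
Qed.

End Diag.

(** * Half diagrams *)

Section Halves.
Local Open Scope nat_scope.
Implicit Types (f g : nat -> nat * nat) (h r : nat -> option nat * nat).

Definition hf (n : nat) f (p : nat) : option nat * nat :=
  (if (f p).1 < n then Some (f p).1 else None, (f p).2).
(** Reflection of a diagram, exchanging each node with its barred copy. *)
Definition flip (n : nat) f (p : nat) : nat * nat :=
  (n + n - (f (n + n - p.+1)).1.+1, (f (n + n - p.+1)).2).
Definition eqh (n : nat) h r := forall p, p < n -> h p = r p.

(** The conditions that characterise left halves, see [is_halfP]. The arc of a propagating
    node at [q] encloses every node after [q], whence [oh_inc]; and no propagating node lies
    under a full arc, whence [oh_cov]. *)
Record ohalf n h : Prop := Ohalf {
  oh_lt : forall p q, p < n -> (h p).1 = Some q -> q < n;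
  oh_neq : forall p q, p < n -> (h p).1 = Some q -> q != p;
  oh_inv : forall p q, p < n -> (h p).1 = Some q -> h q = (Some p, (h p).2);
  oh_nc : forall p q p' q', p < q -> q < n -> (h p).1 = Some p' -> (h q).1 = Some q' ->
    q < p' -> p' < q' -> False;
  oh_cov : forall p q p', p < q -> q < p' -> p' < n -> (h p).1 = Some p' -> (h q).1 = None -> False;
  oh_pos : forall p, p < n -> 0 < (h p).2;
  oh_le : forall p, p < n -> (h p).2 <= p.+1;
  oh_oddN : forall p, p < n -> (h p).1 = None -> odd (h p).2 = odd p.+1;
  oh_oddS : forall p q, p < n -> (h p).1 = Some q -> odd (h p).2 = odd (minn p.+1 q.+1);
  oh_nest : forall p q p' q', q < p -> p < p' -> p' < q' -> p' < n ->
    (h p).1 = Some p' -> (h q).1 = Some q' -> (h q).2 < (h p).2;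
  oh_inc : forall p q, q < p -> p < n -> (h q).1 = None -> (h q).2 < (h p).2 }.

Lemma hf_some n f p q : (hf n f p).1 = Some q -> (f p).1 = q /\ q < n.
Proof. by rewrite /=; case: ifP => // h [<-]. Qed.
Lemma hf_none n f p : (hf n f p).1 = None -> n <= (f p).1.
Proof. by rewrite /=; case: ltnP. Qed.

Lemma hf_ohalf n f : wf n f -> ohalf n (hf n f).
Proof.
move=> w; have dn p : p < n -> p < n + n by lia.
have ablt p : p < n -> ab n p = p.+1 by move=> pn; rewrite /ab pn.
have le' p : p < n + n -> (f p).2 <= ab n (f p).1.
  by move=> pN; rewrite -(wf_l w pN); apply: (wf_le w); exact: wf_lt.
split.
- by move=> p q pn /hf_some[].
- by move=> p q pn /hf_some[<- _]; apply/eqP; exact: wf_neq w _ (dn _ pn).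
- move=> p q pn /hf_some[e qn]; rewrite /hf -e (wf_inv w) /= ?pn //; exact: dn.
- move=> p q p' q' pq qn /hf_some[<- _] /hf_some[<- _]; exact: (wf_nc w (dn _ qn)).
- move=> p q p' pq qp' p'n /hf_some[e _] /hf_none h.
  apply: (wf_nc w (dn q _) pq); rewrite ?e; lia.
- by move=> p pn; exact: (wf_pos w (dn _ pn)).
- by move=> p pn; rewrite -(ablt _ pn); exact: (wf_le w (dn _ pn)).
- move=> p pn /hf_none h; rewrite (wf_odd w (dn _ pn)) ablt //.
  have := wf_parity w (dn _ pn); have := ab_spec n (f p).1; have := wf_lt w (dn _ pn).
  case: (leqP p.+1 (ab n (f p).1)) => // ?; lia.
- move=> p q pn /hf_some[e qn]; rewrite (wf_odd w (dn _ pn)) e !ablt //.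
- move=> p q p' q' qp pp' p'q' p'n /hf_some[ep _] /hf_some[eq _] /=.
  by apply: (wf_nest w (dn p _) qp); rewrite ?ep ?eq //; lia.
move=> p q qp pn /hf_none hq /=.
have qn : q < n by lia.
have pN := dn _ pn; have qN := dn _ qn.
have mq := wf_m w qN; have mp := wf_m w pN; have np := wf_neq w pN.
have ltp := wf_lt w pN; have ltq := wf_lt w qN.
have d1 : (f p).1 <> (f q).1 by move=> e; rewrite e mq in mp; lia.
have d2 : (f p).1 <> q by move=> e; rewrite e in mp; lia.
have nc1 := @wf_nc _ _ w q p pN qp.
have [h|h] : p < (f p).1 \/ (f p).1 < p by lia.
  apply: (wf_nest w pN qp h); lia.
have nc2 := @wf_nc _ _ w (f p).1 q qN; rewrite mp in nc2.
have := @wf_nest _ _ w (f p).1 q ltp; rewrite mp (wf_l w pN); lia.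
Qed.

Lemma flip_wf n f : wf n f -> wf n (flip n f).
Proof.
move=> w; pose b p := n + n - p.+1.
have bb p : p < n + n -> b (b p) = p by rewrite /b; lia.
have bN p : p < n + n -> b p < n + n by rewrite /b; lia.
have fb p : flip n f p = (b (f (b p)).1, (f (b p)).2) by [].
have abb p : p < n + n -> ab n (b p) = ab n p.
  by have := ab_spec n (b p); have := ab_spec n p; rewrite /b; lia.
have lt p : p < n + n -> (f (b p)).1 < n + n by move=> pN; apply: (wf_lt w); exact: bN.
have ltb p q : p < n + n -> q < n + n -> p < q -> b q < b p by rewrite /b; lia.
have bK p q : p < n + n -> q < n + n -> b p < b q -> q < p by rewrite /b; lia.
split.
- by move=> p pN; rewrite fb /=; apply: bN; exact: lt.
- move=> p pN; rewrite fb /= => e; apply: (wf_neq w (bN _ pN)); rewrite -{2}e bb //; exact: lt.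
- by move=> p pN; rewrite !fb /= (bb _ (lt _ pN)) (wf_inv w) ?bb //=; exact: bN.
- move=> p q qN pq; have pN : p < n + n by lia.
  rewrite !fb /= => h1 h2.
  have [lp lq] := (lt _ pN, lt _ qN).
  have e1 := bK _ _ (bN _ lp) (bN _ qN).
  have h1' : (f (b p)).1 < b q by rewrite -(bb _ lp); apply: ltb => //; exact: bN.
  have h2' : (f (b q)).1 < (f (b p)).1 by exact: bK h2.
  have h3 := ltb _ _ pN qN pq.
  have [mp mq] := (wf_m w (bN _ pN), wf_m w (bN _ qN)).
  by apply: (@wf_nc _ _ w (f (b q)).1 (f (b p)).1 lp h2'); rewrite ?mp ?mq.
- by move=> p pN; exact: (wf_pos w (bN _ pN)).
- by move=> p pN; rewrite fb /= -abb //; exact: (wf_le w (bN _ pN)).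
- by move=> p pN; rewrite fb /= (wf_odd w (bN _ pN)) !abb //; exact: lt.
- move=> p q pN qp; have qN : q < n + n by lia.
  rewrite !fb /= => h1 h2.
  have [lp lq] := (lt _ pN, lt _ qN).
  have h1' : (f (b p)).1 < b p by rewrite -(bb _ lp); apply: ltb => //; exact: bN.
  have h2' : (f (b q)).1 < (f (b p)).1 by exact: bK h2.
  have h3 := ltb _ _ qN pN qp.
  have [mp mq] := (wf_m w (bN _ pN), wf_m w (bN _ qN)).
  rewrite -(wf_l w (bN _ pN)) -(wf_l w (bN _ qN)).
  by apply: (@wf_nest _ _ w (f (b p)).1 (f (b q)).1 lp h2'); rewrite ?mp ?mq.
Qed.

Definition rhf n f := hf n (flip n f).

Lemma rhf_ohalf n f : wf n f -> ohalf n (rhf n f).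
Proof. by move=> w; apply: hf_ohalf; exact: flip_wf. Qed.

Definition PL n h s := exists2 p, p < n & h p = (None, s).
Definition samep n h r := forall s, PL n h s <-> PL n r s.

Lemma oh_uniq n h p q : ohalf n h -> p < n -> q < n -> (h p).1 = None -> (h q).1 = None ->
  (h p).2 = (h q).2 -> p = q.
Proof.
move=> o pn qn hp hq e.
have [pq|[qp|//]] : p < q \/ q < p \/ p = q by lia.
  have := oh_inc o pq qn hp; lia.
have := oh_inc o qp pn hq; lia.
Qed.

Lemma samep_sym n h r : samep n h r -> samep n r h.
Proof. by move=> s x; split=> /s. Qed.
Lemma samep_trans n h r t : samep n h r -> samep n r t -> samep n h t.
Proof. by move=> s s' x; split=> [/s/s'|/s'/s]. Qed.
Lemma eqh_samep n h r : eqh n h r -> samep n h r.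
Proof. by move=> e x; split=> -[p pn hp]; exists p => //; rewrite ?e // -e. Qed.

Lemma half_samep n f : wf n f -> samep n (hf n f) (rhf n f).
Proof.
suff H g : wf n g -> forall s, PL n (hf n g) s -> PL n (hf n (flip n g)) s.
  move=> w s; split; first exact: H.
  move=> /(H _ (flip_wf w)) [p pn]; rewrite /hf /flip => -[h1 h2]; exists p => //.
  have pN : p < n + n by lia.
  have e : n + n - (n + n - p.+1).+1 = p by lia.
  rewrite /hf -h2 e; congr (_, _); move: h1; rewrite e.
  have lt := wf_lt w pN.
  case: ltnP => // h1 _; case: ltnP => // h3; exfalso; lia.
move=> w s [p pn]; rewrite /hf => -[]; case: ltnP => // h _ <-.
have pN : p < n + n by lia.
exists (n + n - (g p).1.+1); first by have := wf_lt w pN; lia.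
have e : n + n - (n + n - (g p).1.+1).+1 = (g p).1 by have := wf_lt w pN; lia.
rewrite /hf /flip e (wf_inv w pN) /=; congr (_, _).
by case: ltnP => //; lia.
Qed.

(** Propagating arcs have distinct labels ([oh_uniq]), so there is one way to join the halves. *)
Lemma half_eqa n f g : wf n f -> wf n g -> eqh n (hf n f) (hf n g) -> eqh n (rhf n f) (rhf n g) ->
  eqa n f g.
Proof.
suff H f' g' : wf n f' -> wf n g' -> eqh n (hf n f') (hf n g') -> eqh n (rhf n f') (rhf n g') ->
    forall p, p < n -> f' p = g' p.
  move=> w w' e e' p pN; have [pn|pn] := ltnP p n; first exact: H.
  have ff k : wf n k -> forall p, p < n + n -> flip n (flip n k) p = k p.
    move=> wk x xN; rewrite /flip; have -> : n + n - (n + n - x.+1).+1 = x by lia.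
    rewrite [RHS]surjective_pairing; congr (_, _) => /=; have := wf_lt wk xN; lia.
  have eq2 : flip n f (n + n - p.+1) = flip n g (n + n - p.+1).
    apply: H; try exact: flip_wf; try done; last by lia.
    move=> x xn; rewrite /rhf /hf !ff //; try lia; exact: e.
  have ep : n + n - (n + n - p.+1).+1 = p by lia.
  move: eq2; rewrite /flip ep => -[e1 e2].
  rewrite (surjective_pairing (f p)) (surjective_pairing (g p)) e2; congr (_, _).
  have := wf_lt w pN; have := wf_lt w' pN; lia.
move=> w w' e e' p pn; have := e p pn; rewrite /hf => -[].
have pN : p < n + n by lia.
rewrite (surjective_pairing (f' p)) (surjective_pairing (g' p)) /=.
case: ltnP => h1; case: ltnP => h2 // + e2; first by case=> ->; rewrite e2.
move=> _; rewrite e2; congr (_, _).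
have [lf lg] := (wf_lt w pN, wf_lt w' pN).
have [of_ og] := (rhf_ohalf w, rhf_ohalf w').
pose a := n + n - (f' p).1.+1; pose b := n + n - (g' p).1.+1.
have [an bn] : a < n /\ b < n by rewrite /a /b; lia.
have ra : rhf n f' a = (None, (f' p).2).
  rewrite /rhf /hf /flip /a; have -> : n + n - (n + n - (f' p).1.+1).+1 = (f' p).1 by lia.
  by rewrite (wf_inv w pN) /=; congr (_, _); case: ltnP => //; lia.
have rb : rhf n g' b = (None, (g' p).2).
  rewrite /rhf /hf /flip /b; have -> : n + n - (n + n - (g' p).1.+1).+1 = (g' p).1 by lia.
  by rewrite (wf_inv w' pN) /=; congr (_, _); case: ltnP => //; lia.
suff : a = b by rewrite /a /b; lia.
by apply: (oh_uniq of_ an bn); rewrite ?ra // e' // rb.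
Qed.

Definition isprop h s p := ~~ isSome (h p).1 && ((h p).2 == s).
Definition findl n h s := find (isprop h s) (iota 0 n).

Lemma isnone (T : Type) (x : option T) : ~~ isSome x -> x = None.
Proof. by case: x. Qed.

Lemma findlP n h s : ohalf n h -> PL n h s -> h (findl n h s) = (None, s) /\ findl n h s < n.
Proof.
move=> o [p pn hp].
have hs : has (isprop h s) (iota 0 n).
  by apply/hasP; exists p; rewrite ?mem_iota // /isprop hp /= eqxx.
have := hs; rewrite has_find size_iota => lt; split=> //.
have := nth_find 0 hs; rewrite nth_iota // add0n => /andP[/isnone h1 /eqP h2].
by rewrite [LHS]surjective_pairing h1 h2.
Qed.

Lemma findl_eq n h p s : ohalf n h -> p < n -> h p = (None, s) -> findl n h s = p.
Proof.
move=> o pn hp; have [e lt] : h (findl n h s) = (None, s) /\ findl n h s < n.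
  by apply: findlP => //; exists p.
by apply: (oh_uniq o lt pn); rewrite ?e ?hp.
Qed.

Definition com0 (n : nat) h r (p : nat) : nat * nat :=
  (if (h p).1 is Some q then q else n + n - (findl n r (h p).2).+1, (h p).2).
(** The diagram with left half [h] and right half [r]: propagating half arcs with equal labels
    are joined. *)
Definition com (n : nat) h r (p : nat) : nat * nat :=
  if p < n then com0 n h r p
  else let y := com0 n r h (n + n - p.+1) in (n + n - y.1.+1, y.2).

Section Com.
Variables (n : nat) (h r : nat -> option nat * nat).
Hypotheses (oh : ohalf n h) (or : ohalf n r) (hr : samep n h r).
Let b p := n + n - p.+1.
Let c := com n h r.

Lemma com_LS p q : p < n -> (h p).1 = Some q -> c p = (q, (h p).2).
Proof. by move=> pn e; rewrite /c /com pn /com0 e. Qed.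
Lemma com_LN p : p < n -> (h p).1 = None ->
  exists2 q, q < n & r q = (None, (h p).2) /\ c p = (b q, (h p).2).
Proof.
move=> pn e; have [q qn rq] : PL n r (h p).2.
  by apply/hr; exists p; rewrite // [LHS]surjective_pairing e.
by exists q => //; split=> //; rewrite /c /com pn /com0 e (findl_eq or qn rq).
Qed.
Lemma com_RS p q : p < n -> (r p).1 = Some q -> c (b p) = (b q, (r p).2).
Proof.
move=> pn e; rewrite /c /com ifF; last by apply/negP; rewrite /b; lia.
by have -> : n + n - (b p).+1 = p; [rewrite /b; lia|rewrite /com0 e].
Qed.
Lemma com_RN p : p < n -> (r p).1 = None ->
  exists2 q, q < n & h q = (None, (r p).2) /\ c (b p) = (q, (r p).2).
Proof.
move=> pn e; have [q qn hq] : PL n h (r p).2.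
  by apply/hr; exists p; rewrite // [LHS]surjective_pairing e.
exists q => //; split=> //; rewrite /c /com ifF; last by apply/negP; rewrite /b; lia.
have -> : n + n - (b p).+1 = p by rewrite /b; lia.
by rewrite /com0 e (findl_eq oh qn hq) /=; congr (_, _); lia.
Qed.

Inductive posc p : Prop :=
| PcLS q of p < n & q < n & q != p & (h p).1 = Some q & c p = (q, (h p).2)
| PcLN q of p < n & q < n & (h p).1 = None & r q = (None, (h p).2) & c p = (b q, (h p).2)
| PcRS a q of a < n & q < n & q != a & p = b a & (r a).1 = Some q & c p = (b q, (r a).2)
| PcRN a q of a < n & q < n & p = b a & (r a).1 = None & h q = (None, (r a).2) & c p = (q, (r a).2).

Lemma posP2 p : p < n + n -> posc p.
Proof.
move=> pN; have [pn|pn] := ltnP p n.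
  case e: (h p).1 => [q|].
    by apply: (PcLS pn (oh_lt oh pn e) (oh_neq oh pn e) e); exact: com_LS.
  by have [q qn [rq cq]] := com_LN pn e; exact: (PcLN pn qn e rq cq).
have [a an ->] : exists2 a, a < n & p = b a by exists (b p); rewrite /b; lia.
case e: (r a).1 => [q|].
  by apply: (PcRS an (oh_lt or an e) (oh_neq or an e) erefl e); exact: com_RS.
by have [q qn [hq cq]] := com_RN an e; exact: (PcRN an qn erefl e hq cq).
Qed.

Lemma com_wf : wf n c.
Proof.
have abL p : p < n -> ab n p = p.+1 by move=> pn; rewrite /ab pn.
have abR p : p < n -> ab n (b p) = p.+1 by move=> pn; have := ab_spec n (b p); rewrite /b; lia.
split.
- move=> p /posP2[q ? ? ne e ->|q ? ? ? ? ->|a q ? ? ne -> ? ->|a q ? ? -> ? ? ->] /=; rewrite /b; lia.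
- move=> p /posP2[q ? ? ne e ->|q ? ? ? ? ->|a q ? ? ne -> ? ->|a q ? ? -> ? ? ->] /=; rewrite /b; lia.
- move=> p /posP2[q pn qn ne e ->|q pn qn e rq ->|a q an qn ne -> e ->|a q an qn -> e hq ->] /=.
  + have e' := oh_inv oh pn e.
    by rewrite (com_LS qn (q := p)) e'.
  + have [q' q'n [hq' ->]] := com_RN qn (f_equal fst rq).
    rewrite rq /= in hq' *; congr (_, _).
    by apply: (oh_uniq oh q'n pn); rewrite ?hq' ?e.
  + have e' := oh_inv or an e.
    by rewrite (com_RS qn (q := a)) e'.
  + have [q' q'n [rq' ->]] := com_LN qn (f_equal fst hq).
    rewrite hq /= in rq' *; congr (b _, _).
    by apply: (oh_uniq or q'n an); rewrite ?rq' ?e.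
- move=> p q qN pq; have pN : p < n + n by lia.
  case: (posP2 pN) => [p' pn p'n nep ep ->|p2 pn p2n ep rp ->|p0 p' p0n p'n nep eP ep ->|p0 p' p0n p'n eP ep hp ->] /=.
  + case: (posP2 qN) => [q' qn q'n neq eq ->|q2 qn q2n eq rq ->|q0 q' q0n q'n neq eQ eq ->|q0 q' q0n q'n eQ eq hq ->] /=.
    * exact: (oh_nc oh pq qn ep eq).
    * by move=> h1 _; exact: (oh_cov oh pq h1 p'n ep eq).
    * by rewrite eQ /b; lia.
    * by rewrite eQ /b; lia.
  + case: (posP2 qN) => [q' qn q'n neq eq ->|q2 qn q2n eq rq ->|q0 q' q0n q'n neq eQ eq ->|q0 q' q0n q'n eQ eq hq ->] /=.
    * by rewrite /b; lia.
    * move=> h1 h2; have := oh_inc oh pq qn ep.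
      have : q2 < p2 by rewrite /b in h2; lia.
      by move=> h3; have := oh_inc or h3 p2n (f_equal fst rq); rewrite rp rq /=; lia.
    * rewrite eQ => h1 h2; have e' := oh_inv or q0n eq.
      apply: (@oh_cov _ _ or q' p2 q0) => //; rewrite ?e' ?rp //; rewrite /b in h1 h2; lia.
    * by rewrite /b; lia.
  + case: (posP2 qN) => [q' qn q'n neq eq ->|q2 qn q2n eq rq ->|q0 q' q0n q'n neq eQ eq ->|q0 q' q0n q'n eQ eq hq ->] /=.
    * by rewrite eP in pq; rewrite /b in pq; lia.
    * by rewrite eP in pq; rewrite /b in pq; lia.
    * rewrite eP eQ in pq *; move=> h1 h2.
      apply: (@oh_nc _ _ or q' p' q0 p0) => //; rewrite ?(oh_inv or q0n eq) ?(oh_inv or p0n ep) //; rewrite /b in pq h1 h2; lia.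
    * by rewrite /b; lia.
  + by rewrite eP in pq; rewrite /b in pq; lia.
- move=> p /posP2[q pn qn ne e ->|q pn qn e rq ->|a q an qn ne -> e ->|a q an qn -> e hq ->] /=.
  + exact: (oh_pos oh).
  + exact: (oh_pos oh).
  + exact: (oh_pos or).
  + exact: (oh_pos or).
- move=> p /posP2[q pn qn ne e ->|q pn qn e rq ->|a q an qn ne -> e ->|a q an qn -> e hq ->] /=.
  + by rewrite abL //; exact: (oh_le oh).
  + by rewrite abL //; exact: (oh_le oh).
  + by rewrite abR //; exact: (oh_le or).
  + by rewrite abR //; exact: (oh_le or).
- move=> p /posP2[q pn qn ne e ->|q pn qn e rq ->|a q an qn ne -> e ->|a q an qn -> e hq ->] /=.
  + by rewrite !abL //; exact: (oh_oddS oh pn e).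
  + rewrite (abL _ pn) (abR _ qn).
    have := oh_oddN oh pn e; have := oh_oddN or qn (f_equal fst rq); rewrite rq /=.
    by case: (leqP p.+1 q.+1) => // _ ->.
  + by rewrite !abR //; exact: (oh_oddS or an e).
  + rewrite (abR _ an) (abL _ qn).
    have := oh_oddN or an e; have := oh_oddN oh qn (f_equal fst hq); rewrite hq /=.
    by case: (leqP a.+1 q.+1) => // _ ->.
move=> p q pN qp; have qN : q < n + n by lia.
case: (posP2 pN) => [p' pn p'n nep ep ->|p2 pn p2n ep rp ->|p0 p' p0n p'n nep eP ep ->|p0 p' p0n p'n eP ep hp ->] /=.
- case: (posP2 qN) => [q' qn q'n neq eq ->|q2 qn q2n eq rq ->|q0 q' q0n q'n neq eQ eq ->|q0 q' q0n q'n eQ eq hq ->] /=.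
  + by move=> h1 h2; exact: (oh_nest oh qp h1 h2 p'n ep eq).
  + by move=> h1 h2; exact: (oh_inc oh qp pn eq).
  + by rewrite /b in eQ *; lia.
  + by rewrite /b in eQ *; lia.
- case: (posP2 qN) => [q' qn q'n neq eq ->|q2 qn q2n eq rq ->|q0 q' q0n q'n neq eQ eq ->|q0 q' q0n q'n eQ eq hq ->] /=.
  + by rewrite /b; lia.
  + by move=> h1 h2; exact: (oh_inc oh qp pn eq).
  + by rewrite /b in eQ *; lia.
  + by rewrite /b in eQ *; lia.
- rewrite eP => h1; have h1' : p' < p0 by rewrite /b in h1; lia.
  have ep' := oh_inv or p0n ep.
  case: (posP2 qN) => [q' qn q'n neq eq ->|q2 qn q2n eq rq ->|q0 q' q0n q'n neq eQ eq ->|q0 q' q0n q'n eQ eq hq ->] /=.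
  + by rewrite /b; lia.
  + move=> h2; have h3 : q2 < p0 by rewrite /b in h2; lia.
    by have := oh_inc or h3 p0n (f_equal fst rq); rewrite rq.
  + move=> h2; have eq' := oh_inv or q0n eq.
    have -> : (r p0).2 = (r p').2 by rewrite ep'.
    have -> : (r q0).2 = (r q').2 by rewrite eq'.
    apply: (@oh_nest _ _ or p' q' p0 q0) => //; rewrite ?ep' ?eq' //; rewrite /b in h2 eQ eP; lia.
  + by rewrite /b; lia.
- by rewrite /b in eP *; lia.
Qed.

Lemma com_hf : eqh n (hf n c) h.
Proof.
move=> p pn; rewrite /hf; case e: (h p).1 => [q|].
  by rewrite (com_LS pn e) /= (oh_lt oh pn e) -e -surjective_pairing.
have [q qn [_ ->]] := com_LN pn e; rewrite /= ifF -?e -?surjective_pairing //.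
by apply/negP; rewrite /b; lia.
Qed.

Lemma com_rhf : eqh n (rhf n c) r.
Proof.
move=> p pn; rewrite /rhf /flip /hf -/(b p); case e: (r p).1 => [q|].
  rewrite (com_RS pn e) /=; have qn := oh_lt or pn e.
  have -> : n + n - (b q).+1 = q by rewrite /b; lia.
  by rewrite qn -e -surjective_pairing.
have [q qn [_ ->]] := com_RN pn e; rewrite /= ifF -?e -?surjective_pairing //.
by apply/negP; lia.
Qed.

End Com.

End Halves.

(** * The weight of a half diagram *)

Section Weights.
Local Open Scope nat_scope.
Implicit Types (f g : nat -> nat * nat) (h r : nat -> option nat * nat) (w : seq nat).

Definition contrib h p := if isSome (h p).1 then 0 else (h p).2.
(** The sum of the propagating labels. By [dominance_weight] this number detects everything
    about the dominance order that matters for the filtration. *)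
Definition weight n h := \sum_(p <- iota 0 n) contrib h p.

Lemma weight_eqh n h r : eqh n h r -> weight n h = weight n r.
Proof.
move=> e; rewrite /weight [LHS]big_seq_cond [RHS]big_seq_cond.
by apply: eq_bigr => p; rewrite mem_iota add0n => /andP[/andP[_ pn] _]; rewrite /contrib e.
Qed.

Lemma weight_PL n h (S : seq nat) : ohalf n h -> uniq S -> (forall s, s \in S <-> PL n h s) ->
  weight n h = \sum_(s <- S) s.
Proof.
move=> o uS Ecan.
rewrite (perm_big [seq (h p).2 | p <- iota 0 n & ~~ isSome (h p).1]) /=; last first.
  apply: uniq_perm => //.
    rewrite map_inj_in_uniq ?filter_uniq ?iota_uniq // => p q.
    rewrite !mem_filter !mem_iota !add0n => /andP[/isnone hp pn] /andP[/isnone hq qn].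
    exact: (oh_uniq o).
  move=> s; apply/idP/mapP.
    move=> /Ecan[p pn hp]; exists p; last by rewrite hp.
    by rewrite mem_filter mem_iota hp.
  case=> p; rewrite mem_filter mem_iota add0n => /andP[/isnone hp pn] ->.
  by apply/Ecan; exists p => //; rewrite -hp -surjective_pairing.
rewrite big_map big_filter /weight [RHS]big_mkcond; apply: eq_bigr => p _.
by rewrite /contrib; case: (isSome _).
Qed.

Lemma sum_update n (F F' : nat -> nat) s : uniq s -> {in s, forall x, x < n} ->
  (forall x, x < n -> x \notin s -> F x = F' x) ->
  \sum_(x <- iota 0 n) F' x + \sum_(x <- s) F x = \sum_(x <- iota 0 n) F x + \sum_(x <- s) F' x.
Proof.
move=> us sn e.
have H (G : nat -> nat) : \sum_(x <- s) G x = \sum_(x <- iota 0 n | x \in s) G x.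
  rewrite -[RHS]big_filter; apply: perm_big; apply: uniq_perm => //.
    by rewrite filter_uniq // iota_uniq.
  move=> x; rewrite mem_filter mem_iota add0n /=.
  by case xs: (x \in s) => //=; rewrite sn.
have B (G : nat -> nat) : \sum_(x <- iota 0 n) G x =
    \sum_(x <- iota 0 n | x \in s) G x + \sum_(x <- iota 0 n | x \notin s) G x.
  exact: bigID.
have E : \sum_(x <- iota 0 n | x \notin s) F' x = \sum_(x <- iota 0 n | x \notin s) F x.
  rewrite big_seq_cond [RHS]big_seq_cond; apply: eq_bigr => x.
  by rewrite mem_iota add0n => /andP[/andP[_ xn] xs]; rewrite e.
rewrite !H (B F) (B F') E.
by rewrite addnAC [RHS]addnAC; congr (_ + _); exact: addnC.
Qed.

Lemma rhf_eq n f g : (forall x, n <= x -> x < n + n -> (f x).2 = (g x).2 /\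
   ((f x).1 = (g x).1 \/ (f x).1 < n /\ (g x).1 < n)) -> eqh n (rhf n f) (rhf n g).
Proof.
move=> e x xn; rewrite /rhf /flip /hf /=.
have [-> h] := e (n + n - x.+1) ltac:(lia) ltac:(lia); congr (_, _).
case: h => [->//|[h1 h2]]; rewrite !ifF //; apply/negP; lia.
Qed.

Inductive lcase n i f : Prop :=
| LcArc of (f i.-1).1 = i
| LcLL of (f i.-1).1 != i & (f i.-1).1 < n & (f i).1 < n
| LcLR of (f i.-1).1 < n & n <= (f i).1
| LcRL of n <= (f i.-1).1 & (f i).1 < n
| LcRR of n <= (f i.-1).1 & n <= (f i).1.

Lemma lcaseP n i f : lcase n i f.
Proof.
have [e|e] := eqVneq (f i.-1).1 i; first by constructor 1.
case: (ltnP (f i.-1).1 n) => h1; case: (ltnP (f i).1 n) => h2.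
- by constructor 2.
- by constructor 3.
- by constructor 4.
- by constructor 5.
Qed.

Section Lact.
Variables (n i : nat) (f : nat -> nat * nat).
Hypotheses (iN : 0 < i < n) (w : wf n f).
Let p := i.-1.

Let pN : p < n + n. Proof. by rewrite /p; lia. Qed.
Let qN : i < n + n. Proof. by lia. Qed.
Let pq : p != i. Proof. by rewrite /p; lia. Qed.

Lemma lact_p : lact i f p = (i, i). Proof. exact: surg_p. Qed.
Lemma lact_q : lact i f i = (p, i). Proof. exact: surg_q. Qed.
Lemma lact_o x : x < n + n -> x != p -> x != i -> x != (f p).1 -> x != (f i).1 -> lact i f x = f x.
Proof.
move=> xN xp xq xa xb; rewrite /lact surg_o //.
  by apply: contra_neq xa => e; rewrite -(wf_m w xN) e.
by apply: contra_neq xb => e; rewrite -(wf_m w xN) e.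
Qed.
Lemma lact_a : (f p).1 != i -> lact i f (f p).1 = ((f i).1, minn (f p).2 (f i).2).
Proof.
move=> ap; apply: surg_mp => //; last by rewrite (wf_m w pN).
by apply/eqP; exact: (wf_neq w pN).
Qed.
Lemma lact_b : (f p).1 != i -> lact i f (f i).1 = ((f p).1, minn (f p).2 (f i).2).
Proof.
move=> ap; apply: surg_mq => //; last by rewrite (wf_m w qN).
  by apply: contra_neq ap => e; have := wf_m w qN; rewrite e.
by apply/eqP; exact: (wf_neq w qN).
Qed.
Lemma lact_arc x : (f p).1 = i -> x < n + n -> x != p -> x != i -> lact i f x = f x.
Proof.
move=> ap xN xp xq; apply: lact_o => //; rewrite ?ap //.
by rewrite -ap (wf_m w pN).
Qed.

(** If both i and i + 1 lead back to the left side, the propagating arcs are unchanged. If one of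
    them propagates, its strand is continued along the arc of the other one, so that its label
    can only drop. If both propagate, two labels are lost. Without loss of weight, the right
    side does not notice the surgery. *)
Lemma lact_weight_aux : weight n (hf n (lact i f)) <= weight n (hf n f) /\
  (weight n (hf n (lact i f)) = weight n (hf n f) -> 
    eqh n (rhf n (lact i f)) (rhf n f) /\
    [\/ (f p).1 < n /\ (f i).1 < n,
        [/\ (f p).1 < n, n <= (f i).1 & (f i).2 <= (f p).2] |
        [/\ n <= (f p).1, (f i).1 < n & (f p).2 <= (f i).2]]).
Proof.
have w' := lact_wf iN w.
have [mp mi] := (wf_m w pN, wf_m w qN).
have [pn qn] : p < n /\ i < n by rewrite /p; lia.
have far x : n <= x -> x != p /\ x != i by lia.
have cq : contrib (hf n (lact i f)) i = 0 by rewrite /contrib /hf lact_q /= pn.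
have cp : contrib (hf n (lact i f)) p = 0 by rewrite /contrib /hf lact_p /= qn.
have cS g x : (g x).1 < n -> contrib (hf n g) x = 0 by rewrite /contrib /hf /= => ->.
have cN g x : n <= (g x).1 -> contrib (hf n g) x = (g x).2.
  by rewrite /contrib /hf /= => h; rewrite ltnNge h.
case: (lcaseP n i f); rewrite -/p.
- move=> ap; have aq : (f i).1 = p by rewrite -ap mp.
  have e : weight n (hf n (lact i f)) = weight n (hf n f).
    apply: eq_big_seq => x; rewrite mem_iota add0n => xn.
    have [->|xp] := eqVneq x p; first by rewrite cp cS ?ap.
    have [->|xq] := eqVneq x i; first by rewrite cq cS ?aq.
    by rewrite /contrib /hf lact_arc //; lia.
  split; first by rewrite e.
  move=> _; split; last by constructor 1; rewrite ap aq.
  move=> x xn; rewrite /rhf /flip /hf lact_arc //; lia.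
- move=> na an bn.
  have e : weight n (hf n (lact i f)) = weight n (hf n f).
    apply: eq_big_seq => x; rewrite mem_iota add0n => xn.
    have [->|xp] := eqVneq x p; first by rewrite cp cS.
    have [->|xq] := eqVneq x i; first by rewrite cq cS.
    have [->|xa] := eqVneq x (f p).1; first by rewrite !cS ?lact_a // mp.
    have [->|xb] := eqVneq x (f i).1; first by rewrite !cS ?lact_b // mi.
    by rewrite /contrib /hf lact_o //; lia.
  split; first by rewrite e.
  move=> _; split; last by constructor 1.
  by move=> x xn; rewrite /rhf /flip /hf lact_o //; lia.
- move=> an bn; have na : (f p).1 != i.
    by apply/eqP => e; rewrite e in mp; lia.
  have ap : (f p).1 != p by apply/eqP; exact: (wf_neq w pN).
  have U : weight n (hf n (lact i f)) + (f i).2 = weight n (hf n f) + minn (f p).2 (f i).2.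
    have := @sum_update n (contrib (hf n f)) (contrib (hf n (lact i f))) [:: p; i; (f p).1].
    rewrite !big_cons !big_nil cp cq (cN _ i) // (cS f p) // (cS f (f p).1) ?mp //.
    rewrite (cN _ (f p).1) ?lact_a //= => h.
    have {}h := h ltac:(by rewrite /= !inE !negb_or pq eq_sym ap eq_sym na).
    have {}h := h ltac:(by move=> x; rewrite !inE => /or3P[] /eqP->).
    rewrite /weight; move: h; rewrite !addn0 !add0n; apply.
    move=> x xn; rewrite !inE !negb_or => /and3P[xp xq xa].
    rewrite /contrib /hf lact_o //; first by lia.
    by apply: contraL bn => /eqP <-; rewrite -ltnNge.
  split; first by lia.
  move=> e; have hm : (f i).2 <= (f p).2 by lia.
  split; last by constructor 2.
  apply: rhf_eq => x xn xN; have [xp xq] := far _ xn.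
  have [->|xb] := eqVneq x (f i).1.
    rewrite lact_b // mi (wf_l w qN) /=; split; [lia | by right].
  by rewrite lact_o //; [split; [|left]|lia].
- move=> an bn; have na : (f p).1 != i by lia.
  have nb : (f i).1 != p by apply/eqP => e; rewrite e in mi; lia.
  have bi : (f i).1 != i by apply/eqP; exact: (wf_neq w qN).
  have U : weight n (hf n (lact i f)) + (f p).2 = weight n (hf n f) + minn (f p).2 (f i).2.
    have := @sum_update n (contrib (hf n f)) (contrib (hf n (lact i f))) [:: p; i; (f i).1].
    rewrite !big_cons !big_nil cp cq (cN _ p) // (cS f i) // (cS f (f i).1) ?mi //.
    rewrite (cN _ (f i).1) ?lact_b //= => h.
    have {}h := h ltac:(by rewrite /= !inE !negb_or pq eq_sym nb eq_sym bi).
    have {}h := h ltac:(by move=> x; rewrite !inE => /or3P[] /eqP->).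
    rewrite /weight; move: h; rewrite !addn0 !add0n; apply.
    move=> x xn; rewrite !inE !negb_or => /and3P[xp xq xb].
    rewrite /contrib /hf lact_o //; first by lia.
    by apply: contraL an => /eqP <-; rewrite -ltnNge.
  split; first by lia.
  move=> e; have hm : (f p).2 <= (f i).2 by lia.
  split; last by constructor 3.
  apply: rhf_eq => x xn xN; have [xp xq] := far _ xn.
  have [->|xa] := eqVneq x (f p).1.
    rewrite lact_a // mp (wf_l w pN) /=; split; [lia | by right].
  by rewrite lact_o //; [split; [|left]|lia].
- move=> an bn; have na : (f p).1 != i by lia.
  have U : weight n (hf n (lact i f)) + ((f p).2 + (f i).2) = weight n (hf n f).
    have := @sum_update n (contrib (hf n f)) (contrib (hf n (lact i f))) [:: p; i].
    rewrite !big_cons !big_nil cp cq (cN _ p) // (cN _ i) // => h.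
    have {}h := h ltac:(by rewrite /= !inE pq).
    have {}h := h ltac:(by move=> x; rewrite !inE => /orP[] /eqP->).
    rewrite /weight; move: h; rewrite !addn0; apply.
    move=> x xn; rewrite !inE !negb_or => /andP[xp xq].
    rewrite /contrib /hf lact_o //; first by lia.
      by apply: contraL an => /eqP <-; rewrite -ltnNge.
    by apply: contraL bn => /eqP <-; rewrite -ltnNge.
  have := wf_pos w pN; split; lia.
Qed.

End Lact.

Lemma lact_weight n i f : 0 < i < n -> wf n f -> weight n (hf n (lact i f)) <= weight n (hf n f).
Proof. by move=> iN w; case: (lact_weight_aux iN w). Qed.

Lemma hf_eqE n f g x : eqh n (hf n f) (hf n g) -> x < n ->
  (f x).2 = (g x).2 /\ ((f x).1 = (g x).1 \/ n <= (f x).1 /\ n <= (g x).1).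
Proof.
move=> e xn; have := e x xn; rewrite /hf => -[h ->]; split=> //.
by move: h; case: (ltnP (f x).1 n) => h1; case: (ltnP (g x).1 n) => h2 //; [case=> ->; left|right].
Qed.

(** The reason why the action on a half diagram does not depend on the full diagram chosen to
    represent it. *)
Lemma lact_half n i f g : 0 < i < n -> wf n f -> wf n g -> eqh n (hf n f) (hf n g) ->
  weight n (hf n (lact i f)) = weight n (hf n f) ->
  eqh n (hf n (lact i f)) (hf n (lact i g)) /\ eqh n (rhf n (lact i g)) (rhf n g).
Proof.
move=> iN w w' e wt.
have [_ /(_ wt)[_ cs]] := lact_weight_aux iN w.
suff H : eqh n (hf n (lact i f)) (hf n (lact i g)).
  split=> //; have [_ K] := lact_weight_aux iN w'.
  by have [] := K ltac:(by rewrite -(weight_eqh H) wt; exact: weight_eqh).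
have [pn qn] : i.-1 < n /\ i < n by lia.
have [lp mp] := hf_eqE e pn; have [li mi] := hf_eqE e qn.
have pq : i.-1 != i by lia.
have pN : i.-1 < n + n by lia.
have qN : i < n + n by lia.
have [mfp mgp] := (wf_m w pN, wf_m w' pN).
have [mfi mgi] := (wf_m w qN, wf_m w' qN).
move=> x xn; have [lx mx] := hf_eqE e xn.
have xN : x < n + n by lia.
have [->|xp] := eqVneq x i.-1; first by rewrite /hf !lact_p.
have [->|xq] := eqVneq x i; first by rewrite /hf !(lact_q _ iN).
have La' f' : wf n f' -> (f' i.-1).1 != i ->
    lact i f' (f' i.-1).1 = ((f' i).1, minn (f' i.-1).2 (f' i).2).
  by move=> wf'; exact: (lact_a iN wf').
have Lb' f' : wf n f' -> (f' i.-1).1 != i ->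
    lact i f' (f' i).1 = ((f' i.-1).1, minn (f' i.-1).2 (f' i).2).
  by move=> wf'; exact: (lact_b iN wf').
have out f' : wf n f' -> x != (f' i.-1).1 -> x != (f' i).1 -> lact i f' x = f' x.
  by move=> wf' ? ?; exact: (lact_o wf').
case: cs => [[an bn]|[an bn l]|[an bn l]].
- have ep : (g i.-1).1 = (f i.-1).1 by lia.
  have ei : (g i).1 = (f i).1 by lia.
  have [na|na] := eqVneq (f i.-1).1 i.
    rewrite /hf (lact_arc iN w) // (lact_arc iN w') ?ep //; exact: e.
  have [ea|xa] := eqVneq x (f i.-1).1.
    have := La' _ w'; rewrite ep => /(_ na) eg.
    by rewrite ea /hf eg La' // lp li ei.
  have [eb|xb] := eqVneq x (f i).1.
    have := Lb' _ w'; rewrite ep ei => /(_ na) eg.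
    by rewrite eb /hf eg Lb' // lp li.
  rewrite /hf !out ?ep ?ei //; exact: e.
- have ep : (g i.-1).1 = (f i.-1).1 by lia.
  have gi : n <= (g i).1 by lia.
  have na : (f i.-1).1 != i by apply/eqP => h; rewrite h in mfp; lia.
  have [ea|xa] := eqVneq x (f i.-1).1.
    have := La' _ w'; rewrite ep => /(_ na) eg.
    rewrite ea /hf eg La' // lp li /=.
    by congr (_, _); rewrite !ifF //; apply/negP; lia.
  rewrite /hf !out ?ep //; try lia; exact: e.
- have ei : (g i).1 = (f i).1 by lia.
  have gp : n <= (g i.-1).1 by lia.
  have [eb|xb] := eqVneq x (f i).1.
    have := Lb' _ w'; rewrite ei => /(_ ltac:(lia)) eg.
    rewrite eb /hf eg Lb' ?lp ?li //=; last by lia.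
    by congr (_, _); rewrite !ifF //; apply/negP; lia.
  rewrite /hf !out ?ei //; try lia; exact: e.
Qed.

Lemma wf_La n w f : letters n w -> wf n f -> wf n (La w f).
Proof. by elim: w => //= i w IH /andP[iN lw] wf0; apply: lact_wf => //; exact: IH. Qed.

Lemma La_weight n w f : letters n w -> wf n f -> weight n (hf n (La w f)) <= weight n (hf n f).
Proof.
elim: w => //= i w IH /andP[iN lw] wf0; apply: leq_trans (IH lw wf0).
by apply: lact_weight => //; exact: wf_La.
Qed.

Lemma eqh_trans n h r t : eqh n h r -> eqh n r t -> eqh n h t.
Proof. by move=> e e' x xn; rewrite e // e'. Qed.
Lemma eqh_sym n h r : eqh n h r -> eqh n r h.
Proof. by move=> e x xn; rewrite e. Qed.

Lemma La_half n w f g : letters n w -> wf n f -> wf n g -> eqh n (hf n f) (hf n g) ->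
  weight n (hf n (La w f)) = weight n (hf n f) ->
  eqh n (hf n (La w f)) (hf n (La w g)) /\ eqh n (rhf n (La w g)) (rhf n g).
Proof.
elim: w => [|i w IH] //= /andP[iN lw] wf0 wg e wt.
have [w1 w2] := (wf_La lw wf0, wf_La lw wg).
have h1 := lact_weight iN w1; have h2 := La_weight lw wf0.
have [e1 e2] := IH lw wf0 wg e ltac:(lia).
have [e3 e4] := lact_half iN w1 w2 e1 ltac:(lia).
by split=> //; exact: eqh_trans e4 e2.
Qed.

End Weights.

(** * Canonical half diagrams *)

Section Canonical.
Local Open Scope nat_scope.
Implicit Types (f g : nat -> nat * nat) (h r : nat -> option nat * nat) (w : seq nat) (S : pred nat).

Definition rk S p := count S (iota 1 p).
Lemma rk0 S : rk S 0 = 0. Proof. by []. Qed.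
Lemma rkS S p : rk S p.+1 = rk S p + S p.+1.
Proof. by rewrite /rk -(addn1 p) iotaD count_cat /= addn0 add1n addn1. Qed.

(** Fibonacci sets in terms of the counting function [rk], see [fib_fibP]. *)
Record fibP n S : Prop := FibP {
  fib_in : forall s, S s -> 0 < s <= n;
  fib_odd : forall s, S s -> odd s = odd (rk S s);
  fib_tot : odd (rk S n) = odd n }.

Definition opens S p := ~~ S p.+1 && (odd p == odd (rk S p)).

(** The half diagram in which each s in S propagates, at the node s with label s, while the
    gaps between elements of S, which have even length, are filled with short arcs. *)
Definition can S p : option nat * nat :=
  if S p.+1 then (None, p.+1)
  else if odd p == odd (rk S p) then (Some p.+1, p.+1) else (Some p.-1, p).

Lemma canP S p : [\/ S p.+1 /\ can S p = (None, p.+1),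
  [/\ ~~ S p.+1, odd p = odd (rk S p) & can S p = (Some p.+1, p.+1)] |
  [/\ ~~ S p.+1, odd p = ~~ odd (rk S p) & can S p = (Some p.-1, p)]].
Proof.
rewrite /can; case: ifP => h1; first by constructor 1.
case: eqP => h2; first by constructor 2.
by constructor 3; split => //; lia.
Qed.

Section Fib.
Variables (n : nat) (S : pred nat).
Hypothesis fS : fibP n S.

Lemma opens_next p : p < n -> opens S p -> [/\ p.+1 < n, ~~ S p.+2, ~~ opens S p.+1 & can S p.+1 = (Some p, p.+1)].
Proof.
move=> pn /andP[h1 /eqP h2].
have r1 : rk S p.+1 = rk S p by rewrite rkS (negPf h1) addn0.
have h3 : ~~ S p.+2.
  apply/negP => h; have := fib_odd fS h; rewrite rkS h r1 /=; lia.
have h4 : p.+1 < n.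
  have [//|h] : p.+1 < n \/ p.+1 = n by lia.
  have := fib_tot fS; rewrite -h r1 /=; lia.
split=> //; first by rewrite /opens h3 r1 /=; lia.
rewrite /can (negPf h3) r1 ifF //; apply/eqP; rewrite /=; lia.
Qed.

Lemma closes_prev p : ~~ S p.+1 -> odd p = ~~ odd (rk S p) ->
  exists2 q, p = q.+1 & opens S q /\ ~~ S p.
Proof.
case: p => [|q] h1 h2; first by rewrite rk0 in h2.
have h3 : ~~ S q.+1 by apply/negP => h; have := fib_odd fS h; lia.
exists q => //; split=> //; rewrite /opens h3 /=.
by move: h2; rewrite rkS (negPf h3) addn0 /=; lia.
Qed.

Lemma canE p : p < n -> [\/ S p.+1 /\ can S p = (None, p.+1),
  [/\ opens S p, can S p = (Some p.+1, p.+1), p.+1 < n & can S p.+1 = (Some p, p.+1)] |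
  exists2 q, p = q.+1 & [/\ opens S q, ~~ S p, can S p = (Some q, p) & can S q = (Some p, p)]].
Proof.
move=> pn; case: (canP S p) => [[h1 h2]|[h1 h2 h3]|[h1 h2 h3]]; first by constructor 1.
  constructor 2; have o : opens S p by rewrite /opens h1 h2 eqxx.
  by have [] := opens_next pn o.
constructor 3; have [q eq [o ns]] := closes_prev h1 h2; exists q => //.
split=> //; first by rewrite h3 eq.
by move: o; rewrite /opens /can eq => /andP[/negPf -> ->].
Qed.

Lemma can_ohalf : ohalf n (can S).
Proof.
split.
- move=> p q pn; case: (canE pn) => [[_ ->]|[_ -> h _]|[q' e [_ _ -> _]]] //= [<-] //; lia.
- move=> p q pn; case: (canE pn) => [[_ ->]|[_ -> h _]|[q' e [_ _ -> _]]] //= [<-] //; lia.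
- move=> p q pn; case: (canE pn) => [[_ ->]|[_ -> h h']|[q' e [_ _ -> h']]] //= [<-].
    by rewrite h'.
  by rewrite h' e.
- move=> p q p' q' pq qn; have pn : p < n by lia.
  by case: (canE pn) => [[_ ->]|[_ -> h h']|[p2 e [_ _ -> h']]] //= [<-] _; lia.
- move=> p q p' pq qp' p'n; have pn : p < n by lia.
  by case: (canE pn) => [[_ ->]|[_ -> h h']|[p2 e [_ _ -> h']]] //= [?] _; lia.
- by move=> p pn; case: (canE pn) => [[_ ->]|[_ -> h h']|[p2 e [_ _ -> h']]] //=; lia.
- by move=> p pn; case: (canE pn) => [[_ ->]|[_ -> h h']|[p2 e [_ _ -> h']]] //=; lia.
- by move=> p pn; case: (canE pn) => [[_ ->]|[_ -> h h']|[p2 e [_ _ -> h']]] //=; lia.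
- move=> p q pn; case: (canE pn) => [[_ ->]|[_ -> h h']|[p2 e [_ _ -> h']]] //= [<-].
    by rewrite (minn_idPl (leqnSn _)).
  by rewrite (minn_idPr _) ?e //; lia.
- move=> p q p' q' qp pp' pq' p'n; have qn : q < n by lia.
  by case: (canE qn) => [[_ ->]|[_ -> h h']|[p2 e [_ _ -> h']]] //= _ [?]; lia.
move=> p q qp pn; have qn : q < n by lia.
case: (canE qn) => [[sq ->]|[_ -> h h']|[p2 e [_ _ -> h']]] //= _.
case: (canE pn) => [[_ ->]|[_ -> h h']|[p2 e [_ ns -> h']]] //=; try lia.
have ne : p != q.+1 by apply: contraNneq ns => ->.
lia.
Qed.

Lemma can_PL s : PL n (can S) s <-> S s.
Proof.
split.
  case=> p pn; case: (canE pn) => [[h ->]|[_ -> h h']|[p2 e [_ _ -> h']]] //= [<-] //.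
move=> h; have sn := fib_in fS h; exists s.-1; first by lia.
by rewrite /can prednK ?h //; lia.
Qed.

(** The word whose letters are the left ends of the short arcs of [can S]. *)
Definition canw (n : nat) S := [seq p.+1 | p <- iota 0 n & opens S p].

Lemma letters_canw : letters n (canw n S).
Proof.
apply/allP => a /mapP[p]; rewrite mem_filter mem_iota add0n => /andP[o pn] ->.
by have [] := opens_next pn o.
Qed.

Lemma pairwise_canw : pairwise (fun a b => a.+2 <= b) (canw n S).
Proof.
rewrite pairwise_map.
have h : pairwise ltn [seq p <- iota 0 n | opens S p].
  by rewrite -sorted_pairwise; [apply: sorted_filter; [exact: ltn_trans|exact: iota_ltn_sorted]|exact: ltn_trans].
apply: (@sub_in_pairwise _ [pred p | opens S p && (p < n)] ltn) h.
  move=> p q; rewrite !inE => /andP[op pn] /andP[oq qn] /= pq.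
  have [_ _ no _] := opens_next pn op.
  have : q != p.+1 by apply: contraNneq no => <-.
  by lia.
by apply/allP => p; rewrite mem_filter mem_iota.
Qed.

Definition arcs_in h := forall p, p < n -> opens S p -> h p = (Some p.+1, p.+1).

(** A propagating node carries a label at most its absolute value, which is attained in
    [can S]; and the right end of a short arc does not propagate. *)
Lemma arcs_contrib h p : ohalf n h -> arcs_in h -> p < n -> contrib h p <= contrib (can S) p.
Proof.
move=> o a pn; rewrite /contrib; case: (canE pn) => [[sp ->]|[op -> h' _]|[q e [oq _ -> _]]] /=.
- by case: (isSome _) => //; exact: (oh_le o).
- by rewrite a.
- have qn : q < n by lia.
  by have := oh_inv o qn (f_equal fst (a q qn oq)); rewrite -e => ->.
Qed.

Lemma arcs_le h : ohalf n h -> arcs_in h -> weight n h <= weight n (can S).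
Proof.
move=> o a; rewrite /weight [leqLHS]big_seq_cond [leqRHS]big_seq_cond.
by apply: leq_sum => p; rewrite mem_iota add0n => /andP[/andP[_ pn] _]; exact: arcs_contrib.
Qed.

(** The canonical half diagram is the only heaviest one among those that contain its short
    arcs. Therefore the canonical word of S annihilates every half diagram of larger weight,
    and maps those with label set S to a single one. *)
Lemma arcs_eq h : ohalf n h -> arcs_in h -> weight n h = weight n (can S) -> eqh n h (can S).
Proof.
move=> o a e.
have ce p : p < n -> contrib h p = contrib (can S) p.
  move=> pn; apply/eqP; rewrite eqn_leq arcs_contrib //=.
  have pi : p \in iota 0 n by rewrite mem_iota.
  have us := iota_uniq 0 n.
  have : weight n h = weight n (can S) by [].
  rewrite /weight (bigD1_seq p) //= (bigD1_seq p (F := contrib (can S))) //=.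
  have : \sum_(i <- iota 0 n | i != p) contrib h i <= \sum_(i <- iota 0 n | i != p) contrib (can S) i.
    rewrite big_seq_cond [leqRHS]big_seq_cond; apply: leq_sum => q.
    by rewrite mem_iota add0n => /andP[/andP[_ qn] _]; exact: arcs_contrib.
  lia.
move=> p pn; have := ce _ pn; rewrite /contrib.
case: (canE pn) => [[sp ->]|[op -> h' _]|[q eq [oq _ -> _]]].
- by case: (h p) => [[q|] l] //= ->.
- by move=> _; exact: a.
- move=> _; have qn : q < n by lia.
  by have := oh_inv o qn (f_equal fst (a q qn oq)); rewrite -eq => ->; rewrite a //= eq.
Qed.

End Fib.

Lemma La_fix n w f : letters n w -> good n f -> (forall a, a \in w -> f a.-1 = (a, a)) ->
  eqa n (La w f) f.
Proof.
elim: w => //= a w IH /andP[aN lw] g h.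
have {}IH : eqa n (La w f) f by apply: IH => // b bw; apply: h; rewrite inE bw orbT.
apply: eqa_trans (lact_eqa aN IH) _ => x xN.
have [m _] := g.
apply: (surg_arc (M := n + n)) => //; try lia.
by apply: h; rewrite inE eqxx.
Qed.

Lemma La_arcs n w f : letters n w -> pairwise (fun a b => a.+2 <= b) w -> good n f ->
  forall a, a \in w -> La w f a.-1 = (a, a).
Proof.
elim: w => //= a w IH /andP[aN lw] /andP[/allP pw pw'] g b; rewrite inE => /orP[/eqP->|bw].
  exact: surg_p.
have := pw _ bw => ab; have e := IH lw pw' g b bw.
by rewrite /lact surg_o ?e //=; lia.
Qed.

Lemma La_out n w x : letters n w -> x < n -> (forall a, a \in w -> x != a.-1 /\ x != a) ->
  La w (idf n) x = idf n x.
Proof.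
move=> lw xn; elim: w lw => //= a w IH /andP[aN lw] h.
have {}IH : La w (idf n) x = idf n x by apply: IH => // b bw; apply: h; rewrite inE bw orbT.
have [h1 h2] := h a ltac:(by rewrite inE eqxx).
by rewrite /lact surg_o ?IH //= /idf /=; lia.
Qed.

Definition Ra (n : nat) w f := foldr (bact n) f w.

Lemma Ra_good n w f : letters n w -> good n f -> good n (Ra n w f).
Proof. by elim: w => //= i w IH /andP[iN wN] e; apply: bact_good => //; exact: IH. Qed.

Lemma Ra_eqa n w f g : letters n w -> eqa n f g -> eqa n (Ra n w f) (Ra n w g).
Proof. by elim: w => //= i w IH /andP[iN wN] e; apply: bact_eqa => //; exact: IH. Qed.

Lemma lact_Ra n i w f : 0 < i < n -> letters n w -> good n f ->
  eqa n (lact i (Ra n w f)) (Ra n w (lact i f)).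
Proof.
move=> iN; elim: w => //= j w IH /andP[jN lw] g.
apply: eqa_trans (lact_bact iN jN (Ra_good lw g)) _.
by apply: bact_eqa => //; exact: IH.
Qed.

Lemma La_Ra n u w f : letters n u -> letters n w -> good n f ->
  eqa n (La u (Ra n w f)) (Ra n w (La u f)).
Proof.
move=> lu lw g; elim: u lu => //= i u IH /andP[iN lu].
apply: eqa_trans (lact_eqa iN (IH lu)) _.
by apply: lact_Ra => //; exact: La_good.
Qed.

Lemma lact_bact_id n i : 0 < i < n -> eqa n (lact i (idf n)) (bact n i (idf n)).
Proof.
move=> iN; have aI : ab n i.-1 = i by have := ab_spec n i.-1; lia.
have aJ : ab n i = i.+1 by have := ab_spec n i; lia.
have aK : ab n (n + n - i.+1) = i.+1 by have := ab_spec n (n + n - i.+1); lia.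
have aL : ab n (n + n - i) = i by have := ab_spec n (n + n - i); lia.
move=> x xN; rewrite /lact /bact.
have [->|x1] := eqVneq x i.-1.
  rewrite surg_p surg_mq /idf ?aK ?aL /=; try lia; congr (_, _); lia.
have [->|x2] := eqVneq x i.
  rewrite surg_q; last by lia.
  rewrite surg_mp /idf ?aK ?aL /=; try lia; congr (_, _); lia.
have [->|x3] := eqVneq x (n + n - i.+1).
  rewrite surg_p surg_mq /idf ?aI ?aJ /=; try lia; congr (_, _); lia.
have [->|x4] := eqVneq x (n + n - i).
  rewrite surg_q; last by lia.
  rewrite surg_mp /idf ?aI ?aJ /=; try lia; congr (_, _); lia.
rewrite !surg_o //= /idf /=; lia.
Qed.

Lemma letters_rev n w : letters n (rev w) = letters n w.
Proof. exact: all_rev. Qed.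

Lemma La_Ra_id n w : letters n w -> eqa n (La w (idf n)) (Ra n (rev w) (idf n)).
Proof.
elim: w => //= a w IH /andP[aN lw].
have g := wf_good (idf_wf n).
have lr : letters n (rev w) by rewrite letters_rev.
apply: eqa_trans (lact_eqa aN (IH lw)) _.
apply: eqa_trans (lact_Ra aN lr g) _.
rewrite rev_cons /Ra -cats1 foldr_cat /=.
exact: Ra_eqa lr (lact_bact_id aN).
Qed.

Lemma Ra_fix n w f : letters n w -> good n f ->
  (forall a, a \in w -> f (n + n - a) = (n + n - a.+1, a)) -> eqa n (Ra n w f) f.
Proof.
elim: w => //= a w IH /andP[aN lw] g h.
have {}IH : eqa n (Ra n w f) f by apply: IH => // b bw; apply: h; rewrite inE bw orbT.
apply: eqa_trans (bact_eqa aN IH) _ => x xN.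
have [m _] := g.
have ne : n + n - a.+1 != n + n - a by lia.
rewrite /bact surg_sym //; apply: (surg_arc (M := n + n)) => //; try lia.
by apply: h; rewrite inE eqxx.
Qed.

Lemma La_arcs_in n S f : fibP n S -> good n f -> arcs_in n S (hf n (La (canw n S) f)).
Proof.
move=> fS g p pn op.
have arcs : La (canw n S) f p = (p.+1, p.+1).
  apply: (La_arcs (letters_canw fS) (pairwise_canw fS) g (a := p.+1)).
  by apply/mapP; exists p => //; rewrite mem_filter op mem_iota.
by rewrite /hf arcs /=; have [-> ] := opens_next fS pn op.
Qed.

Lemma can_arcs n S f : fibP n S -> eqh n (hf n f) (can S) ->
  forall a, a \in canw n S -> f a.-1 = (a, a).
Proof.
move=> fS hg a /mapP[p]; rewrite mem_filter mem_iota add0n => /andP[op pn] -> /=.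
have := hg p pn; have [pn1 _ _ _] := opens_next fS pn op.
have -> : can S p = (Some p.+1, p.+1) by move: op; rewrite /opens /can => /andP[/negPf -> ->].
by move=> h; have [e _] := hf_some (f_equal fst h); rewrite [LHS]surjective_pairing e; congr (_, _); case: h.
Qed.

Lemma La_canw_fix n S f : fibP n S -> wf n f -> eqh n (hf n f) (can S) -> eqa n (La (canw n S) f) f.
Proof.
move=> fS w e; apply: La_fix; [exact: letters_canw|exact: wf_good|exact: can_arcs].
Qed.

Lemma hf_canw n S : fibP n S -> eqh n (hf n (La (canw n S) (idf n))) (can S).
Proof.
move=> fS; have g := wf_good (idf_wf n).
have lw := letters_canw fS; have pw := pairwise_canw fS.
have o := hf_ohalf (La_wf lw).
have ai := La_arcs_in fS g.
apply: arcs_eq => //; apply/eqP; rewrite eqn_leq arcs_le //=.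
rewrite /weight big_seq_cond [leqRHS]big_seq_cond; apply: leq_sum => p.
rewrite mem_iota add0n => /andP[/andP[_ pn] _]; rewrite {1}/contrib.
case: (canE fS pn) => [[sp ->]|[op -> h' _]|[q e [oq _ -> _]]] //.
rewrite /contrib /hf La_out //.
  have e : (n + n - p.+1 < n) = false by lia.
  by rewrite /idf /= e /= /ab pn.
move=> a /mapP[q]; rewrite mem_filter mem_iota add0n => /andP[oq qn] -> /=.
have [_ n1 _ _] := opens_next fS qn oq.
move: oq => /andP[n2 _]; split; first by apply: contraNneq n2 => <-.
by apply: contraNneq n1 => <-.
Qed.

(** A diagram D with propagating labels S is A_u A_P A_v, where P is the canonical word of S:
    let A_u have the left half of D and the right half [can S], and let A_v have the left half
    [can S] and the right half of D. Then P fixes A_v, on whose left half A_u acts as on that of A_P; and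
    A_u A_P = A_u because A_P acts trivially on the right of A_u. *)
Lemma factor_can n S f : fibP n S -> wf n f -> (forall s, PL n (hf n f) s <-> S s) ->
  exists u v, [/\ letters n u, letters n v & eqa n (La u (La (canw n S) (La v (idf n)))) f].
Proof.
move=> fS w fib_pred.
have oc := can_ohalf fS.
have lP := letters_canw fS; have pP := pairwise_canw fS.
have gi := wf_good (idf_wf n).
have sc : samep n (hf n f) (can S).
  by move=> s; split=> [/fib_pred/(can_PL fS)|/(can_PL fS)/fib_pred].
have sr : samep n (can S) (rhf n f).
  exact: samep_trans (samep_sym sc) (half_samep w).
have [oL oR] := (hf_ohalf w, rhf_ohalf w).
have w1 := com_wf oL oc sc; have w2 := com_wf oc oR sr.
have [u [lu eu]] := wf_word w1.
have [v [lv ev]] := wf_word w2.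
exists u, v; split=> //.
set g := com n (can S) (rhf n f) in w2 ev.
have hg : eqh n (hf n g) (can S) := com_hf oc oR sr.
have rg : eqh n (rhf n g) (rhf n f) := com_rhf oc oR sr.
have e1 : eqa n (La (canw n S) (La v (idf n))) g.
  apply: eqa_trans (La_eqa lP ev) _.
  exact: La_canw_fix.
apply: eqa_trans (La_eqa lu e1) _.
(* A_u is computed on A_P, which has the same left half as A_v *)
set f0 := La (canw n S) (idf n).
have w0 : wf n f0 := La_wf lP.
have h0 : eqh n (hf n f0) (can S) := hf_canw fS.
set d := com n (hf n f) (can S) in w1 eu.
have hd : eqh n (hf n d) (hf n f) := com_hf oL oc sc.
have rd : eqh n (rhf n d) (can S) := com_rhf oL oc sc.
have e0 : eqa n (La u f0) d.
  apply: eqa_trans (La_eqa lu (La_Ra_id lP)) _.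
  have lR : letters n (rev (canw n S)) by rewrite letters_rev.
  apply: eqa_trans (La_Ra lu lR gi) _.
  apply: eqa_trans (Ra_eqa lR eu) _.
  apply: Ra_fix => //; first exact: wf_good.
  move=> a; rewrite mem_rev => /mapP[p]; rewrite mem_filter mem_iota add0n => /andP[op pn] ->.
  have := rd p pn; have [pn1 _ _ _] := opens_next fS pn op.
  have -> : can S p = (Some p.+1, p.+1) by move: op; rewrite /opens /can => /andP[/negPf -> ->].
  rewrite /rhf => h; have [e _] := hf_some (f_equal fst h).
  case: h => _; move: e; rewrite /flip /= => e1' e2'.
  rewrite [LHS]surjective_pairing e2'; congr (_, _).
  have := wf_lt w1 (p := n + n - p.+1) ltac:(lia); lia.
have wt : weight n (hf n (La u f0)) = weight n (hf n f0).
  have -> : weight n (hf n (La u f0)) = weight n (hf n f).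
    apply: weight_eqh; apply: eqh_trans hd => p pn; rewrite /hf e0 //; lia.
  rewrite (weight_eqh h0).
  have uS : uniq [seq s <- iota 0 n.+1 | S s] by rewrite filter_uniq // iota_uniq.
  have mS s : s \in [seq s <- iota 0 n.+1 | S s] <-> S s.
    rewrite mem_filter mem_iota add0n /=; split; first by case/andP.
    by move=> h; rewrite h /=; have := fib_in fS h; lia.
  rewrite (weight_PL oL uS); last by move=> s; split=> [/mS h|/fib_pred h]; [apply/fib_pred|apply/mS].
  rewrite (weight_PL oc uS) //.
  by move=> s; split=> [/mS h|/(can_PL fS) h]; [apply/(can_PL fS)|apply/mS].
have [k1 k2] := La_half lu w0 w2 (eqh_trans h0 (eqh_sym hg)) wt.
apply: half_eqa => //; first exact: wf_La.
  apply: eqh_trans (eqh_sym k1) _; apply: eqh_trans hd => p pn; rewrite /hf e0 //; lia.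
exact: eqh_trans k2 rg.
Qed.

End Canonical.

(** * Restriction and extension of half diagrams *)

Section Restriction.
Local Open Scope nat_scope.
Implicit Types (f g : nat -> nat * nat) (h r : nat -> option nat * nat) (w : seq nat) (S : pred nat).

Definition restr (n : nat) h p : option nat * nat :=
  (if (h p).1 is Some q then if q < n then Some q else None else None, (h p).2).

Lemma restr_some n h p q : (restr n h p).1 = Some q <-> (h p).1 = Some q /\ q < n.
Proof.
rewrite /restr; case: (h p) => [[q'|] l] /=; last by split=> // -[].
case: ltnP => h1; split=> //.
- by case=> <-.
- by case.
- by case=> -[<-]; rewrite ltnNge h1.
Qed.

Lemma restr_none n h p : ohalf n.+1 h -> p < n ->
  (restr n h p).1 = None <-> (h p).1 = None \/ (h p).1 = Some n.
Proof.
move=> o pn; rewrite /restr; case e: (h p).1 => [q|] /=; last by split=> //; left.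
have qn := oh_lt o (p := p) ltac:(lia) e.
case: ltnP => h1; split=> //; first by case=> // -[eq]; lia.
by move=> _; right; congr Some; lia.
Qed.

Lemma restr_ohalf n h : ohalf n.+1 h -> ohalf n (restr n h).
Proof.
move=> o; have dn p : p < n -> p < n.+1 by lia.
split.
- by move=> p q pn /restr_some[].
- by move=> p q pn /restr_some[e _]; exact: (oh_neq o (dn _ pn)).
- move=> p q pn /restr_some[e qn]; rewrite {1}/restr (oh_inv o (dn _ pn) e) /=.
  by rewrite pn.
- move=> p q p' q' pq qn /restr_some[ep _] /restr_some[eq _].
  exact: (oh_nc o pq (dn _ qn) ep eq).
- move=> p q p' pq qp' p'n /restr_some[ep _] /(restr_none o _)[|eq|eq]; first by lia.
    exact: (oh_cov o pq qp' (dn _ p'n) ep eq).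
  exact: (oh_nc o pq (dn q ltac:(lia)) ep eq).
- by move=> p pn; exact: (oh_pos o (dn _ pn)).
- by move=> p pn; exact: (oh_le o (dn _ pn)).
- move=> p pn /(restr_none o pn)[e|e]; first exact: (oh_oddN o (dn _ pn) e).
  by rewrite (oh_oddS o (dn _ pn) e) (minn_idPl _) //; lia.
- by move=> p q pn /restr_some[e _]; exact: (oh_oddS o (dn _ pn) e).
- move=> p q p' q' qp pp' pq' p'n /restr_some[ep _] /restr_some[eq _].
  exact: (oh_nest o qp pp' pq' (dn _ p'n) ep eq).
move=> p q qp pn; have qn : q < n by lia.
move=> /(restr_none o qn)[e|e]; first exact: (oh_inc o qp (dn _ pn) e).
have pn1 := dn _ pn; have qn1 := dn _ qn; rewrite /=.
case ep: (h p).1 => [p'|]; last by case: (oh_cov o qp (_ : p < n) (leqnn _) e ep).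
have ip := oh_inv o pn1 ep; have p'n := oh_lt o pn1 ep.
have np := oh_neq o pn1 ep; have iq := oh_inv o qn1 e.
have p'N : p' <> n by move=> e'; rewrite e' iq in ip; case: ip; lia.
have [h1|h1] : p < p' \/ p' < p by lia.
  exact: (oh_nest o qp h1 (q' := n) ltac:(lia) p'n ep e).
have h2 : p' <> q by move=> e'; rewrite e' in ip; rewrite ip /= in e; case: e; lia.
have [h3|h3] : q < p' \/ p' < q by lia.
  have := oh_nest o h3 h1 (q' := n) pn pn1 (f_equal fst ip) e.
  by rewrite ip.
by case: (oh_nc o h3 qn1 (f_equal fst ip) e qp pn).
Qed.

Lemma restr_ins n k f : wf n f -> k <= n -> eqh n (restr n (hf n.+1 (ins n k f))) (hf n f).
Proof.
move=> w kn p pn; have s1 := sh_spec (n + k) p; have ep : p = sh (n + k) p by lia.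
have s2 := sh_spec (n + k) (f p).1.
rewrite /restr /hf {1 2}ep ins_sh /=; congr (_, _); last by rewrite {1}ep ins_sh.
case: (ltnP (f p).1 n) => h.
  by rewrite (_ : sh _ _ = (f p).1) ?(ltnW h) ?ltnS ?(ltnW h) ?h //; lia.
by case: ltnP => // h1; rewrite ifF //; lia.
Qed.

Lemma rhf_eqE n f g x : eqh n (rhf n f) (rhf n g) -> n <= x -> x < n + n ->
  (f x).2 = (g x).2 /\ ((f x).1 = (g x).1 \/ (f x).1 < n /\ (g x).1 < n \/ n + n <= (f x).1 \/ n + n <= (g x).1).
Proof.
move=> e h1 h2; have pn : n + n - x.+1 < n by lia.
have := e _ pn; rewrite /rhf /flip /hf (_ : n + n - (n + n - x.+1).+1 = x); last by lia.
case=> e1 ->; split=> //; move: e1.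
case: ltnP => h3; case: ltnP => h4 //; last by move=> _; right; lia.
by case; lia.
Qed.

Lemma rhf_ins n k f g : wf n f -> wf n g -> k <= n -> eqh n (rhf n f) (rhf n g) ->
  eqh n.+1 (rhf n.+1 (ins n k f)) (rhf n.+1 (ins n k g)).
Proof.
move=> w w' kn e; apply: rhf_eq => x xn xN.
case: (posP (n + k) x) xn xN => [->|->|[y ->]]; rewrite ?ins_k ?ins_k1 ?ins_sh /=; try by split; [|left].
have s1 := sh_spec (n + k) y => xn xN.
have yn : n <= y by lia.
have yN : y < n + n by lia.
have [-> h] := rhf_eqE e yn yN; split=> //.
have := wf_lt w yN; have := wf_lt w' yN.
case: h => [->|]; first by left.
have := sh_spec (n + k) (f y).1; have := sh_spec (n + k) (g y).1; lia.
Qed.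

(** The propagating labels can be read on the right half ([half_samep]), where insertion does
    not see the left half. *)
Lemma ins_PL n k f g : wf n f -> wf n g -> k <= n -> eqh n (rhf n f) (rhf n g) ->
  samep n.+1 (hf n.+1 (ins n k f)) (hf n.+1 (ins n k g)).
Proof.
move=> w w' kn e.
apply: samep_trans (half_samep (ins_wf kn w)) _.
apply: samep_trans (eqh_samep (rhf_ins w w' kn e)) _.
exact: samep_sym (half_samep (ins_wf kn w')).
Qed.

(** If the last node propagates, it does so with the largest label, which restriction removes. *)
Lemma lastN n h l : ohalf n.+1 h -> h n = (None, l) ->
  (forall s, PL n.+1 h s <-> PL n (restr n h) s \/ s = l) /\
  (forall s, PL n (restr n h) s -> s < l).
Proof.
move=> o hn.
have nS p : p < n -> (h p).1 <> Some n.
  by move=> pn e; have := oh_inv o (p := p) ltac:(lia) e; rewrite hn.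
have PLr s : PL n (restr n h) s -> exists2 p, p < n & h p = (None, s).
  case=> p pn e; exists p => //; have [e1|/(nS _ pn)//] := iffLR (restr_none o pn) (f_equal fst e).
  by rewrite [LHS]surjective_pairing e1 -[(h p).2]/((restr n h p).2) e.
split=> s.
  split=> [[p pn hp]|[/PLr[p pn hp]|->]].
  - have [e|pn'] : p = n \/ p < n by lia.
      by right; move: hp; rewrite e hn => -[].
    by left; exists p => //; rewrite /restr hp.
  - by exists p => //; lia.
  - by exists n.
by move=> /PLr[p pn hp]; have := oh_inc o pn (leqnn _) (f_equal fst hp); rewrite hp hn.
Qed.

(** If the last node closes an arc, restriction makes the other end of that arc propagate,
    with a label larger than all the others since nothing to its right propagates. *)
Lemma lastS n h a l : ohalf n.+1 h -> h n = (Some a, l) ->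
  [/\ a < n, restr n h a = (None, l), h a = (Some n, l),
    (forall s, PL n (restr n h) s <-> PL n.+1 h s \/ s = l) &
    (forall s, PL n.+1 h s -> s < l)].
Proof.
move=> o hn; have e1 : (h n).1 = Some a by rewrite hn.
have an := oh_lt o (leqnn _) e1; have na := oh_neq o (leqnn _) e1.
have ha := oh_inv o (leqnn _) e1; rewrite hn /= in ha.
have an' : a < n by lia.
have ra : restr n h a = (None, l) by rewrite /restr ha /= ltnn.
have lt s : PL n.+1 h s -> s < l.
  case=> p pn hp.
  have pn' : p != n by apply/eqP => e; rewrite e hn in hp.
  have [h1|[h1|h1]] : a < p \/ p = a \/ p < a by lia.
  - by case: (oh_cov o h1 (_ : p < n) (leqnn _) (f_equal fst ha) (f_equal fst hp)); lia.
  - by rewrite h1 ha in hp.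
  - by have := oh_inc o h1 an (f_equal fst hp); rewrite hp ha.
split=> // s; split.
  case=> p pn e; have e2 : (h p).2 = s by rewrite -[(h p).2]/((restr n h p).2) e.
  have [h1|h1] := iffLR (restr_none o pn) (f_equal fst e).
    by left; exists p; [lia|rewrite -h1 -e2 -surjective_pairing].
  right; have := oh_inv o (p := p) ltac:(lia) h1; rewrite hn => -[_ ->].
  by rewrite e2.
case=> [[p pn hp]|->]; last by exists a.
have pn' : p != n by apply/eqP => e; rewrite e hn in hp.
by exists p; [lia|rewrite /restr hp].
Qed.

(** Comparing the label set with that of the restriction tells whether the last node
    propagates, and what its label is; if it closes an arc, the other end is the propagating
    node of the restriction with this label. *)
Lemma restr_inj n h h' : ohalf n.+1 h -> ohalf n.+1 h' -> eqh n (restr n h) (restr n h') ->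
  samep n.+1 h h' -> eqh n.+1 h h'.
Proof.
move=> o o' e sp.
have spr := eqh_samep e.
have base p : p < n -> (h p).1 <> Some n -> (h' p).1 <> Some n -> h p = h' p.
  move=> pn n1 n2; have := e p pn; rewrite /restr => -[e1 e2].
  rewrite (surjective_pairing (h p)) (surjective_pairing (h' p)) e2; congr (_, _).
  have lt q : (h p).1 = Some q -> q < n.
    move=> e3; have := oh_lt o (p := p) ltac:(lia) e3.
    have : q <> n by move=> e4; rewrite e4 in e3.
    lia.
  have lt' q : (h' p).1 = Some q -> q < n.
    move=> e3; have := oh_lt o' (p := p) ltac:(lia) e3.
    have : q <> n by move=> e4; rewrite e4 in e3.
    lia.
  move: e1; case E: (h p).1 => [q|]; case E': (h' p).1 => [q'|] //.
  - by rewrite (lt _ E) (lt' _ E').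
  - by rewrite (lt _ E).
  - by rewrite (lt' _ E').
case hn: (h n) => [[a|] l]; case hn': (h' n) => [[a'|] l'].
- have [an ra ha PLr lt] := lastS o hn; have [an' ra' ha' PLr' lt'] := lastS o' hn'.
  have ll : l = l'.
    have : PL n (restr n h') l by apply/spr/PLr; right.
    by case/PLr' => // /sp/lt; rewrite ltnn.
  subst l'; have aa : a = a'.
    by apply: (oh_uniq (restr_ohalf o) an an'); rewrite ?ra ?e // ?ra'.
  subst a' => p pn; have [->|pn'] : p = n \/ p < n by lia.
    by rewrite hn hn'.
  have [->|pa] := eqVneq p a; first by rewrite ha ha'.
  apply: base => //.
    by move=> e1; have := oh_inv o pn e1; rewrite hn => -[e2]; case/eqP: pa.
  by move=> e1; have := oh_inv o' pn e1; rewrite hn' => -[e2]; case/eqP: pa.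
- have [an ra ha PLr lt] := lastS o hn; have [PLr' lt'] := lastN o' hn'.
  have : PL n.+1 h l' by apply/sp/PLr'; right.
  move=> h1; have : PL n (restr n h') l' by apply/spr/PLr; left.
  by move=> /lt'; rewrite ltnn.
- have [an ra ha PLr lt] := lastS o' hn'; have [PLr' lt'] := lastN o hn.
  have : PL n.+1 h' l by apply/sp/PLr'; right.
  move=> h1; have : PL n (restr n h) l by apply/spr/PLr; left.
  by move=> /lt'; rewrite ltnn.
have [PLr lt] := lastN o hn; have [PLr' lt'] := lastN o' hn'.
have ll : l = l'.
  have : PL n.+1 h' l by apply/sp/PLr; right.
  by case/PLr' => // /spr/lt; rewrite ltnn.
subst l' => p pn; have [->|pn'] : p = n \/ p < n by lia.
  by rewrite hn hn'.
apply: base => //.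
  by move=> e1; have := oh_inv o pn e1; rewrite hn.
by move=> e1; have := oh_inv o' pn e1; rewrite hn'.
Qed.

(** The two inverses of restriction, according to whether the last node propagates or closes
    an arc that starts at [a]. *)
Definition ext1 (n : nat) h l p : option nat * nat := if p == n then (None, l) else h p.
Definition ext2 (n : nat) h a l p : option nat * nat :=
  if p == n then (Some a, l) else if p == a then (Some n, l) else h p.

Lemma ext1P n h l p : p < n.+1 -> (p = n /\ ext1 n h l p = (None, l)) \/ (p < n /\ ext1 n h l p = h p).
Proof. by move=> pn; rewrite /ext1; case: eqP => [->|ne]; [left|right; split=> //; lia]. Qed.

Lemma ext1_ohalf n h l : ohalf n h -> (forall s, PL n h s -> s < l) -> 0 < l <= n.+1 ->
  odd l = odd n.+1 -> ohalf n.+1 (ext1 n h l).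
Proof.
move=> o lt l1 l2.
have ex q : q < n -> ext1 n h l q = h q by rewrite /ext1; case: eqP => // ->; lia.
split.
- move=> p q pn; case: (ext1P h l pn) => -[pn' ->] //= e; have := oh_lt o pn' e; lia.
- move=> p q pn; case: (ext1P h l pn) => -[pn' ->] //= e; exact: (oh_neq o pn' e).
- move=> p q pn; case: (ext1P h l pn) => -[pn' ->] //= e; have qn := oh_lt o pn' e.
  by rewrite ex // (oh_inv o pn' e).
- move=> p q p' q' pq qn; have pn : p < n by lia.
  rewrite ex //; case: (ext1P h l qn) => -[qn' ->] //=; exact: (oh_nc o pq qn').
- move=> p q p' pq qp' p'n; have pn : p < n by lia.
  have qn : q < n by lia.
  rewrite !ex // => ep; apply: (oh_cov o pq qp' _ ep); exact: (oh_lt o pn ep).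
- move=> p pn; case: (ext1P h l pn) => -[pn' ->] //=; [lia|exact: (oh_pos o pn')].
- move=> p pn; case: (ext1P h l pn) => -[pn' ->] //=; [lia|exact: (oh_le o pn')].
- by move=> p pn; case: (ext1P h l pn) => -[pn' ->] //=; [rewrite pn'|exact: (oh_oddN o pn')].
- by move=> p q pn; case: (ext1P h l pn) => -[pn' ->] //=; exact: (oh_oddS o pn').
- move=> p q p' q' qp pp' pq' p'n; have pn : p < n by lia.
  have qn : q < n by lia.
  rewrite !ex // => ep eq; apply: (oh_nest o qp pp' pq' _ ep eq); exact: (oh_lt o pn ep).
move=> p q qp pn; have qn : q < n by lia.
rewrite (ex _ qn) => eq; case: (ext1P h l pn) => -[pn' ->] /=.
  by apply: lt; exists q => //; rewrite -eq -surjective_pairing.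
exact: (oh_inc o qp pn' eq).
Qed.

Lemma restr_id n h h' : ohalf n h -> (forall p, p < n -> h' p = h p) -> eqh n (restr n h') h.
Proof.
move=> o e p pn; rewrite /restr e //; case E: (h p).1 => [q|]; last by rewrite -E -surjective_pairing.
by rewrite (oh_lt o pn E) -E -surjective_pairing.
Qed.

Lemma ext1_restr n h l : ohalf n h -> eqh n (restr n (ext1 n h l)) h.
Proof. by move=> o; apply: restr_id => // p pn; rewrite /ext1; case: eqP => // e; lia. Qed.

Lemma ext2_ohalf n h a l : ohalf n h -> a < n -> h a = (None, l) -> (forall s, PL n h s -> s <= l) ->
  ohalf n.+1 (ext2 n h a l).
Proof.
move=> o an ha mx.
have np p : a < p -> p < n -> (h p).1 <> None.
  move=> ap pn e; have := oh_inc o ap pn (f_equal fst ha); rewrite ha /=.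
  have : (h p).2 <= l by apply: mx; exists p => //; rewrite -e -surjective_pairing.
  lia.
have en : ext2 n h a l n = (Some a, l) by rewrite /ext2 eqxx.
have ea : ext2 n h a l a = (Some n, l) by rewrite /ext2 eqxx ifF //; apply/eqP; lia.
have ex p : p < n -> p != a -> ext2 n h a l p = h p.
  by move=> pn pa; rewrite /ext2 (negPf pa) ifF //; apply/eqP; lia.
have P p : p < n.+1 -> [\/ p = n, p = a | p < n /\ p != a].
  move=> pn; have [->|h1] := eqVneq p n; first by constructor 1.
  by have [->|h2] := eqVneq p a; [constructor 2|constructor 3; split=> //; lia].
have ha2 q : q < n -> (h q).1 <> Some a.
  by move=> qn e; have := oh_inv o qn e; rewrite ha.
split.
- move=> p q pn; case: (P _ pn) => [->|->|[pn' pa]]; rewrite ?en ?ea ?ex //=; try (by case=> <-; lia).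
  by move=> e; have := oh_lt o pn' e; lia.
- move=> p q pn; case: (P _ pn) => [->|->|[pn' pa]]; rewrite ?en ?ea ?ex //=; try (by case=> <-; lia).
  exact: (oh_neq o pn').
- move=> p q pn; case: (P _ pn) => [->|->|[pn' pa]].
    by rewrite en /= => -[<-]; rewrite ea.
    by rewrite ea /= => -[<-]; rewrite en.
  rewrite (ex p) // => e; have qn := oh_lt o pn' e; rewrite ex ?(oh_inv o pn' e) //.
  by apply/eqP => eqa; rewrite eqa in e; exact: (ha2 _ pn' e).
- move=> p q p' q' pq qn; have pn : p < n by lia.
  case: (P _ (leqW pn)) => [e|e|[_ pa]]; first by lia.
    subst p; rewrite ea /= => -[<-] eq h1; case: (P _ qn) => [e1|e1|[qn' qa]]; try lia.
    by move: eq; rewrite (ex _ qn' qa) => eq; have := oh_lt o qn' eq; lia.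
  rewrite (ex p) // => ep; have p'n := oh_lt o pn ep.
  case: (P _ qn) => [e|e|[qn' qa]]; first by subst q; lia.
    subst q; rewrite ea /= => _ h1 _; apply: (oh_cov o pq h1 p'n ep); by rewrite ha.
  by rewrite (ex q) // => eq; exact: (oh_nc o pq qn' ep eq).
- move=> p q p' pq qp' p'n; have pn : p < n by lia.
  have qn : q < n by lia.
  case: (P _ (leqW qn)) => [e|e|[_ qa]]; [by lia|by subst q; rewrite ea|].
  rewrite (ex q) //; case: (P _ (leqW pn)) => [e|e|[_ pa]]; first by lia.
    subst p; rewrite ea /= => -[ep'] eq; apply: (np q) => //; lia.
  by rewrite (ex p) // => ep; apply: (oh_cov o pq qp' _ ep); exact: (oh_lt o pn ep).
- move=> p pn; have := oh_pos o an; rewrite ha /= => l0.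
  case: (P _ pn) => [e|e|[pn' pa]]; [by subst p; rewrite en|by subst p; rewrite ea|].
  by rewrite ex //; exact: (oh_pos o pn').
- move=> p pn; have := oh_le o an; rewrite ha /= => l0.
  case: (P _ pn) => [e|e|[pn' pa]]; [by subst p; rewrite en /=; lia|by subst p; rewrite ea|].
  by rewrite ex //; exact: (oh_le o pn').
- move=> p pn; case: (P _ pn) => [e|e|[pn' pa]]; [by subst p; rewrite en|by subst p; rewrite ea|].
  by rewrite ex //; exact: (oh_oddN o pn').
- move=> p q pn; have := oh_oddN o an; rewrite ha /= => /(_ erefl) ol.
  case: (P _ pn) => [e|e|[pn' pa]].
  + by subst p; rewrite en /= => -[<-]; rewrite (minn_idPr _) //; lia.
  + by subst p; rewrite ea /= => -[<-]; rewrite (minn_idPl _) //; lia.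
  + by rewrite (ex p) //; exact: (oh_oddS o pn').
- move=> p q p' q' qp pp' pq' p'n; have pn : p < n by lia.
  have qn : q < n by lia.
  case: (P _ (leqW pn)) => [e|e|[_ pa]]; first by lia.
    subst p; rewrite ea /= => -[e] eq; exfalso; subst p'.
    case: (P _ (leqW qn)) eq => [e|e|[_ qa]]; first (by lia); first by subst q; rewrite ea => -[]; lia.
    by rewrite (ex q) // => eq; have := oh_lt o qn eq; lia.
  rewrite (ex p) // => ep; have p'n' := oh_lt o pn ep.
  case: (P _ (leqW qn)) => [e|e|[_ qa]]; first by lia.
    subst q; rewrite ea /= => _; have := oh_inc o qp pn (f_equal fst ha); by rewrite ha.
  by rewrite (ex q) // => eq; exact: (oh_nest o qp pp' pq' p'n' ep eq).
move=> p q qp pn; have qn : q < n by lia.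
case: (P _ (leqW qn)) => [e|e|[_ qa]]; [by lia|by subst q; rewrite ea|].
rewrite (ex q) // => eq.
have lq : (h q).2 < l.
  have [h1|h1] : a < q \/ q < a by move/eqP: qa; lia.
    by case: (np q h1 qn).
  by have := oh_inc o h1 an eq; rewrite ha.
case: (P _ pn) => [e|e|[pn' pa]]; [by subst p; rewrite en|by subst p; rewrite ea|].
by rewrite (ex p) //; exact: (oh_inc o qp pn' eq).
Qed.

Lemma ext2_restr n h a l : ohalf n h -> a < n -> h a = (None, l) -> eqh n (restr n (ext2 n h a l)) h.
Proof.
move=> o an ha p pn; rewrite /restr /ext2 ifF; last by apply/eqP; lia.
have [->|pa] := eqVneq p a; first by rewrite /= ltnn ha.
case E: (h p).1 => [q|]; last by rewrite -E -surjective_pairing.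
by rewrite (oh_lt o pn E) -E -surjective_pairing.
Qed.

Lemma rk_add S S' l p : (forall s, S s = S' s || (s == l)) -> ~~ S' l ->
  rk S p = rk S' p + (0 < l <= p).
Proof.
move=> e nl; elim: p => [|p IH]; first by rewrite !rk0; case: l {e nl}.
rewrite !rkS IH e.
have [e1|ne] := eqVneq p.+1 l; first by subst l; rewrite (negPf nl) /=; lia.
by rewrite orbF; lia.
Qed.

Lemma rk_const S p m : p <= m -> (forall s, p < s -> s <= m -> ~~ S s) -> rk S m = rk S p.
Proof.
move=> pm; elim: m pm => [|m IH] pm h; first by have -> : p = 0 by lia.
have [->//|pm'] : p = m.+1 \/ p <= m by lia.
rewrite rkS IH // ?(negPf (h m.+1 _ _)) ?addn0 //; try lia.
by move=> s ps sm; apply: h; lia.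
Qed.

Lemma fib_add n S S' l : fibP n S' -> (forall s, S s = S' s || (s == l)) ->
  (forall s, S' s -> s < l) -> 0 < l <= n.+1 -> odd l = odd n.+1 -> fibP n.+1 S.
Proof.
move=> f e lt l1 ol.
have nl : ~~ S' l by apply/negP => /lt; rewrite ltnn.
have ra p := rk_add p e nl.
have rc : rk S' l = rk S' n.
  have [h|h] : l <= n \/ l = n.+1 by lia.
    symmetry; apply: rk_const => // s ls sn; apply/negP => /lt; lia.
  by rewrite h rkS -h (negPf nl) addn0.
have nn : ~~ S' n.+1 by apply/negP => h; have := fib_in f h; lia.
split.
- by move=> s; rewrite e => /orP[h|/eqP->//]; have := fib_in f h; lia.
- move=> s; rewrite e => /orP[h|/eqP->]; rewrite ra.
    have := lt _ h; have := fib_odd f h; lia.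
  have := fib_tot f; rewrite rc; lia.
- by rewrite ra rkS (negPf nn); have := fib_tot f; lia.
Qed.

Lemma fib_rem n S S' l : fibP n S' -> (forall s, S' s = S s || (s == l)) ->
  (forall s, S s -> s < l) -> fibP n.+1 S.
Proof.
move=> f e lt.
have nl : ~~ S l by apply/negP => /lt; rewrite ltnn.
have ra p := rk_add p e nl.
have ss s : S s -> S' s by rewrite e => ->.
have ln : 0 < l <= n by apply: (fib_in f); rewrite e eqxx orbT.
have nn : ~~ S n.+1 by apply/negP => /ss h; have := fib_in f h; lia.
split.
- by move=> s /ss h; have := fib_in f h; lia.
- move=> s h; have := fib_odd f (ss _ h); rewrite ra; have := lt _ h; lia.
- by rewrite rkS (negPf nn); have := fib_tot f; rewrite ra; lia.
Qed.

(** Removing the last node adds or removes the largest label. *)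
Lemma ohalf_fib n h S : ohalf n h -> (forall s, S s <-> PL n h s) -> fibP n S.
Proof.
elim: n h S => [|n IH] h S o e.
  by split=> // s /e[].
have or := restr_ohalf o.
case hn: (h n) => [[a|] l].
  have [an ra ha PLr lt] := lastS o hn.
  apply: (@fib_rem _ _ (fun s => S s || (s == l)) l) => //; last by move=> s /e/lt.
  apply: IH or _ => s; split=> [/orP[/e h1|/eqP->]|/PLr[/e->//|->]].
  - by apply/PLr; left.
  - by apply/PLr; right.
  - by rewrite eqxx orbT.
have [PLr lt] := lastN o hn.
have nl : ~ PL n (restr n h) l by move/lt; rewrite ltnn.
apply: (@fib_add _ _ (fun s => S s && (s != l)) l).
- apply: IH or _ => s; split.
    by case/andP=> /e/PLr[//|->]; rewrite eqxx.
  move=> h1; apply/andP; split; first by apply/e/PLr; left.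
  by apply/eqP => e'; rewrite e' in h1.
- move=> s; have [->|] := eqVneq s l; rewrite ?andbT ?orbF // orbT.
  by apply/e/PLr; right.
- move=> s /andP[/e/PLr[/lt//|->]]; by rewrite eqxx.
- have := oh_pos o (leqnn n.+1); have := oh_le o (leqnn n.+1); rewrite hn /=; lia.
- by have := oh_oddN o (leqnn n.+1); rewrite hn /=; apply.
Qed.

End Restriction.

(** * Label sets and the covering relation *)

Section HalfBridge.
Local Open Scope nat_scope.
Implicit Types (f g : nat -> nat * nat) (h r : nat -> option nat * nat) (S T : {fset nat}).

(** [ph] and [mkh] translate half diagrams into functions on positions and back. *)
Definition ph N (H : prehalf N) (p : nat) : option nat * nat :=
  if insub p is Some i then (omap val (H i).1, val (H i).2) else (None, 0).

Definition mkh N h : prehalf N := [ffun i : 'I_N => (obind insub (h i).1, inord (h i).2)].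

Lemma phE N (H : prehalf N) (i : 'I_N) : ph H i = (omap val (H i).1, val (H i).2).
Proof. by rewrite /ph valK. Qed.

Lemma ph_mkh N h : ohalf N h -> eqh N (ph (mkh N h)) h.
Proof.
move=> o p pn; rewrite -[p]/(val (Ordinal pn)) phE ffunE /= inordK; last first.
  by have := oh_le o pn; lia.
rewrite [RHS]surjective_pairing; congr (_, _).
case e: (h p).1 => [q|] //=.
by rewrite insubT ?(oh_lt o pn e).
Qed.

Lemma ph_inj N (H H' : prehalf N) : eqh N (ph H) (ph H') -> H = H'.
Proof.
move=> e; apply/ffunP => i; have := e i (ltn_ord i); rewrite !phE => -[e1 e2].
rewrite (surjective_pairing (H i)) (surjective_pairing (H' i)); congr (_, _).
  by apply: (inj_omap (@ord_inj N)).
exact: val_inj.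
Qed.

Lemma eq_mkh N h r : eqh N h r -> mkh N h = mkh N r.
Proof. by move=> e; apply/ffunP => i; rewrite !ffunE e. Qed.

Lemma ph_left N (D : prediagram N) : good N (pf D) -> eqh N (ph (left_half D)) (hf N (pf D)).
Proof.
move=> g p pn; rewrite -[p]/(val (Ordinal pn)) phE ffunE /hf.
have := pfE D (inl (Ordinal pn)) => /= ->; congr (_, _).
by case: (mate D _) => j /=; rewrite ?ltn_ord // ifF //; apply/negP; have := ltn_ord j; lia.
Qed.

Lemma left_half_mk N f : good N f -> eqh N (ph (left_half (mk N f))) (hf N f).
Proof.
move=> g; have e := pf_mk g; have g' : good N (pf (mk N f)).
  case: g => -[l n i] le; split; first split.
  - by move=> p pN; rewrite e //; exact: l.
  - by move=> p pN; rewrite e //; exact: n.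
  - by move=> p pN; rewrite !e //; [exact: i|exact: l].
  - by move=> p pN; rewrite e //; exact: le.
apply: eqh_trans (ph_left g') _ => p pn; rewrite /hf e //; lia.
Qed.

Lemma mkh_left N f : wf N f -> left_half (mk N f) = mkh N (hf N f).
Proof.
move=> w; apply: ph_inj; apply: eqh_trans (left_half_mk (wf_good w)) _.
by apply: eqh_sym; apply: ph_mkh; exact: hf_ohalf.
Qed.

Lemma ohalf_eqh N h r : eqh N h r -> ohalf N h -> ohalf N r.
Proof.
move=> e o; split.
- by move=> p q pn; rewrite -e //; exact: (oh_lt o pn).
- by move=> p q pn; rewrite -e //; exact: (oh_neq o pn).
- move=> p q pn; rewrite -e // => h1; rewrite -e; first exact: (oh_inv o pn h1).
  exact: (oh_lt o pn h1).
- by move=> p q p' q' pq qn; rewrite -!e //; [exact: (oh_nc o pq qn)|lia].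
- by move=> p q p' pq qp' p'n; rewrite -!e //; [exact: (oh_cov o pq qp' p'n)|lia|lia].
- by move=> p pn; rewrite -e //; exact: (oh_pos o pn).
- by move=> p pn; rewrite -e //; exact: (oh_le o pn).
- by move=> p pn; rewrite -e //; exact: (oh_oddN o pn).
- by move=> p q pn; rewrite -e //; exact: (oh_oddS o pn).
- by move=> p q p' q' qp pp' pq' p'n; rewrite -!e //; [exact: (oh_nest o qp pp' pq' p'n)|lia|lia].
- by move=> p q qp pn; rewrite -!e //; [exact: (oh_inc o qp pn)|lia].
Qed.

Lemma is_halfP N (H : prehalf N) : is_half H <-> ohalf N (ph H).
Proof.
split.
  case/existsP => D /eqP <-.
  have w := pf_diagram D; have o := hf_ohalf w.
  have e := ph_left (wf_good w).
  exact: ohalf_eqh (eqh_sym e) o.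
move=> o; have sm : samep N (ph H) (ph H) by move=> s.
have w := com_wf o o sm.
apply/existsP; exists (exist (fun D => is_true (is_okada D)) _ (mk_okada w)) => /=; apply/eqP.
apply: ph_inj; apply: eqh_trans (left_half_mk (wf_good w)) _; exact: com_hf.
Qed.

Lemma ph_restr n (H : prehalf n.+1) : ohalf n.+1 (ph H) ->
  eqh n (ph (half_restr (leqnSn n) H)) (restr n (ph H)).
Proof.
move=> o p pn; rewrite -[p]/(val (Ordinal pn)) phE ffunE.
have := phE H (widen_ord (leqnSn n) (Ordinal pn)) => /=.
have := oh_le o (p := p) ltac:(lia).
rewrite /restr; case: (H _) => q l /= lp e; rewrite e /=; rewrite e /= in lp.
congr (_, _); last by rewrite inordK //; lia.
by case: q {e} => [q|] //=; case: insubP => [j qn <-|/negPf->] //=; rewrite ltn_ord.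
Qed.

Lemma prop_labelsP N (H : prehalf N) s : s \in prop_labels H <-> PL N (ph H) s.
Proof.
split.
  case/imfsetP => i /=; rewrite !inE => /isnone hi ->; exists i => //.
  by rewrite phE hi.
case=> p pn; rewrite -[p]/(val (Ordinal pn)) phE => -[h1 h2].
apply/imfsetP; exists (Ordinal pn) => //=; rewrite !inE.
by case: (H _).1 h1.
Qed.

Definition fset_weight S := \sum_(s <- enum_fset S) s.

Lemma weight_fset N h S : ohalf N h -> (forall s, s \in S <-> PL N h s) -> weight N h = fset_weight S.
Proof. by move=> o e; apply: weight_PL => //; exact: fset_uniq. Qed.

Lemma fset_seq_mem S : fset_seq S =i S.
Proof. by move=> s; rewrite mem_sort. Qed.
Lemma fset_seq_uniq S : uniq (fset_seq S).
Proof. by rewrite sort_uniq fset_uniq. Qed.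
Lemma fset_seq_size S : size (fset_seq S) = #|` S|.
Proof. by rewrite size_sort. Qed.
Lemma fset_seq_sorted S : sorted ltn (fset_seq S).
Proof.
by rewrite ltn_sorted_uniq_leq fset_seq_uniq sort_sorted //; exact: leq_total.
Qed.
Lemma fset_weight_seq S : fset_weight S = \sum_(s <- fset_seq S) s.
Proof. by apply: perm_big; rewrite perm_sym; apply/permPl; exact: perm_sort. Qed.

Lemma leq_sum_nth (s t : seq nat) : size s <= size t ->
  (forall i, i < size s -> nth 0 s i <= nth 0 t i) -> all (fun x => 0 < x) t ->
  \sum_(x <- s) x <= \sum_(x <- t) x /\ (\sum_(x <- s) x = \sum_(x <- t) x -> s = t).
Proof.
elim: s t => [|x s IH] [|y t] //=.
  move=> _ _ /andP[y0 _]; rewrite big_nil big_cons; split=> //; lia.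
rewrite ltnS => st h /andP[y0 t0]; rewrite !big_cons.
have [h1 h2] := IH t st (fun i => h i.+1) t0; have h3 := h 0 isT; rewrite /= in h3.
split; first by lia.
move=> e; have ex : x = y by lia.
have es : s = t by apply: h2; lia.
by rewrite ex es.
Qed.

(** Dominance compares the two sets term by term, starting from the largest elements. *)
Lemma dominance_weight S T : (forall s, s \in T -> 0 < s) -> dominance S T ->
  fset_weight S <= fset_weight T /\ (fset_weight S = fset_weight T -> S = T).
Proof.
move=> T0 /andP[kl /allP h].
have := @leq_sum_nth (rev (fset_seq S)) (rev (fset_seq T)).
rewrite !size_rev !fset_seq_size => /(_ kl).
have /[swap]/[apply] : forall i, i < #|` S| -> nth 0 (rev (fset_seq S)) i <= nth 0 (rev (fset_seq T)) i.
  move=> i iS; rewrite !nth_rev ?fset_seq_size //; last by lia.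
  by apply: h; rewrite mem_iota.
have a0 : all (fun x => 0 < x) (rev (fset_seq T)).
  by rewrite all_rev; apply/allP => x; rewrite fset_seq_mem; exact: T0.
move=> /(_ a0); rewrite !(perm_big _ (permEl (perm_rev _))) /= -!fset_weight_seq => -[h1 h2].
split=> // /h2 /(congr1 rev); rewrite !revK => e.
by apply/fsetP => x; rewrite -fset_seq_mem e fset_seq_mem.
Qed.

Lemma rk_count S p : (forall s, s \in S -> 0 < s) -> rk (mem S) p = count (fun s => s <= p) (fset_seq S).
Proof.
move=> S0; rewrite /rk -!size_filter; apply: perm_size; apply: uniq_perm.
- by rewrite filter_uniq // iota_uniq.
- by rewrite filter_uniq // fset_seq_uniq.
move=> x; rewrite !mem_filter mem_iota fset_seq_mem /= add1n ltnS.
by case xS: (x \in S); rewrite ?andbF //= S0 // andbT.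
Qed.

Lemma count_sorted (t : seq nat) i : sorted ltn t -> i < size t ->
  count (fun s => s <= nth 0 t i) t = i.+1.
Proof.
by move=> st it; have := Order.PreorderTheory.count_le_nth 0 (s := t) st it.
Qed.

Lemma fib_fibP n S : is_fibonacci n S <-> fibP n (mem S).
Proof.
have key : (forall s, s \in S -> 0 < s) -> forall i, i < #|` S| ->
    rk (mem S) (nth 0 (fset_seq S) i) = i.+1.
  by move=> S0 i iS; rewrite rk_count // count_sorted ?fset_seq_size //; exact: fset_seq_sorted.
have nthS i : i < #|` S| -> nth 0 (fset_seq S) i \in S.
  by move=> iS; rewrite -fset_seq_mem mem_nth // fset_seq_size.
have tot : (forall s, s \in S -> 0 < s <= n) -> rk (mem S) n = #|` S|.
  move=> h; rewrite rk_count; last by move=> s /h/andP[].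
  rewrite -fset_seq_size; apply/eqP; rewrite -all_count; apply/allP => s.
  by rewrite fset_seq_mem => /h/andP[].
split.
  case/and3P=> /allP h1 /eqP h2 /allP h3.
  have S0 s : s \in S -> 0 < s by move=> /h1/andP[].
  split; [exact: h1| |by rewrite tot].
  move=> s sS; have sS' : s \in fset_seq S by rewrite fset_seq_mem.
  have iS : index s (fset_seq S) < #|` S| by rewrite -fset_seq_size index_mem.
  have := h3 (index s (fset_seq S)); rewrite mem_iota nth_index // => /(_ iS)/eqP ->.
  by rewrite -(key S0 _ iS) nth_index.
case=> h1 h2 h3.
have S0 s : s \in S -> 0 < s by move=> /h1/andP[].
apply/and3P; split; first by apply/allP => s /h1.
  by rewrite -tot // h3.
apply/allP => i; rewrite mem_iota add0n => /andP[_ iS]; apply/eqP.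
by rewrite (h2 _ (nthS _ iS)) key.
Qed.

Lemma fset_max_ub S s : s \in S -> s <= fset_max S.
Proof. by move=> sS; rewrite /fset_max; rewrite (big_rem s) //= leq_maxl. Qed.

Lemma fset_max_eq S s : s \in S -> (forall t, t \in S -> t <= s) -> fset_max S = s.
Proof.
move=> sS h; apply/eqP; rewrite eqn_leq fset_max_ub // andbT.
by rewrite /fset_max big_seq_cond; apply/bigmax_leqP_seq => t; rewrite andbT => tS _; exact: h.
Qed.

Lemma fset_max_in S : S != fset0 -> fset_max S \in S.
Proof.
move=> /fset0Pn[s sS].
have [t tS tm] : exists2 t, t \in S & forall u, u \in S -> u <= t.
  pose P t := t \in S; have exP : exists t, P t by exists s.
  case: (ex_maxnP exP (fun t => @fset_max_ub S t)) => t tS tm; exists t => // u; exact: tm.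
by rewrite (fset_max_eq tS tm).
Qed.

Lemma coversP S T : fib_covers S T <->
  (exists2 l, l \notin T /\ S = (l |` T)%fset & forall s, s \in T -> s < l) \/
  (exists2 l, l \notin S /\ T = (l |` S)%fset & forall s, s \in S -> s < l).
Proof.
have aux A B : (A != fset0) && (B == A `\ fset_max A)%fset <->
    exists2 l, l \notin B /\ A = (l |` B)%fset & forall s, s \in B -> s < l.
  split.
    case/andP=> /fset_max_in m /eqP ->; exists (fset_max A).
      by rewrite !inE eqxx /= fsetD1K.
    move=> s; rewrite !inE => /andP[ne sA]; rewrite ltn_neqAle ne /=; exact: fset_max_ub.
  case=> l [lB ->] lt; have ml : fset_max (l |` B)%fset = l.
    apply: fset_max_eq; first by rewrite !inE eqxx.
    by move=> t; rewrite !inE => /orP[/eqP->//|/lt/ltnW].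
  rewrite ml; apply/andP; split; first by apply/fset0Pn; exists l; rewrite !inE eqxx.
  by rewrite fsetU1K.
rewrite /fib_covers; split.
  by case/orP=> /aux; [left|right].
by case=> /aux h; rewrite h ?orbT.
Qed.

Lemma restr_covers n h S T : ohalf n.+1 h -> (forall s, s \in T <-> PL n.+1 h s) ->
  (forall s, s \in S <-> PL n (restr n h) s) -> fib_covers S T.
Proof.
move=> o eT Ecan; apply/coversP.
case hn: (h n) => [[a|] l].
  have [an ra ha PLr lt] := lastS o hn; left; exists l; last by move=> s /eT/lt.
  split; first by apply/negP => /eT/lt; rewrite ltnn.
  apply/fsetP => s; rewrite !inE; apply/idP/orP.
    by move=> /Ecan/PLr[/eT|->]; [right|left].
  by case=> [/eqP->|/eT h1]; apply/Ecan/PLr; [right|left].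
have [PLr lt] := lastN o hn; right; exists l; last by move=> s /Ecan/lt.
split; first by apply/negP => /Ecan/lt; rewrite ltnn.
apply/fsetP => s; rewrite !inE; apply/idP/orP.
  by move=> /eT/PLr[/Ecan|->]; [right|left].
by case=> [/eqP->|/Ecan h1]; apply/eT/PLr; [right|left].
Qed.

(** Together with [restr_covers] and [restr_inj] this is the branching rule on bases: the half
    diagrams with labels T correspond to those whose label set is a predecessor of T. *)
Lemma covers_ext n h S T : ohalf n h -> (forall s, s \in S <-> PL n h s) -> fib_covers S T ->
  is_fibonacci n.+1 T ->
  exists h', [/\ ohalf n.+1 h', (forall s, s \in T <-> PL n.+1 h' s) & eqh n (restr n h') h].
Proof.
move=> o Ecan /coversP[[l [lT eST] lt]|[l [lS eTS] lt]] /fib_fibP fT.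
  have [a an ha] : PL n h l by apply/Ecan; rewrite eST !inE eqxx.
  have mx s : PL n h s -> s <= l.
    by move=> /Ecan; rewrite eST !inE => /orP[/eqP->//|/lt/ltnW].
  have o' := ext2_ohalf o an ha mx; have r' := ext2_restr o an ha.
  exists (ext2 n h a l); split=> // s.
  have hn : ext2 n h a l n = (Some a, l) by rewrite /ext2 eqxx.
  have [_ _ _ PLr lt'] := lastS o' hn.
  have eP t : PL n h t <-> PL n (restr n (ext2 n h a l)) t by split=> /(eqh_samep r').
  split.
    move=> sT; have : PL n h s by apply/Ecan; rewrite eST !inE sT orbT.
    move=> /eP/PLr[//|e]; by rewrite e (negPf lT) in sT.
  move=> h1; have : PL n h s by apply/eP/PLr; left.
  move=> /Ecan; rewrite eST !inE => /orP[/eqP e|//].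
  by have := lt' _ h1; rewrite e ltnn.
have lT : l \in T by rewrite eTS !inE eqxx.
have l1 := fib_in fT lT; have l2 := fib_odd fT lT; have l3 := fib_tot fT.
have rl : rk (mem T) n.+1 = rk (mem T) l.
  apply: rk_const; first by lia.
  move=> s ls sn; apply/negP => /=; rewrite eTS !inE => /orP[/eqP e|/lt]; lia.
have ol : odd l = odd n.+1 by rewrite l2 -rl.
have lt0 s : PL n h s -> s < l by move=> /Ecan/lt.
have o' := ext1_ohalf o lt0 l1 ol.
have r' := ext1_restr l o.
exists (ext1 n h l); split=> // s.
have hn : ext1 n h l n = (None, l) by rewrite /ext1 eqxx.
have [PLr _] := lastN o' hn.
have eP t : PL n h t <-> PL n (restr n (ext1 n h l)) t by split=> /(eqh_samep r').
rewrite eTS !inE; split.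
  by case/orP=> [/eqP->|/Ecan/eP h1]; apply/PLr; [right|left].
by move=> /PLr[/eP/Ecan->|->]; rewrite ?eqxx ?orbT.
Qed.

End HalfBridge.

(** * Coordinates in the cell modules *)

Section Cell.
Local Open Scope ring_scope.
Variables (K : fieldType) (X Y : nat -> K) (n : nat) (S : fibset n) (V : cell_module X Y S).
Implicit Types (f g : nat -> nat * nat) (H : half_diagram S) (v w : V).

Local Notation vec := (cell_vec V).

Definition cellc v : {ffun half_diagram S -> K} := sval (cid (cell_basis v)).

Lemma cellcE v : v = \sum_H (cellc v H)%:A *: vec (val H).
Proof. by rewrite /cellc; case: cid => c /= []. Qed.

Lemma cellc_uniq v (c : {ffun half_diagram S -> K}) :
  v = \sum_H (c H)%:A *: vec (val H) -> cellc v = c.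
Proof. by rewrite /cellc; case: cid => d /= [_ +] e; apply. Qed.

Lemma cellcD v w H : cellc (v + w) H = cellc v H + cellc w H.
Proof.
have -> : cellc (v + w) = [ffun H => cellc v H + cellc w H]; last by rewrite ffunE.
apply: cellc_uniq; rewrite {1}(cellcE v) {1}(cellcE w) -big_split /=.
by apply: eq_bigr => H' _; rewrite ffunE scalerDl scalerDl.
Qed.

Lemma cellcZ (k : K) v H : cellc (k%:A *: v) H = k * cellc v H.
Proof.
have -> : cellc (k%:A *: v) = [ffun H => k * cellc v H]; last by rewrite ffunE.
apply: cellc_uniq; rewrite {1}(cellcE v) scaler_sumr.
by apply: eq_bigr => H' _; rewrite ffunE scalerA mulr_algl scalerA.
Qed.

Lemma cellc0 H : cellc 0 H = 0.
Proof. by rewrite -[0 : V](scale0r 0) -(scale0r 1) cellcZ mul0r. Qed.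

Lemma cellc_sum (I : Type) (s : seq I) (P : pred I) (F : I -> V) H :
  cellc (\sum_(i <- s | P i) F i) H = \sum_(i <- s | P i) cellc (F i) H.
Proof.
elim: s => [|i s IH]; first by rewrite !big_nil cellc0.
by rewrite !big_cons; case: (P i); rewrite ?cellcD IH.
Qed.

Lemma cellc_vec H H' : cellc (vec (val H)) H' = (H == H')%:R.
Proof.
have -> : cellc (vec (val H)) = [ffun H' => (H == H')%:R]; last by rewrite ffunE.
apply: cellc_uniq; rewrite (bigD1 H) //= ffunE eqxx scale1r scale1r big1 ?addr0 // => H2 ne.
by rewrite ffunE eq_sym (negPf ne) scale0r scale0r.
Qed.

Lemma cellc_inj v w : (forall H, cellc v H = cellc w H) -> v = w.
Proof. by move=> e; rewrite (cellcE v) (cellcE w); apply: eq_bigr => H _; rewrite e. Qed.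

Lemma vec_neq0 H : vec (val H) != 0.
Proof.
apply/eqP => e; have := cellc_vec H H; rewrite e cellc0 eqxx => /eqP.
by rewrite eq_sym oner_eq0.
Qed.

Definition lh f : prehalf n := left_half (mk n f).
Definition okS f : bool := prop_labels (lh f) == val S.

Lemma lh_ph f : wf n f -> eqh n (ph (lh f)) (hf n f).
Proof. by move=> w; exact: left_half_mk (wf_good w). Qed.

Lemma lh_eqa f g : eqa n f g -> lh f = lh g.
Proof. by move=> e; rewrite /lh (eq_mk e). Qed.

Lemma okSP f : wf n f -> reflect (forall s, s \in val S <-> PL n (hf n f) s) (okS f).
Proof.
move=> w; have e := eqh_samep (lh_ph w).
apply: (iffP eqP) => [<- s|h]; first by rewrite prop_labelsP; exact: e.
apply/fsetP => s; apply/idP/idP; first by move=> /prop_labelsP/e/h.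
by move=> /h/e/prop_labelsP.
Qed.

Lemma okS_half f : wf n f -> okS f -> is_half (lh f) && (prop_labels (lh f) == val S).
Proof.
move=> w ok; rewrite -/(okS f) ok andbT; apply/existsP.
by exists (exist (fun D => is_true (is_okada D)) _ (mk_okada w)).
Qed.

Lemma halfW H : exists2 f, wf n f & val H = lh f /\ okS f.
Proof.
have /andP[/existsP[D /eqP eD] pl] := valP H.
exists (pf (val D)); first exact: pf_diagram.
by rewrite /okS /lh mk_pf eD.
Qed.

Lemma okS_weight f : wf n f -> okS f -> weight n (hf n f) = fset_weight (val S).
Proof. by move=> w /(okSP w) e; apply: weight_fset (hf_ohalf w) e. Qed.

Lemma cell_gen i f : (0 < i < n)%N -> wf n f -> okS f ->
  okada_gen X Y n i *: vec (lh f) =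
  if okS (lact i f) then (okada_lambda X Y (diagram_gen n i) (mk n f))%:A *: vec (lh (lact i f)) else 0.
Proof.
move=> iN w ok.
have gw : wf n (lact i (idf n)) by apply: lact_wf => //; exact: idf_wf.
have gok : is_okada (diagram_gen n i) by rewrite diagram_genE //; exact: mk_okada.
pose C : diagram n := exist (fun D => is_true (is_okada D)) _ gok.
pose D : diagram n := exist (fun D => is_true (is_okada D)) _ (mk_okada w).
have := @cell_act _ _ _ _ _ V C D (eqP ok); rewrite /= Ed_gen //.
have e := pf_mk (wf_good w).
rewrite diagram_mul_gen //; last exact: wf_good (wf_eqa (eqa_sym e) w).
have -> : mk n (lact i (pf (mk n f))) = mk n (lact i f) by apply: eq_mk; apply: lact_eqa.
by [].
Qed.

Lemma cell_word (w : seq nat) f : letters n w -> wf n f -> okS f ->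
  exists k : K, Ew X Y n w *: vec (lh f) = k%:A *: vec (lh (La w f)) /\ (k != 0 -> okS (La w f)).
Proof.
move=> + wff ok; elim: w => [|i w IH] /=.
  by move=> _; exists 1; rewrite Ew0 !scale1r.
case/andP=> iN lw; have [k [e h]] := IH lw.
rewrite Ew_cons -scalerA e.
have [k0|k0] := eqVneq k 0.
  by exists 0; rewrite k0 !scale0r scaler0 eqxx.
have gC : okada_gen X Y n i * k%:A = k%:A * okada_gen X Y n i by rewrite mulr_algl mulr_algr.
rewrite scalerA gC -scalerA cell_gen ?h //; last exact: wf_La.
case: ifP => ok'.
  exists (k * okada_lambda X Y (diagram_gen n i) (mk n (La w f))); split=> //.
  by rewrite scalerA mulr_algl scalerA.
by exists 0; rewrite scaler0 !scale0r eqxx.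
Qed.

End Cell.

(** * The filtration of the restricted module *)

Section ModIso.
Local Open Scope ring_scope.

Lemma bij_iso (R : nzRingType) (M N : lmodType R) (f : M -> N) :
  (forall x y, f (x + y) = f x + f y) -> (forall a x, f (a *: x) = a *: f x) ->
  injective f -> (forall y, exists x, f x = y) -> mod_iso M N.
Proof.
move=> fD fZ inj fS.
have zm : zmod_morphism f.
  by move=> p q; apply/eqP; rewrite eq_sym subr_eq -fD subrK.
pose L : {linear M -> N} := HB.pack f
  (GRing.isZmodMorphism.Build _ _ f zm) (GRing.isScalable.Build R M N *:%R f fZ).
exists L; exists (fun y => sval (cid (fS y))) => [x|y] /=; last by case: cid.
by apply: inj; case: cid.
Qed.

Lemma kernel0_inj (U W : zmodType) (f : U -> W) :
  (forall x y, f (x + y) = f x + f y) -> (forall x, f x = 0 -> x = 0) -> injective f.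
Proof.
move=> fD f0 x y e; apply/eqP; rewrite -subr_eq0; apply/eqP/f0/(addIr (f y)).
by rewrite -fD subrK add0r.
Qed.

Lemma mod_iso_sym (R : nzRingType) (M N : lmodType R) : mod_iso M N -> mod_iso N M.
Proof.
move=> [f [g fg gf]].
have fi := can_inj fg.
apply: (@bij_iso _ _ _ g).
- by move=> x y; apply: fi; rewrite linearD !gf.
- by move=> a x; apply: fi; rewrite linearZ /= !gf.
- exact: can_inj gf.
by move=> y; exists (f y).
Qed.

End ModIso.

Section SubquotIso.
Local Open Scope ring_scope.
Variables (R : nzRingType) (M N : lmodType R) (U W : submodClosed M) (phi : M -> N).
Hypothesis phiD : forall v w, phi (v + w) = phi v + phi w.
Hypothesis phiZ : forall a v, v \in U -> phi (a *: v) = a *: phi v.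
Hypothesis phiK : forall v, v \in U -> phi v = 0 <-> v \in W.
Hypothesis phiS : forall x, exists2 v, v \in U & phi v = x.

Let phiB v w : phi (v - w) = phi v - phi w.
Proof. by apply/eqP; rewrite eq_sym subr_eq -phiD subrK. Qed.

Local Notation Q := (subquot U W).

Definition subquot_fun (q : Q) : N := phi (val (generic_quotient.repr q : submod U)).

Lemma subquot_pi (v : submod U) : subquot_fun (\pi_Q v)%qT = phi (val v).
Proof.
apply/eqP; rewrite -subr_eq0 -phiB; apply/eqP.
rewrite /subquot_fun; set r := generic_quotient.repr _.
have : r - v \in submod_zmod (@in_sub R M U W : submodClosed (submod U)).
  by rewrite Quotient.idealrBE /r reprK.
move=> h; apply/phiK; last exact: h.
by have [_ cl] := submod_zmod_closed U; apply: cl; exact: valP.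
Qed.

Lemma subquot_ind (P : Q -> Prop) : (forall v : submod U, P (\pi_Q v)%qT) -> forall q, P q.
Proof. by move=> h q; rewrite -[q]reprK. Qed.

Lemma subquot_funD : {morph subquot_fun : p q / p + q}.
Proof.
elim/subquot_ind => v; elim/subquot_ind => w.
have := @pi_quotD R (submod U) (@in_sub R M U W : submodClosed (submod U)) v w.
by move=> /esym ->; rewrite !subquot_pi phiD.
Qed.

Lemma subquot_funZ : scalable subquot_fun.
Proof.
move=> a; elim/subquot_ind => v.
have := @quot_scale_pi R (submod U) (@in_sub R M U W : submodClosed (submod U)) a v.
by move=> e; rewrite [a *: _]e !subquot_pi phiZ //; exact: valP.
Qed.

(** The first isomorphism theorem for an additive map that is only linear on [U], as happens
    for the projections onto the layers. *)
Lemma subquot_iso : mod_iso Q N.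
Proof.
apply: (bij_iso subquot_funD subquot_funZ).
  elim/subquot_ind => v; elim/subquot_ind => w; rewrite !subquot_pi => e.
  apply/eqP; rewrite -Quotient.idealrBE.
  have h : phi (val v - val w) = 0 by rewrite phiB e subrr.
  have vU : val v - val w \in U.
    by have [_ cl] := submod_zmod_closed U; apply: cl; exact: valP.
  exact: (iffLR (phiK vU) h).
move=> x; have [v vU <-] := phiS x; exists (\pi_Q (Sub v vU : submod U))%qT.
by rewrite subquot_pi SubK.
Qed.

End SubquotIso.

Section Filtration.
Local Open Scope ring_scope.
Variables (K : fieldType) (X Y : nat -> K) (n : nat) (T : fibset n.+1) (k : nat).
Variables (S : 'I_k -> fibset n) (VT : cell_module X Y T) (V : forall U : fibset n, cell_module X Y U).
Hypothesis S_incr : forall i j : 'I_k, (i < j)%N -> (S i != S j) && dominance (val (S i)) (val (S j)).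
Hypothesis S_pred : forall U : fibset n, fib_covers (val U) (val T) <-> exists i, S i = U.
Implicit Types (f g : nat -> nat * nat) (H : half_diagram T) (v w : VT) (i j : 'I_k).

Lemma fibset_pos m (U : fibset m) s : s \in val U -> (0 < s)%N.
Proof. by move=> sU; have /fib_fibP fU := valP U; have /andP[] := fib_in fU sU. Qed.

Lemma S_weight i j : (i < j)%N -> (fset_weight (val (S i)) < fset_weight (val (S j)))%N.
Proof.
move=> ij; have /andP[ne d] := S_incr ij.
have [h1 h2] := dominance_weight (@fibset_pos _ _) d.
rewrite ltn_neqAle h1 andbT; apply: contra_neq ne => /h2 e; exact: val_inj.
Qed.

Lemma S_weight_le i j : (fset_weight (val (S i)) <= fset_weight (val (S j)))%N -> (i <= j)%N.
Proof. by rewrite leqNgt => h; rewrite leqNgt; apply: contra h; exact: S_weight. Qed.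

Lemma S_inj i j : val (S i) = val (S j) -> i = j.
Proof.
move=> e; apply: val_inj; apply/eqP; rewrite eqn_leq.
by rewrite !S_weight_le ?e.
Qed.

Lemma dominance_refl (A : {fset nat}) : dominance A A.
Proof. by rewrite /dominance leqnn; apply/allP. Qed.

Lemma S_dom i j : dominance (val (S i)) (val (S j)) = (i <= j)%N.
Proof.
apply/idP/idP.
  by move=> /(dominance_weight (@fibset_pos _ _))[h _]; exact: S_weight_le.
rewrite leq_eqVlt => /orP[/eqP/val_inj->|/S_incr/andP[//]]; exact: dominance_refl.
Qed.

Definition restrH (H : prehalf n.+1) : prehalf n := half_restr (leqnSn n) H.

Lemma restrH_lh f c : (c <= n)%N -> wf n f -> restrH (lh n.+1 (ins n c f)) = lh n f.
Proof.
move=> cn w; have w' := ins_wf cn w.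
have cast m h r : eqh m h r -> forall p, (p < m)%N -> r p = h p by move=> e p pm; rewrite e.
have eL := lh_ph w'.
have o : ohalf n.+1 (ph (lh n.+1 (ins n c f))).
  apply/is_halfP; apply/existsP.
  by exists (exist (fun D => is_true (is_okada D)) _ (mk_okada w')).
apply: ph_inj; apply: eqh_trans (ph_restr o) _.
apply: eqh_trans (eqh_sym (lh_ph w)).
apply: eqh_trans (restr_ins w cn) => p pn.
by rewrite /restr eL //; lia.
Qed.

Lemma halfT H : exists f c, [/\ wf n f, (c <= n)%N, val H = lh n.+1 (ins n c f), okS T (ins n c f)
  & restrH (val H) = lh n f].
Proof.
have [F w [eH ok]] := halfW H.
have [c [cn f0 f1 top]] := wf_top w.
have wd := del_wf cn f0 f1 top w; have ed := ins_del cn f0 f1 w.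
have eL := lh_eqa ed.
exists (del n c F), c; split=> //; first by rewrite eH eL.
  by rewrite /okS -eL.
by rewrite eH eL restrH_lh.
Qed.

Lemma idx_ex H : exists i, prop_labels (restrH (val H)) = val (S i).
Proof.
have [f [c [w cn eH ok er]]] := halfT H.
have w' := ins_wf cn w.
have o' := hf_ohalf w'; have o := hf_ohalf w.
have eT := okSP _ w' ok.
have Ecan s : s \in prop_labels (restrH (val H)) <-> PL n (hf n f) s.
  by rewrite er prop_labelsP; exact: (eqh_samep (lh_ph w)).
have fib : is_fibonacci n (prop_labels (restrH (val H))) by apply/fib_fibP; exact: ohalf_fib o Ecan.
have cov : fib_covers (prop_labels (restrH (val H))) (val T).
  apply: restr_covers o' eT _ => s; rewrite Ecan.
  exact: (samep_sym (eqh_samep (restr_ins w cn))).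
have [i ei] := iffLR (S_pred (exist (fun A => is_true (is_fibonacci n A)) _ fib)) cov.
by exists i; rewrite ei.
Qed.

Definition idx H : 'I_k := sval (cid (idx_ex H)).
Lemma idxP H : prop_labels (restrH (val H)) = val (S (idx H)).
Proof. by rewrite /idx; case: cid. Qed.

Lemma idx_eq H i : prop_labels (restrH (val H)) = val (S i) -> idx H = i.
Proof. by rewrite idxP => /S_inj. Qed.

(** The projection along the basis vectors of the other layers. It commutes with the smaller
    algebra only on the i-th step of the filtration, see [okada_layer]. *)
Definition layer_pr i (v : VT) : V (S i) :=
  \sum_H (cellc v H)%:A *: (if idx H == i then cell_vec (V (S i)) (restrH (val H)) else 0).

Lemma prD i v w : layer_pr i (v + w) = layer_pr i v + layer_pr i w.
Proof.
rewrite /layer_pr -big_split; apply: eq_bigr => H _.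
by rewrite cellcD scalerDl scalerDl.
Qed.

Lemma prZ i (a : K) v : layer_pr i (a%:A *: v) = a%:A *: layer_pr i v.
Proof.
rewrite /layer_pr scaler_sumr; apply: eq_bigr => H _.
by rewrite cellcZ scalerA mulr_algl scalerA.
Qed.

Lemma pr0 i : layer_pr i 0 = 0.
Proof. by rewrite /layer_pr big1 // => H _; rewrite cellc0 !scale0r. Qed.

Lemma pr_sum i (I : Type) (s : seq I) (P : pred I) (F : I -> VT) :
  layer_pr i (\sum_(x <- s | P x) F x) = \sum_(x <- s | P x) layer_pr i (F x).
Proof.
elim: s => [|x s IH]; first by rewrite !big_nil pr0.
by rewrite !big_cons; case: (P x); rewrite ?prD IH.
Qed.

Lemma pr_vec i H : layer_pr i (cell_vec VT (val H)) =
  if idx H == i then cell_vec (V (S i)) (restrH (val H)) else 0.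
Proof.
rewrite /layer_pr (bigD1 H) //= cellc_vec eqxx !scale1r big1 ?addr0 // => H' ne.
by rewrite cellc_vec eq_sym (negPf ne) !scale0r.
Qed.

(** The span of the vectors |H> whose restriction belongs to one of the first [m] predecessors. *)
Definition filt (m : nat) : {pred VT} :=
  fun v => [forall H, (cellc v H != 0) ==> (idx H < m)%N].

Lemma filtP m v : reflect (forall H, cellc v H != 0 -> (idx H < m)%N) (filt m v).
Proof. by apply: (iffP forallP) => h H; [move/implyP: (h H)|apply/implyP/h]. Qed.

Lemma filt_le m m' v : (m <= m')%N -> filt m v -> filt m' v.
Proof. by move=> le /filtP h; apply/filtP => H /h; lia. Qed.

Lemma filt0 m : filt m 0.
Proof. by apply/filtP => H; rewrite cellc0 eqxx. Qed.

Lemma filtD m v w : filt m v -> filt m w -> filt m (v + w).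
Proof.
move=> /filtP hv /filtP hw; apply/filtP => H; rewrite cellcD.
have [->|nv] := eqVneq (cellc v H) 0; last by move=> _; exact: hv.
by rewrite add0r; exact: hw.
Qed.

Lemma filtZ m (a : K) v : filt m v -> filt m (a%:A *: v).
Proof.
move=> /filtP hv; apply/filtP => H; rewrite cellcZ mulf_eq0 negb_or => /andP[_]; exact: hv.
Qed.

Lemma filt_sum m (I : Type) (s : seq I) (P : pred I) (F : I -> VT) :
  (forall x, P x -> filt m (F x)) -> filt m (\sum_(x <- s | P x) F x).
Proof. by move=> h; elim/big_ind: _ => //; [exact: filt0|exact: filtD]. Qed.

Lemma filt_vec m H : (idx H < m)%N -> filt m (cell_vec VT (val H)).
Proof.
by move=> h; apply/filtP => H'; rewrite cellc_vec; case: (H =P H') => [<-//|_]; rewrite mulr0n eqxx.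
Qed.

Lemma filt_top v : filt k v.
Proof. by apply/filtP => H _; exact: ltn_ord. Qed.

(** If |H> comes from the insertion of an arc into f, then H/[n] is the left half of f ([restrH_lh]),
    and the generator acts on f before the insertion, with the same scalar. What remains is to
    compare the tests for the propagating labels, in rank n + 1 and in rank n. *)
Lemma gen_vec a H : (0 < a < n)%N ->
  let v := okada_gen X Y n.+1 a *: cell_vec VT (val H) in
  filt (idx H).+1 v /\
  forall i, (idx H <= i)%N -> layer_pr i v = okada_gen X Y n a *: layer_pr i (cell_vec VT (val H)).
Proof.
move=> aN /=; have aN' : (0 < a < n.+1)%N by lia.
have [f [c [w cn eH ok er]]] := halfT H.
have w' := ins_wf cn w; have wa := lact_wf aN w; have wa' := lact_wf aN' w'.
have wia := ins_wf cn wa.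
have eL : eqa n.+1 (lact a (ins n c f)) (ins n c (lact a f)) by move=> x _; exact: lact_ins.
have okr : okS (S (idx H)) f by apply/eqP; rewrite -er idxP.
have wle := lact_weight aN w.
have key : (idx H <= idx H)%N by [].
rewrite eH cell_gen // (lh_eqa eL) lambda_ins //.
rewrite /okS (lh_eqa eL) -/(okS T _).
set lam := okada_lambda _ _ _ _.
have PR i : layer_pr i (cell_vec VT (lh n.+1 (ins n c f))) =
    if idx H == i then cell_vec (V (S i)) (lh n f) else 0.
  by rewrite -eH pr_vec er.
(* if the restriction keeps its labels, the weight is kept, so the right half is unchanged *)
have tst : okS (S (idx H)) (lact a f) -> okS T (ins n c (lact a f)).
  move=> oka; have wt : weight n (hf n (lact a f)) = weight n (hf n f).
    by rewrite (okS_weight wa oka) (okS_weight w okr).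
  have [_ er2] := lact_half aN w w (fun p _ => erefl) wt.
  have sp := ins_PL wa w cn er2.
  apply/(okSP _ wia) => s; rewrite (okSP _ w' ok s).
  exact: samep_sym sp s.
case: ifP => okT; last first.
  split; first exact: filt0.
  move=> i hi; rewrite pr0 PR; case: eqP => [e|]; last by rewrite scaler0.
  subst i; rewrite cell_gen //; case: ifP => // /tst; by rewrite okT.
pose H2 : half_diagram T := exist (fun Q => is_true (is_half Q && (prop_labels Q == val T))) _ (okS_half wia okT).
have r2 : restrH (val H2) = lh n (lact a f) by rewrite /= restrH_lh.
have ok2 : okS (S (idx H2)) (lact a f) by apply/eqP; rewrite -/(lh _ _) -r2 idxP.
have le2 : (idx H2 <= idx H)%N.
  by apply: S_weight_le; rewrite -(okS_weight wa ok2) -(okS_weight w okr).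
split; first by apply: filtZ; apply: (filt_vec (H := H2)).
move=> i hi; rewrite prZ -[lh n.+1 _]/(val H2) pr_vec PR r2.
case: eqP => [e|ne].
  have ei : idx H = i by apply: val_inj; apply/eqP; rewrite eqn_leq hi -e le2.
  have ok3 : okS (S (idx H)) (lact a f) by rewrite -[idx H]/(idx H) ei -e.
  clear e; subst i; by rewrite eqxx cell_gen // ok3.
rewrite scaler0; case: eqP => [e|_]; last by rewrite scaler0.
subst i; rewrite cell_gen //; case: ifP => // ok3; case: ne.
by apply: S_inj; rewrite -(eqP ok2) -(eqP ok3).
Qed.

End Filtration.

(** * The layers of the filtration *)

Section Layers.
Local Open Scope ring_scope.
Variables (K : fieldType) (X Y : nat -> K) (n : nat) (T : fibset n.+1) (k : nat).
Variables (S : 'I_k -> fibset n) (VT : cell_module X Y T) (V : forall U : fibset n, cell_module X Y U).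
Hypothesis S_incr : forall i j : 'I_k, (i < j)%N -> (S i != S j) && dominance (val (S i)) (val (S j)).
Hypothesis S_pred : forall U : fibset n, fib_covers (val U) (val T) <-> exists i, S i = U.
Implicit Types (f g : nat -> nat * nat) (H : half_diagram T) (v w : VT) (i j : 'I_k).

Local Notation idx := (idx S_pred).
Local Notation pr := (layer_pr V S_pred).
Local Notation filt := (filt (VT := VT) S_pred).
Local Notation res := (resmod (okada_incl X Y n) VT).
Local Notation incl := (okada_incl X Y n).

Lemma gen_layer a m v : (0 < a < n)%N -> filt m v ->
  filt m (okada_gen X Y n.+1 a *: v) /\
  forall i, (m <= i.+1)%N -> pr i (okada_gen X Y n.+1 a *: v) = okada_gen X Y n a *: pr i v.
Proof.
move=> aN /filtP hv.
have e : okada_gen X Y n.+1 a *: v =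
   \sum_H (cellc v H)%:A *: (okada_gen X Y n.+1 a *: cell_vec VT (val H)).
  rewrite {1}(cellcE v) scaler_sumr; apply: eq_bigr => H _.
  by rewrite !scalerA mulr_algl mulr_algr.
split.
  rewrite e; apply: filt_sum => H _; have [->|nz] := eqVneq (cellc v H) 0.
    by rewrite !scale0r; exact: filt0.
  apply: filtZ; apply: filt_le (hv _ nz) _; by have [] := gen_vec VT V S_incr S_pred H aN.
move=> i mi; rewrite e pr_sum {2}(cellcE v) pr_sum scaler_sumr; apply: eq_bigr => H _.
have [->|nz] := eqVneq (cellc v H) 0.
  by rewrite !scale0r !pr0 scaler0.
have [_ h] := gen_vec VT V S_incr S_pred H aN.
rewrite !prZ h ?scalerA ?mulr_algl ?mulr_algr //.
by have := hv _ nz; lia.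
Qed.

(** Both claims pass from generators to products because the algebra preserves the step. *)
Lemma okada_layer (p : okada X Y n) m v : filt m v ->
  filt m (incl p *: v) /\ forall i, (m <= i.+1)%N -> pr i (incl p *: v) = p *: pr i v.
Proof.
move: p v; elim/okada_gen_ind => [c|a aN|p q hp hq|p q hp hq] v Fv.
- by rewrite incl_scale rmorph1; split=> [|i _]; [exact: filtZ|rewrite prZ].
- by rewrite incl_gen //; exact: gen_layer.
- rewrite rmorphD /= scalerDl; have [h1 h2] := hp v Fv; have [h3 h4] := hq v Fv.
  by split=> [|i mi]; [exact: filtD|rewrite prD h2 // h4 // scalerDl].
rewrite rmorphM /= -scalerA; have [h3 h4] := hq v Fv; have [h1 h2] := hp _ h3.
by split=> [//|i mi]; rewrite h2 // h4 // scalerA.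
Qed.

Lemma filt_closed m : subsemimod_closed (filt m : {pred res}).
Proof.
split; first split; [exact: filt0|exact: filtD|].
by move=> p v Fv; have [] := okada_layer p Fv.
Qed.

Definition filt_submod m : submodClosed res :=
  HB.pack (filt m : {pred res}) (GRing.isSubSemiModClosed.Build _ res (filt m : {pred res}) (filt_closed m)).

Lemma filt_submodE m v : (v \in filt_submod m) = filt m v.
Proof. by []. Qed.

Lemma restrH_half H i : idx H = i -> is_half (restrH (val H)) && (prop_labels (restrH (val H)) == val (S i)).
Proof.
move=> e; have [f [c [w _ _ _ er]]] := halfT H.
have ok : okS (S (idx H)) f by apply/eqP; rewrite -er (idxP S_pred).
by rewrite -e er; exact: okS_half.
Qed.

Lemma half_ohalf m (U : fibset m) (H : half_diagram U) : ohalf m (ph (val H)).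
Proof. by have /andP[/is_halfP] := valP H. Qed.

Lemma half_PL m (U : fibset m) (H : half_diagram U) s : PL m (ph (val H)) s <-> s \in val U.
Proof. by have /andP[_ /eqP e] := valP H; rewrite -prop_labelsP e. Qed.

Lemma ohalf_half m (U : fibset m) h : ohalf m h -> (forall s, s \in val U <-> PL m h s) ->
  is_half (mkh m h) && (prop_labels (mkh m h) == val U).
Proof.
move=> o e; have em := ph_mkh o.
apply/andP; split; first by apply/is_halfP; exact: ohalf_eqh (eqh_sym em) o.
apply/eqP/fsetP => s; apply/idP/idP.
  by move=> /prop_labelsP/(eqh_samep em)/e.
by move=> /e/(eqh_samep em)/prop_labelsP.
Qed.

Lemma restrH_inj H H' : restrH (val H) = restrH (val H') -> H = H'.
Proof.
move=> e; apply: val_inj; apply: ph_inj.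
apply: restr_inj; [exact: half_ohalf|exact: half_ohalf| |].
  apply: eqh_trans (eqh_sym (ph_restr (half_ohalf H))) _.
  by apply: eqh_trans _ (ph_restr (half_ohalf H')); rewrite -/(restrH _) e.
by move=> s; rewrite !half_PL.
Qed.

Lemma half_lift i (h : nat -> option nat * nat) : ohalf n h ->
  (forall s, s \in val (S i) <-> PL n h s) ->
  exists H, idx H = i /\ eqh n (ph (restrH (val H))) h.
Proof.
move=> o e; have cov : fib_covers (val (S i)) (val T) by apply/S_pred; exists i.
have [h' [o' e' r']] := covers_ext o e cov (valP T).
pose H : half_diagram T := exist (fun Q => is_true (is_half Q && (prop_labels Q == val T))) _ (ohalf_half o' e').
have er : eqh n (ph (restrH (val H))) h.
  apply: eqh_trans (ph_restr (half_ohalf H)) _; apply: eqh_trans r' => p pn.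
  by rewrite /restr ph_mkh //; lia.
exists H; split=> //; apply: (idx_eq S_incr); apply/fsetP => s; apply/idP/idP.
  by move=> /prop_labelsP/(eqh_samep er)/e.
by move=> /e/(eqh_samep er)/prop_labelsP.
Qed.

Lemma restrH_onto i (H' : half_diagram (S i)) : exists H, idx H = i /\ restrH (val H) = val H'.
Proof.
have [s|H [e r]] := half_lift (i := i) (half_ohalf H'); first by rewrite half_PL.
by exists H; split=> //; exact: ph_inj.
Qed.

Definition liftH i (H' : half_diagram (S i)) := sval (cid (restrH_onto H')).

Lemma idx_liftH i (H' : half_diagram (S i)) : idx (liftH H') = i.
Proof. by rewrite /liftH; case: cid => H []. Qed.
Lemma restrH_liftH i (H' : half_diagram (S i)) : restrH (val (liftH H')) = val H'.
Proof. by rewrite /liftH; case: cid => H []. Qed.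

Lemma pr_onto i (x : V (S i)) : exists2 v, filt i.+1 v & pr i v = x.
Proof.
exists (\sum_H' (cellc x H')%:A *: cell_vec VT (val (liftH H'))).
  by apply: filt_sum => H' _; apply: filtZ; apply: filt_vec; rewrite idx_liftH.
rewrite pr_sum [RHS]cellcE; apply: eq_bigr => H' _.
by rewrite prZ pr_vec idx_liftH eqxx restrH_liftH.
Qed.

(** On the i-th layer, different half diagrams have different restrictions ([restrH_inj]), so
    the coordinates can be read off the image. *)
Lemma pr_ker i v : filt i.+1 v -> pr i v = 0 <-> filt i v.
Proof.
move=> /filtP h; split=> [e|/filtP h']; last first.
  rewrite /layer_pr big1 // => H _; have [->|/h' lt] := eqVneq (cellc v H) 0; first by rewrite !scale0r.
  by case: eqP => [e|]; [rewrite e ltnn in lt|rewrite scaler0].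
apply/filtP => H nz; have := h _ nz; rewrite ltnS leq_eqVlt => /orP[/eqP/val_inj eH|//].
case/eqP: nz.
pose H' : half_diagram (S i) := exist (fun Q => is_true (is_half Q && (prop_labels Q == val (S i)))) _ (restrH_half eH).
have := cellc0 (V (S i)) H'; rewrite -e cellc_sum (bigD1 H) //= eH eqxx cellcZ.
rewrite -[restrH (sval H)]/(val H') cellc_vec eqxx mulr1 big1 ?addr0 // => H2 ne.
rewrite cellcZ; case: eqP => e2; last by rewrite cellc0 mulr0.
pose H2' : half_diagram (S i) := exist (fun Q => is_true (is_half Q && (prop_labels Q == val (S i)))) _ (restrH_half e2).
rewrite -[restrH (sval H2)]/(val H2') cellc_vec; case: eqP => [e3|]; last by rewrite mulr0.
by case/eqP: ne; apply: restrH_inj; exact: (congr1 val e3).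
Qed.

Lemma layer_iso i : mod_iso (subquot (filt_submod i.+1) (filt_submod i)) (V (S i)).
Proof.
apply: (@subquot_iso _ res (V (S i)) _ _ (pr i)).
- by move=> v w; exact: prD.
- by move=> p v Fv; have [_ ->] := okada_layer p Fv.
- by move=> v; exact: pr_ker.
by move=> x; have [v Fv e] := pr_onto x; exists v.
Qed.

Lemma filt_submod_cell i v : v \in filt_submod i.+1 <-> cell_filtration VT (S i) v.
Proof.
rewrite filt_submodE; split.
  move=> /filtP h; exists (cellc v); last exact: cellcE.
  by move=> H /h; rewrite ltnS -/(restrH _) (idxP S_pred) S_dom.
move=> [c h e]; apply/filtP => H; rewrite (cellc_uniq e) => /h.
by rewrite -/(restrH _) (idxP S_pred) S_dom.
Qed.

Definition canH i : prehalf n := mkh n (can (mem (val (S i)))).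

Lemma canH_half i : is_half (canH i) && (prop_labels (canH i) == val (S i)).
Proof.
have fS := iffLR (fib_fibP _ _) (valP (S i)).
by apply: ohalf_half => [|s]; [exact: can_ohalf|rewrite can_PL].
Qed.

Lemma filt_submod_strict i : {subset filt_submod i <= filt_submod i.+1} /\ ~ {subset filt_submod i.+1 <= filt_submod i}.
Proof.
split=> [v|h]; first by apply: filt_le.
pose H' : half_diagram (S i) := exist (fun Q => is_true (is_half Q && (prop_labels Q == val (S i)))) _ (canH_half i).
have /h/filtP : cell_vec VT (val (liftH H')) \in filt_submod i.+1 by apply: filt_vec; rewrite idx_liftH.
by move=> /(_ (liftH H')); rewrite cellc_vec eqxx oner_eq0 idx_liftH ltnn => /(_ isT).
Qed.

Lemma filt_submod_zero v : v \in filt_submod 0 <-> v = 0.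
Proof.
split=> [/filtP h|->]; last exact: filt0.
apply: cellc_inj => H; rewrite cellc0; apply/eqP; case: eqP => // /eqP /h; lia.
Qed.

Lemma filt_submod_all v : v \in filt_submod k.
Proof. exact: filt_top. Qed.

End Layers.

(** * Canonical words in the algebra *)

Section CanonicalWord.
Local Open Scope ring_scope.
Variables (K : fieldType) (X Y : nat -> K) (n : nat).
Implicit Types (f g : nat -> nat * nat) (U : fibset n) (w u v : seq nat).

Definition fib_pred U : pred nat := mem (val U).
Definition can_word U : seq nat := canw n (fib_pred U).
(** Proportional to an idempotent if the parameters are nonzero ([Ecan_sq]); it kills the
    heavier cell modules ([Ecan_kill]) and has rank one on its own ([Ecan_line], [Ecan_vec]). *)
Definition Ecan U : okada X Y n := Ew X Y n (can_word U).

Lemma fib_predP U : fibP n (fib_pred U).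
Proof. exact: (iffLR (fib_fibP _ _) (valP U)). Qed.

Lemma letters_can_word U : letters n (can_word U).
Proof. exact: (letters_canw (fib_predP U)). Qed.

Lemma weight_can U : weight n (can (fib_pred U)) = fset_weight (val U).
Proof. by apply: weight_fset (can_ohalf (fib_predP U)) _ => s; rewrite (can_PL (fib_predP U)). Qed.

Lemma scaleAl (M : lmodType (okada X Y n)) (l : K) (a : okada X Y n) (x : M) :
  (l *: a) *: x = l%:A *: (a *: x).
Proof. by have -> : l *: a = l%:A * a; [rewrite mulr_algl|rewrite scalerA]. Qed.

Lemma scaleC (M : lmodType (okada X Y n)) (l : K) (a : okada X Y n) (x : M) :
  a *: (l%:A *: x) = l%:A *: (a *: x).
Proof. by rewrite !scalerA mulr_algl mulr_algr. Qed.

Lemma can_word_weight U f : wf n f -> (weight n (hf n (La (can_word U) f)) <= fset_weight (val U))%N.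
Proof.
move=> w; rewrite -weight_can; have wP := wf_La (letters_can_word U) w.
exact: (arcs_le (fib_predP U) (hf_ohalf wP) (La_arcs_in (fib_predP U) (wf_good w))).
Qed.

Lemma can_word_can U f : wf n f -> weight n (hf n (La (can_word U) f)) = fset_weight (val U) ->
  eqh n (hf n (La (can_word U) f)) (can (fib_pred U)).
Proof.
move=> w; rewrite -weight_can => e; have wP := wf_La (letters_can_word U) w.
exact: (arcs_eq (fib_predP U) (hf_ohalf wP) (La_arcs_in (fib_predP U) (wf_good w)) e).
Qed.

Lemma Ew_eq w w' : nz X Y -> letters n w -> letters n w' ->
  eqa n (La w (idf n)) (La w' (idf n)) -> exists2 l, l != 0 & Ew X Y n w = l *: Ew X Y n w'.
Proof.
move=> h lw lw' e; have [l [l0 ->]] := Ew_Ed X Y lw; have [l' [l0' ->]] := Ew_Ed X Y lw'.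
exists (l / l'); first by rewrite mulf_neq0 ?invr_eq0 ?l0 ?l0'.
by rewrite scalerA divfK ?l0' // (Ed_eqa X Y e).
Qed.

Lemma Ecan_sq U : nz X Y -> exists2 l, l != 0 & Ecan U * Ecan U = l *: Ecan U.
Proof.
move=> h; have lP := letters_can_word U.
rewrite /Ecan -Ew_cat; apply: Ew_eq => //; first by rewrite /letters all_cat -/(letters n _) lP.
rewrite La_cat; apply: La_canw_fix (fib_predP U) (La_wf lP) _; exact: (hf_canw (fib_predP U)).
Qed.

Lemma Ecan_kill U U' (V : cell_module X Y U') (x : V) : (fset_weight (val U) < fset_weight (val U'))%N -> Ecan U *: x = 0.
Proof.
move=> lt; rewrite (cellcE x) scaler_sumr big1 // => H _; rewrite scaleC.
have [f w [-> ok]] := halfW H.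
have [c [-> h]] := cell_word V (letters_can_word U) w ok.
have [->|/h ok'] := eqVneq c 0; first by rewrite !scale0r scaler0.
have := can_word_weight U w; rewrite (okS_weight (wf_La (letters_can_word U) w) ok'); lia.
Qed.

Definition can_prehalf U : prehalf n := mkh n (can (fib_pred U)).

Lemma can_prehalf_half U : is_half (can_prehalf U) && (prop_labels (can_prehalf U) == val U).
Proof. by apply: ohalf_half => [|s]; [exact: (can_ohalf (fib_predP U))|rewrite (can_PL (fib_predP U))]. Qed.

Definition can_half U : half_diagram U := exist (fun Q => is_true (is_half Q && (prop_labels Q == val U))) _ (can_prehalf_half U).

Lemma Ecan_line U (V : cell_module X Y U) (x : V) :
  exists c : K, Ecan U *: x = c%:A *: cell_vec V (can_prehalf U).
Proof.
rewrite (cellcE x) scaler_sumr.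
suff /fin_all_exists[c hc] : forall H, exists c : K, Ecan U *: ((cellc x H)%:A *: cell_vec V (val H)) = c%:A *: cell_vec V (can_prehalf U).
  exists (\sum_H c H); rewrite (eq_bigr _ (fun H _ => hc H)) scaler_suml.
  by rewrite scaler_suml.
move=> H; rewrite scaleC.
have [f w [-> ok]] := halfW H.
have [c [-> h]] := cell_word V (letters_can_word U) w ok.
have [->|/h ok'] := eqVneq c 0; first by exists 0; rewrite !scale0r scaler0.
exists (cellc x H * c); rewrite scalerA mulr_algl scalerA; congr (_ *: cell_vec V _).
have wP := wf_La (letters_can_word U) w.
rewrite /lh mkh_left //; apply: eq_mkh; apply: can_word_can => //.
exact: okS_weight wP ok'.
Qed.

Lemma Ecan_vec U (V : cell_module X Y U) : nz X Y ->
  exists2 c : K, c != 0 & Ecan U *: cell_vec V (can_prehalf U) = c%:A *: cell_vec V (can_prehalf U).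
Proof.
move=> hnz; have lP := letters_can_word U; set f := La (can_word U) (idf n).
have w : wf n f := La_wf lP.
have hc : eqh n (hf n f) (can (fib_pred U)) := hf_canw (fib_predP U).
have e : can_prehalf U = lh n f by rewrite /lh mkh_left //; apply: eq_mkh; exact: eqh_sym.
have ok : okS U f by rewrite /okS -e; have /andP[] := can_prehalf_half U.
rewrite e /Ecan; move: (lP) (can_arcs (fib_predP U) hc); rewrite -/(can_word U).
elim: (can_word U) => [_ _|a s IH /= /andP[aN ls] h].
  by exists 1; rewrite ?oner_eq0 // Ew0 !scale1r.
have [|c c0 ec] := IH ls; first by move=> b bs; apply: h; rewrite inE bs orbT.
have ef : eqa n (lact a f) f.
  by apply: (@La_fix n [:: a]) (wf_good w) _; rewrite /= ?aN // => b; rewrite inE => /eqP ->; apply: h; rewrite inE eqxx.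
rewrite Ew_cons -scalerA ec scaleC cell_gen //.
have -> : okS U (lact a f) by rewrite /okS (lh_eqa ef).
rewrite (lh_eqa ef) scalerA mulr_algl scalerA.
eexists; last by [].
by rewrite mulf_neq0 //; have [_ ->] := lambda_spec X Y aN w.
Qed.

(** E_D for the diagram D with canonical left half and right half H. *)
Definition Eleft U (H : half_diagram U) : okada X Y n := Ed X Y n (com n (can (fib_pred U)) (ph (val H))).

Lemma can_samep U (H : half_diagram U) : samep n (can (fib_pred U)) (ph (val H)).
Proof. by move=> s; rewrite half_PL (can_PL (fib_predP U)). Qed.

Lemma com_eqa h r r' : ohalf n h -> ohalf n r -> ohalf n r' -> samep n h r -> eqh n r r' ->
  eqa n (com n h r) (com n h r').
Proof.
move=> oh or or' hr e; have hr' := samep_trans hr (eqh_samep e).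
apply: half_eqa; [exact: com_wf|exact: com_wf| |].
  exact: (eqh_trans (com_hf oh or hr) (eqh_sym (com_hf oh or' hr'))).
apply: eqh_trans (com_rhf oh or hr) (eqh_trans e _).
exact: (eqh_sym (com_rhf oh or' hr')).
Qed.

Lemma Ecan_Eleft U (H : half_diagram U) : nz X Y -> exists2 l, l != 0 & Ecan U * Eleft H = l *: Eleft H.
Proof.
move=> hnz; have oc := can_ohalf (fib_predP U); have oH := half_ohalf H; have sH := can_samep H.
have w := com_wf oc oH sH; have [v [lv ev]] := wf_word w.
have lP := letters_can_word U.
have [l [l0 e]] := Ew_Ed X Y lv.
have -> : Eleft H = l^-1 *: Ew X Y n v.
  by rewrite e scalerA mulVf ?l0 // scale1r; apply: Ed_eqa; exact: eqa_sym.
rewrite -scalerAr -Ew_cat.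
have [||l' l0' ->] := @Ew_eq (can_word U ++ v) v hnz _ lv _.
- by rewrite /letters all_cat -!/(letters n _) lP.
- rewrite La_cat; apply: eqa_trans (La_eqa lP ev) (eqa_trans _ (eqa_sym ev)).
  by apply: La_canw_fix (fib_predP U) w _; exact: com_hf.
by exists l' => //; rewrite !scalerA mulrC.
Qed.

(** The diagram of A_P A_w, with P the canonical word, contains the short arcs of the canonical half
    diagram. If its weight is that of U, its left half is canonical by [arcs_eq]; otherwise the
    diagram is lighter and factors through a lighter canonical word by [factor_can]. *)
Lemma Ecan_word U w : nz X Y -> letters n w ->
  (exists H : half_diagram U, exists l, Ecan U * Ew X Y n w = l *: Eleft H) \/
  (exists U' u v l, [/\ (fset_weight (val U') < fset_weight (val U))%N, letters n u, letters n v &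
     Ecan U * Ew X Y n w = l *: (Ew X Y n u * (Ecan U' * Ew X Y n v))]).
Proof.
move=> hnz lw; have lP := letters_can_word U.
have lPw : letters n (can_word U ++ w) by rewrite /letters all_cat -!/(letters n _) lP.
set D := La (can_word U ++ w) (idf n).
have wD : wf n D := La_wf lPw.
have eD : D = La (can_word U) (La w (idf n)) by rewrite -La_cat.
have o := hf_ohalf wD.
have ePL s : s \in prop_labels (lh n D) <-> PL n (hf n D) s.
  by rewrite prop_labelsP; exact: (eqh_samep (lh_ph wD)).
have fib : is_fibonacci n (prop_labels (lh n D)) by apply/fib_fibP; exact: ohalf_fib o ePL.
pose U' : fibset n := exist (fun A => is_true (is_fibonacci n A)) _ fib.
have wt : weight n (hf n D) = fset_weight (val U') by apply: weight_fset.
have := can_word_weight U (La_wf lw); rewrite -eD wt leq_eqVlt => /orP[/eqP e|lt]; [left|right].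
  have hc : eqh n (hf n D) (can (fib_pred U)) by rewrite eD; apply: can_word_can (La_wf lw) _; rewrite -eD wt.
  have oc := can_ohalf (fib_predP U).
  have oR := rhf_ohalf wD.
  have sR : samep n (can (fib_pred U)) (rhf n D).
    exact: (samep_trans (samep_sym (eqh_samep hc)) (half_samep wD)).
  have hR : is_half (mkh n (rhf n D)) && (prop_labels (mkh n (rhf n D)) == val U).
    by apply: ohalf_half => // s; rewrite -(can_PL (fib_predP U)).
  pose H : half_diagram U := exist (fun Q => is_true (is_half Q && (prop_labels Q == val U))) _ hR.
  have [l [_ el]] := Ew_Ed X Y lPw.
  exists H, l; rewrite /Ecan -Ew_cat el; congr (_ *: _); apply: Ed_eqa; rewrite -/D.
  have eH : eqh n (ph (val H)) (rhf n D) := ph_mkh oR.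
  apply: eqa_trans (com_eqa oc oR (half_ohalf H) sR (eqh_sym eH)).
  apply: half_eqa wD (com_wf oc oR sR) _ _.
    exact: eqh_trans hc (eqh_sym (com_hf oc oR sR)).
  exact: (eqh_sym (com_rhf oc oR sR)).
have [u [v [lu lv e]]] := factor_can (fib_predP U') wD (fun s => iff_sym (ePL s)).
have lP' := letters_can_word U'.
have [||l _ el] := @Ew_eq (can_word U ++ w) (u ++ (can_word U' ++ v)) hnz lPw _ _.
- by rewrite /letters !all_cat -!/(letters n _) lu lv lP'.
- by rewrite !La_cat -La_cat -/D; exact: eqa_sym.
by exists U', u, v, l; split=> //; rewrite /Ecan -!Ew_cat.
Qed.

End CanonicalWord.

(** * Extending the projections onto the layers *)

Section Extension.
Local Open Scope ring_scope.
Variable K : fieldType.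

Lemma ffun_onto (I : finType) (g : {ffun I -> K} -> {ffun I -> K}) :
  (forall x y, g (x + y) = g x + g y) ->
  (forall (c : K) (x : {ffun I -> K}), g [ffun i => c * x i] = [ffun i => c * g x i]) ->
  (forall x, g x = 0 -> x = 0) -> forall y, exists x, g x = y.
Proof.
move=> gD gZ g0 y.
pose W : vectType K := {ffun I -> K^o}.
pose g' : W -> W := g.
have gl : linear g'.
  move=> c x z; have -> : c *: x + z = ([ffun i => c * x i] : {ffun I -> K}) + z by apply/ffunP => i; rewrite !ffunE.
  by rewrite /g' gD gZ; apply/ffunP => i; rewrite !ffunE.
pose L : {linear W -> W} := HB.pack g' (GRing.isLinear.Build K W W *:%R g' gl).
have ker : lker (linfun L) == 0%VS.
  by apply/lker0P => x z; rewrite !lfunE /= => e; apply/eqP; rewrite -subr_eq0; apply/eqP/g0;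
     rewrite -[g _]/(L (x - z)) raddfB /= /g' -[g x]/(L x) -[g z]/(L z) [L x]e subrr.
have full : limg (linfun L) = fullv.
  by apply/eqP; rewrite eqEdim subvf /= -(limg_ker_dim (linfun L) fullv) (eqP ker) capv0 dimv0 add0n.
have : (y : W) \in limg (linfun L) by rewrite full memvf.
by case/memv_imgP => x _ ->; exists x; rewrite lfunE.
Qed.

End Extension.

Section Splitting.
Local Open Scope ring_scope.
Variables (K : fieldType) (X Y : nat -> K) (n : nat) (T : fibset n.+1) (k : nat).
Variables (S : 'I_k -> fibset n) (VT : cell_module X Y T) (V : forall U : fibset n, cell_module X Y U).
Hypothesis S_incr : forall i j : 'I_k, (i < j)%N -> (S i != S j) && dominance (val (S i)) (val (S j)).
Hypothesis S_pred : forall U : fibset n, fib_covers (val U) (val T) <-> exists i, S i = U.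
Hypothesis hnz : nz X Y.
Hypothesis S_simple : forall i : 'I_k, simple_mod (V (S i)).
Implicit Types (f g : nat -> nat * nat) (v w : VT) (i j : 'I_k).

Local Notation pr := (layer_pr V S_pred).
Local Notation filt := (filt (VT := VT) S_pred).
Local Notation res := (resmod (okada_incl X Y n) VT).
Local Notation incl := (okada_incl X Y n).
Local Notation layer := (okada_layer V S_incr).

(** Let e v lie in a step j + 1 > m. Its image in the layer j is killed by e, as that layer is
    heavier, but is also multiplied by a nonzero scalar since e is proportional to an
    idempotent. Hence the image vanishes, and e v lies in the step j. *)
Lemma Ecan_filt U m v : (forall j, (m <= j)%N -> (fset_weight (val U) < fset_weight (val (S j)))%N) ->
  filt m (incl (Ecan X Y U) *: v).
Proof.
move=> lt; set v' := _ *: v.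
have [l l0 e] := Ecan_sq U hnz.
have ev : incl (Ecan X Y U) *: v' = l%:A *: v'.
  by rewrite /v' scalerA -rmorphM /= e incl_scale scaleAl.
have [km|mk] := leqP k m; first by apply: filt_le km _; exact: filt_top.
suff h d : (d <= k - m)%N -> filt (k - d)%N v'.
  by have := h (k - m)%N (leqnn _); rewrite subKn //; exact: ltnW.
elim: d => [_|d IH dk]; first by rewrite subn0; exact: filt_top.
have jk : (k - d.+1 < k)%N by lia.
pose j := Ordinal jk.
have Fj : filt j.+1 v'.
  have -> : j.+1 = (k - d)%N by rewrite /=; lia.
  by apply: IH; lia.
apply/(pr_ker V Fj).
have [_ h] := layer (Ecan X Y U) Fj.
have := h j (leqnn _); rewrite ev prZ Ecan_kill; last by apply: lt; rewrite /=; lia.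
move=> e0; have := congr1 (fun x => l^-1%:A *: x) e0.
by rewrite scaler0 scalerA mulr_algl scalerA mulVf // !scale1r.
Qed.

Let e i := Ecan X Y (S i).

(** These x form a submodule, which is proper because e multiplies the canonical vector by a
    nonzero scalar. *)
Lemma simple_zero i (x : V (S i)) : (forall a, e i *: (a *: x) = 0) -> x = 0.
Proof.
pose Z : {pred V (S i)} := fun x => `[< forall a, e i *: (a *: x) = 0 >].
have cl : subsemimod_closed Z.
  split; first split.
  - by apply/asboolP => a; rewrite !scaler0.
  - move=> y z /asboolP hy /asboolP hz; apply/asboolP => a.
    by rewrite !scalerDr hy hz addr0.
  - by move=> b y /asboolP hy; apply/asboolP => a; rewrite scalerA.
pose ZZ : submodClosed (V (S i)) := HB.pack Z (GRing.isSubSemiModClosed.Build _ (V (S i)) Z cl).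
have [_ /(_ ZZ) [h|h]] := S_simple i.
  by move=> hx; apply: h; apply/asboolP.
have /asboolP/(_ 1) := h (cell_vec (V (S i)) (can_prehalf (S i))); rewrite scale1r.
have [c c0 ->] := Ecan_vec (V (S i)) hnz.
move=> /(congr1 (fun x => c^-1%:A *: x)); rewrite scaler0 scalerA mulr_algl scalerA mulVf // !scale1r.
by move=> /eqP; rewrite (negPf (vec_neq0 (V (S i)) (can_half (S i)))).
Qed.

Lemma line_inj i (y z : V (S i)) (c d : K) :
  y = c%:A *: cell_vec (V (S i)) (can_prehalf (S i)) -> z = d%:A *: cell_vec (V (S i)) (can_prehalf (S i)) ->
  cellc y (can_half (S i)) = cellc z (can_half (S i)) -> y = z.
Proof.
by move=> -> ->; rewrite -[can_prehalf _]/(val (can_half (S i))) !cellcZ cellc_vec eqxx !mulr1 => ->.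
Qed.

Lemma Eleft_line i (H : half_diagram (S i)) (x : V (S i)) :
  exists c : K, Eleft X Y H *: x = c%:A *: cell_vec (V (S i)) (can_prehalf (S i)).
Proof.
have [l l0 el] := Ecan_Eleft H hnz.
have -> : Eleft X Y H = l^-1 *: (Ecan X Y (S i) * Eleft X Y H) by rewrite el scalerA mulVf // scale1r.
rewrite scaleAl -scalerA; have [c ->] := Ecan_line (Eleft X Y H *: x).
by exists (l^-1 * c); rewrite scalerA mulr_algl scalerA.
Qed.

Lemma Ecan_low i v : filt i.+1 (incl (e i) *: v).
Proof. by apply: Ecan_filt => j ij; exact: S_weight. Qed.

Lemma Eleft_low i (H : half_diagram (S i)) v :
  filt i.+1 (incl (Eleft X Y H) *: v) /\
  exists c : K, pr i (incl (Eleft X Y H) *: v) = c%:A *: cell_vec (V (S i)) (can_prehalf (S i)).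
Proof.
have [l l0 el] := Ecan_Eleft H hnz.
have eb : Eleft X Y H = l^-1 *: (e i * Eleft X Y H) by rewrite el scalerA mulVf // scale1r.
have F : filt i.+1 (incl (Eleft X Y H) *: v).
  rewrite eb incl_scale rmorphM /= scaleAl -scalerA; apply: filtZ; exact: Ecan_low.
split=> //; have [_ /(_ i (leqnn _)) h] := layer (e i) F.
rewrite eb incl_scale scaleAl prZ rmorphM /= -scalerA h.
have [c ->] := Ecan_line (pr i (incl (Eleft X Y H) *: v)).
by exists (l^-1 * c); rewrite scalerA mulr_algl scalerA.
Qed.

(** A word either is one of the elements for which the equation is assumed, after
    multiplication by e, or passes through a lighter canonical word; the latter kills x, and
    maps v into the step below, on which the projection vanishes. *)
Lemma Ecan_pr i (x : V (S i)) v :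
  (forall H : half_diagram (S i), Eleft X Y H *: x = pr i (incl (Eleft X Y H) *: v)) ->
  forall a, e i *: (a *: x) = pr i (incl (e i) *: (incl a *: v)).
Proof.
move=> hx a; have [s [ls ->]] := okada_span a.
rewrite rmorph_sum /= !scaler_suml !scaler_sumr pr_sum big_seq_cond [RHS]big_seq_cond.
apply: eq_bigr => -[c w] /andP[/(allP ls) /= lw _].
rewrite incl_scale (scaleAl c (Ew X Y n w)) (scaleAl c (incl _)) scaleC [in RHS]scaleC prZ; congr (_ *: _).
rewrite !scalerA -rmorphM /=.
case: (Ecan_word (S i) hnz lw) => [[H [l ->]]|[U' [u [w' [l [lt lu lw' ->]]]]]].
  by rewrite incl_scale (scaleAl l (Eleft X Y H)) (scaleAl l (incl _)) prZ hx.
rewrite incl_scale (scaleAl l (Ew X Y n u * _)) (scaleAl l (incl _)) prZ.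
have -> : (Ew X Y n u * (Ecan X Y U' * Ew X Y n w')) *: x = 0.
  by rewrite -!scalerA Ecan_kill // scaler0.
rewrite !rmorphM /= -!scalerA.
have F : filt i (incl (Ecan X Y U') *: (incl (Ew X Y n w') *: v)).
  apply: Ecan_filt => j; rewrite leq_eqVlt => /orP[/eqP/val_inj <- //|/(S_weight S_incr)]; lia.
have [F' _] := layer (Ew X Y n u) F.
have /(pr_ker V (filt_le (leqnSn i) F')) -> := F'.
by rewrite scaler0.
Qed.

(** By [Ecan_pr] it suffices to solve the equations for the elements [Eleft H]. Both sides of each
    lie on the line of the canonical vector, so this is a system of scalar equations indexed by
    the same set as the coordinates of x. The homogeneous system has no nonzero solution
    by [simple_zero]. *)
Lemma ext_ex i v : exists x : V (S i), forall a, e i *: (a *: x) = pr i (incl (e i) *: (incl a *: v)).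
Proof.
pose vv (c : {ffun half_diagram (S i) -> K}) : V (S i) := \sum_H (c H)%:A *: cell_vec (V (S i)) (val H).
have vvc c : cellc (vv c) = c by apply: cellc_uniq.
pose g c : {ffun half_diagram (S i) -> K} := [ffun H => cellc (Eleft X Y H *: vv c) (can_half (S i))].
have vvD c d : vv (c + d) = vv c + vv d.
  by apply: cellc_inj => H; rewrite cellcD !vvc ffunE.
have vvZ (b : K) (c : {ffun half_diagram (S i) -> K}) : vv [ffun H => b * c H] = b%:A *: vv c.
  by apply: cellc_inj => H; rewrite cellcZ !vvc ffunE.
have bx0 c : g c = 0 -> forall H : half_diagram (S i), Eleft X Y H *: vv c = 0.
  move=> g0 H; have [d ed] := Eleft_line H (vv c).
  apply: (line_inj ed (d := 0)); first by rewrite !scale0r.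
  by have := congr1 (fun f : {ffun _ -> K} => f H) g0; rewrite !ffunE => ->; rewrite cellc0.
have [|||c ec] := @ffun_onto K _ g _ _ _ [ffun H => cellc (pr i (incl (Eleft X Y H) *: v)) (can_half (S i))].
- by move=> c d; apply/ffunP => H; rewrite !ffunE vvD scalerDr cellcD.
- by move=> b c; apply/ffunP => H; rewrite !ffunE vvZ scaleC cellcZ.
- move=> c /bx0 c0; rewrite -[c]vvc.
  have -> : vv c = 0; last by apply/ffunP => H; rewrite cellc0 ffunE.
  apply: simple_zero => a; rewrite (@Ecan_pr i (vv c) 0) ?scaler0 ?pr0 //.
  by move=> H; rewrite c0 !scaler0 pr0.
exists (vv c); apply: Ecan_pr => H.
have [d ed] := Eleft_line H (vv c); have [_ [d' ed']] := Eleft_low H v.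
apply: (line_inj ed ed').
by have := congr1 (fun f : {ffun _ -> K} => f H) ec; rewrite !ffunE.
Qed.

(** The module map onto the layer that extends the projection, see [extZ] and [ext_pr]. *)
Definition ext i v : V (S i) := sval (cid (ext_ex i v)).

Lemma extP i v a : e i *: (a *: ext i v) = pr i (incl (e i) *: (incl a *: v)).
Proof. by rewrite /ext; case: cid. Qed.

Lemma ext_uniq i v (x : V (S i)) :
  (forall a, e i *: (a *: x) = pr i (incl (e i) *: (incl a *: v))) -> ext i v = x.
Proof.
move=> hx; apply/eqP; rewrite -subr_eq0; apply/eqP/simple_zero => a.
by rewrite !scalerBr extP hx subrr.
Qed.

Lemma extD i v w : ext i (v + w) = ext i v + ext i w.
Proof. by apply: ext_uniq => a; rewrite !scalerDr prD !extP. Qed.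

Lemma extZ i (p : okada X Y n) v : ext i (incl p *: v) = p *: ext i v.
Proof. by apply: ext_uniq => a; rewrite [a *: _]scalerA extP rmorphM /= -!scalerA. Qed.

Lemma ext_pr i v : filt i.+1 v -> ext i v = pr i v.
Proof.
move=> F; apply: ext_uniq => a.
have [F' h'] := layer a F; have [_ h] := layer (e i) F'.
by rewrite h // h'.
Qed.

End Splitting.

(** * The direct sum decomposition *)

Section FiniteSupport.
Local Open Scope ring_scope.

Lemma finite_supp_surj (R : nzRingType) (I : Type) (M : I -> lmodType R) (k : nat) (s : 'I_k -> I) :
  (forall x, exists i, s i = x) -> forall u : Defs.dprod M, u \in @finite_supp R I M.
Proof.
move=> hs u; apply/asboolP; apply: (@sub_finite_set _ _ (s @` setT)%classic).
  by move=> x _; have [i <-] := hs x; exists i.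
by apply: finite_image; exact: finite_finset.
Qed.

End FiniteSupport.

Section Sums.
Local Open Scope ring_scope.
Variables (K : fieldType) (X Y : nat -> K) (n : nat) (T : fibset n.+1) (k : nat).
Variables (S : 'I_k -> fibset n) (VT : cell_module X Y T) (V : forall U : fibset n, cell_module X Y U).
Hypothesis S_incr : forall i j : 'I_k, (i < j)%N -> (S i != S j) && dominance (val (S i)) (val (S j)).
Hypothesis S_pred : forall U : fibset n, fib_covers (val U) (val T) <-> exists i, S i = U.

Local Notation res := (resmod (okada_incl X Y n) VT).
Local Notation DS := (dsum (fun i : 'I_k => V (S i) : lmodType (okada X Y n))).

Definition mkDS (u : forall i : 'I_k, V (S i)) : DS :=
  exist _ u (@finite_supp_surj _ _ (fun i : 'I_k => V (S i) : lmodType (okada X Y n)) k id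
    (fun x => ex_intro _ x erefl) u).

Section Simple.
Hypothesis hnz : nz X Y.
Hypothesis S_simple : forall i : 'I_k, simple_mod (V (S i)).
Local Notation ext := (ext (VT := VT) S_incr S_pred hnz S_simple).
Local Notation filt := (filt (VT := VT) S_pred).

(** On the step j + 1 of the filtration the j-th map is the projection, with kernel the step j. *)
Lemma ext_zero v : (forall i, ext i v = 0) -> v = 0.
Proof.
move=> h; apply/(filt_submod_zero V S_incr S_pred); rewrite filt_submodE.
suff s d : (d <= k)%N -> filt (k - d)%N v by rewrite -(subnn k); exact: s.
elim: d => [_|d IH dk]; first by rewrite subn0; exact: filt_top.
have jk : (k - d.+1 < k)%N by lia.
pose j := Ordinal jk.
have Fj : filt j.+1 v.
  have -> : j.+1 = (k - d)%N by rewrite /=; lia.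
  by apply: IH; lia.
by apply/(pr_ker V Fj); rewrite -(ext_pr S_incr hnz S_simple Fj).
Qed.

(** Correct the components from the last one down: a vector in the step j + 1 does not affect
    the components after j. *)
Lemma ext_onto (y : forall i, V (S i)) : exists v, forall i, ext i v = y i.
Proof.
suff s d : (d <= k)%N -> exists v, forall j : 'I_k, (k - d <= j)%N -> ext j v = y j.
  by have [v hv] := s k (leqnn k); exists v => i; apply: hv; lia.
elim: d => [_|d IH dk]; first by exists 0 => j; have := ltn_ord j; lia.
have [v hv] := IH (ltnW dk).
have jk : (k - d.+1 < k)%N by lia.
pose i := Ordinal jk.
have [u Fu eu] := pr_onto VT S_incr S_pred (y i - ext i v).
exists (v + u) => j; rewrite leq_eqVlt => /orP[/eqP e|lt].
  have -> : j = i by apply: val_inj.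
  by rewrite extD (ext_pr S_incr hnz S_simple Fu) eu addrC subrK.
rewrite extD hv; last by lia.
have Fj : filt j u by apply: filt_le Fu; rewrite /=; lia.
rewrite (ext_pr S_incr hnz S_simple (filt_le (leqnSn j) Fj)).
by have /(pr_ker V (filt_le (leqnSn j) Fj)) -> := Fj; rewrite addr0.
Qed.

Lemma res_iso : mod_iso res DS.
Proof.
apply: (@bij_iso _ res DS (fun v => mkDS (fun i => ext i v))).
- by move=> v w; apply: val_inj; apply: functional_extensionality_dep => i; exact: extD.
- by move=> a v; apply: val_inj; apply: functional_extensionality_dep => i; exact: extZ.
- apply: kernel0_inj => [v w|v e]; first by apply: val_inj; apply: functional_extensionality_dep => i; exact: extD.
  apply: ext_zero => i; exact: (congr1 (fun u : DS => val u i) e).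
move=> u; have [v hv] := ext_onto (val u); exists v.
by apply: val_inj; apply: functional_extensionality_dep => i; exact: hv.
Qed.

End Simple.

Local Notation I := {U : fibset n | fib_covers (val U) (val T)}.
Local Notation DU := (dsum (fun U : I => V (val U) : lmodType (okada X Y n))).

Lemma S_covers i : fib_covers (val (S i)) (val T).
Proof. by apply/S_pred; exists i. Qed.

Definition sI i : I := exist (fun U : fibset n => is_true (fib_covers (val U) (val T))) (S i) (S_covers i).

Lemma sI_onto (U : I) : exists i, sI i = U.
Proof.
have [i e] := iffLR (S_pred (val U)) (valP U).
by exists i; apply: val_inj.
Qed.

Lemma reindex_iso : mod_iso DS DU.
Proof.
apply: mod_iso_sym.
apply: (@bij_iso _ DU DS (fun w => mkDS (fun i => val w (sI i)))).
- by move=> v w; apply: val_inj; apply: functional_extensionality_dep => i.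
- by move=> a v; apply: val_inj; apply: functional_extensionality_dep => i.
- move=> w w' e; apply: val_inj; apply: functional_extensionality_dep => U.
  have [i <-] := sI_onto U; exact: (congr1 (fun u : DS => val u i) e).
move=> u.
have /= ex (U : I) : exists x : V (val U), forall i (e : S i = val U), x = eq_rect _ (fun A => V A) (val u i) _ e.
  have [i0 e0] := iffLR (S_pred (val U)) (valP U).
  exists (eq_rect _ (fun A => V A) (val u i0) _ e0) => i e.
  (* the predecessors are distinct, so the transport of u does not depend on the index *)
  have ii : i = i0 by apply: (S_inj S_incr); rewrite e e0.
  subst i0; by rewrite (eq_irrelevance e e0).
pose w : Defs.dprod (fun U : I => V (val U) : lmodType (okada X Y n)) := fun U => sval (cid (ex U)).
exists (exist _ w (finite_supp_surj sI_onto w)).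
apply: val_inj; apply: functional_extensionality_dep => i /=.
by rewrite /w; case: cid => x /= /(_ i erefl).
Qed.

End Sums.

Local Open Scope ring_scope.

Theorem proposition6p6 (K : fieldType) (X Y : nat -> K) (n : nat)
    (T : fibset n.+1) (k : nat) (S : 'I_k -> fibset n)
    (VT : cell_module X Y T) (V : forall U : fibset n, cell_module X Y U)
    (S_incr : forall i j : 'I_k, (i < j)%N ->
       (S i != S j) && dominance (val (S i)) (val (S j)))
    (S_pred : forall U : fibset n,
       fib_covers (val U) (val T) <-> exists i, S i = U) :
  (exists F : nat -> submodClosed (resmod (okada_incl X Y n) VT),
     [/\ forall v, v \in F 0%N <-> v = 0,
         forall (i : 'I_k) v, v \in F i.+1 <-> cell_filtration VT (S i) v,
         forall v, v \in F k,
         forall i : 'I_k, {subset F i <= F i.+1} /\ ~ {subset F i.+1 <= F i}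
       & forall i : 'I_k, mod_iso (subquot (F i.+1) (F i)) (V (S i))])
  /\
  ((forall i, (0 < i)%N -> X i != 0 /\ Y i != 0) ->
   (forall i : 'I_k, simple_mod (V (S i))) ->
   mod_iso (resmod (okada_incl X Y n) VT) (dsum (fun i : 'I_k => V (S i))) /\
   mod_iso (dsum (fun i : 'I_k => V (S i)))
           (dsum (fun U : {U : fibset n | fib_covers (val U) (val T)} =>
                    V (val U)))).
Proof.
split.
  exists (filt_submod VT V S_incr S_pred); split.
  - by move=> v; exact: filt_submod_zero.
  - by move=> i v; exact: filt_submod_cell.
  - by move=> v; exact: filt_submod_all.
  - by move=> i; exact: filt_submod_strict.
  by move=> i; exact: layer_iso.
move=> hnz simp; split; first exact: (res_iso VT S_incr S_pred hnz simp).
exact: (reindex_iso V S_incr S_pred).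
Qed.
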